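(* Let $p$ be a prime, $n, m\ge 1$ integers, and $K/F$ a cyclic Galois extension of degree $p^n$ with Galois group $G=\langle\sigma\rangle$. Suppose that $F$ contains a primitive $p$-th root of unity $\xi_p$. If $p=2$ and $n=1$, suppose that $-1\in N_{K/F}(K^\times)$ as well. Let $J_m=K^\times/K^{\times p^m}$. Then, as $R_mG$-modules, $$J_m\simeq X\oplus\bigoplus_{i=0}^n Y_i,$$ where for some $\mathbf a=(a_0,\dots,a_{m-1})\in\{-\infty,0,\dots,n\}^m$ and some $d\in U_1$: (1) $X$ is an indecomposable $R_mG$-module isomorphic to $X_{\mathbf a,d,m}$; and (2) for each $i$, $Y_i$ is a free $R_mG_i$-module of rank $e(i,m)$, where $$e(i,m)+|\{j: 0\le j<m,\ a_j=i\}|=e_i(K/F),\qquad 0\le i<n,$$ $$e(n,m)+1+|\{j: 0\le j<m,\ a_j=n\}|=e_n(K/F).$$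
   Context: $R_m=\mathbb Z/p^m\mathbb Z$. For $0\le i\le n$, $K_i$ is the intermediate field of $K/F$ of degree $p^i$ over $F$, and $G_i=\mathrm{Gal}(K_i/F)$, a quotient of $G$; $R_mG_i$-modules are viewed as $R_mG$-modules via $G\to G_i$. $J_m$ carries the natural $G$-action. $U_1=1+p\mathbb Z$. For $d\in U_1$ and $\mathbf a\in\{-\infty,0,\dots,n\}^m$, $X_{\mathbf a,d}$ is the $\mathbb Z_pG$-module with generators $y,x_0,\dots,x_{m-1}$ and defining relations $$(\sigma-d)y=\sum_{i=0}^{m-1}p^ix_i,\qquad \sigma^{p^{a_i}}x_i=x_i\quad (0\le i\le m-1),$$ with the convention $\sigma^{p^{-\infty}}=0$ (so $x_i=0$ when $a_i=-\infty$). Put $X_{\mathbf a,d,m}=X_{\mathbf a,d}/p^mX_{\mathbf a,d}$. The (possibly infinite) cardinals $e_i(K/F)$ are $$e_i(K/F)=\dim_{\mathbb F_p}\frac{N_{K_i/F}(K_i^\times)F^{\times p}}{N_{K_{i+1}/F}(K_{i+1}^\times)F^{\times p}}\ (0\le i<n),\qquad e_n(K/F)=\dim_{\mathbb F_p}\frac{N_{K/F}(K^\times)F^{\times p}}{F^{\times p}}.$$ The module $\{0\}$ is regarded as free (of rank $0$) over any ring. *)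

(* Defs.v *)
From HB Require Import structures.
From mathcomp Require Import all_boot all_order all_algebra all_fingroup all_field.
From mathcomp Require Import boolp.

Set Implicit Arguments.
Unset Strict Implicit.
Unset Printing Implicit Defensive.

Import GRing.Theory.
Local Open Scope ring_scope.

Local Notation funext_dep := functional_extensionality_dep.
Local Notation repr := generic_quotient.repr.

(* Products of a family of modules or rings; for a finite index type this is
   also the direct sum. *)
Definition famprod (I : Type) (V : I -> Type) := forall i, V i.

Section FamprodChoice.
Variables (I : Type) (V : I -> choiceType).
HB.instance Definition _ := Choice.copy (famprod V) (forall i, V i).
End FamprodChoice.

Section FamprodZmod.
Variables (I : Type) (V : I -> zmodType).
Implicit Types x y z : famprod V.

Definition famprod_zero : famprod V := fun i => 0.
Definition famprod_opp x : famprod V := fun i => - x i.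
Definition famprod_add x y : famprod V := fun i => x i + y i.

Fact famprod_addA : associative famprod_add.
Proof. by move=> x y z; apply: funext_dep => i; apply: addrA. Qed.
Fact famprod_addC : commutative famprod_add.
Proof. by move=> x y; apply: funext_dep => i; apply: addrC. Qed.
Fact famprod_add0 : left_id famprod_zero famprod_add.
Proof. by move=> x; apply: funext_dep => i; apply: add0r. Qed.
Fact famprod_addN : left_inverse famprod_zero famprod_opp famprod_add.
Proof. by move=> x; apply: funext_dep => i; apply: addNr. Qed.
HB.instance Definition _ := GRing.isZmodule.Build (famprod V)
  famprod_addA famprod_addC famprod_add0 famprod_addN.
End FamprodZmod.

Section FamprodLmod.
Variables (R : pzRingType) (I : Type) (V : I -> lmodType R).

Definition famprod_scale (c : R) (x : famprod V) : famprod V := fun i => c *: x i.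

Fact famprod_scaleA a b x :
  famprod_scale a (famprod_scale b x) = famprod_scale (a * b) x.
Proof. by apply: funext_dep => i; apply: scalerA. Qed.
Fact famprod_scale1 : left_id 1 famprod_scale.
Proof. by move=> x; apply: funext_dep => i; apply: scale1r. Qed.
Fact famprod_scaleDr : right_distributive famprod_scale +%R.
Proof. by move=> c x y; apply: funext_dep => i; apply: scalerDr. Qed.
Fact famprod_scaleDl x : {morph famprod_scale^~ x : a b / a + b}.
Proof. by move=> a b; apply: funext_dep => i; apply: scalerDl. Qed.
HB.instance Definition _ := GRing.Zmodule_isLmodule.Build R (famprod V)
  famprod_scaleA famprod_scale1 famprod_scaleDr famprod_scaleDl.
End FamprodLmod.

Section FamprodRing.
Variables (I : Type) (V : I -> comPzRingType).
Implicit Types x y z : famprod V.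

Definition famprod_one : famprod V := fun i => 1.
Definition famprod_mul x y : famprod V := fun i => x i * y i.

Fact famprod_mulA : associative famprod_mul.
Proof. by move=> x y z; apply: funext_dep => i; apply: mulrA. Qed.
Fact famprod_mulC : commutative famprod_mul.
Proof. by move=> x y; apply: funext_dep => i; apply: mulrC. Qed.
Fact famprod_mul1 : left_id famprod_one famprod_mul.
Proof. by move=> x; apply: funext_dep => i; apply: mul1r. Qed.
Fact famprod_mulDl : left_distributive famprod_mul +%R.
Proof. by move=> x y z; apply: funext_dep => i; apply: mulrDl. Qed.
HB.instance Definition _ := GRing.Zmodule_isComPzRing.Build (famprod V)
  famprod_mulA famprod_mulC famprod_mul1 famprod_mulDl.
End FamprodRing.

(* The ring of p-adic integers, as the inverse limit of the rings Z/p^(k+1). *)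
Section Padic.
Variable p : nat.

Definition padic_compat : {pred famprod (fun k => 'Z_(p ^ k.+1))} :=
  fun x => `[< forall k, x k = (x k.+1 : nat)%:R >].

Fact padic_dvd k : ((Zp_trunc (p ^ k.+1)).+2 %| (Zp_trunc (p ^ k.+2)).+2)%N.
Proof.
case: p => [|[|q]]; [by rewrite !exp0n | by rewrite !exp1n |].
by rewrite !Zp_cast ?dvdn_exp2l // -(expn0 q.+2) ltn_exp2l.
Qed.

Fact padic_natr k n :
  (n %% (Zp_trunc (p ^ k.+2)).+2)%:R = n%:R :> 'Z_(p ^ k.+1).
Proof.
by apply: val_inj; rewrite !Zp_nat /= modn_dvdm // padic_dvd.
Qed.

Fact padic_compat_subring : subring_closed padic_compat.
Proof.
have natN k (x : 'Z_(p ^ k.+2)) :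
    ((- x : 'Z__) : nat)%:R = - (x : nat)%:R :> 'Z_(p ^ k.+1).
  rewrite /= padic_natr natrB; last exact/ltnW/ltn_ord.
  have -> : ((Zp_trunc (p ^ k.+2)).+2)%:R = 0 :> 'Z_(p ^ k.+1).
    by rewrite -padic_natr modnn.
  by rewrite sub0r.
split; first 1 last.
- move=> x y /asboolP Cx /asboolP Cy; apply/asboolP=> k.
  transitivity (x k - y k) => //; rewrite Cx Cy -natN -natrD.
  by rewrite -[LHS]padic_natr.
- move=> x y /asboolP Cx /asboolP Cy; apply/asboolP=> k.
  transitivity (x k * y k) => //; rewrite Cx Cy -natrM.
  by rewrite -[LHS]padic_natr.
- by apply/asboolP=> k; rewrite /= padic_natr.
Qed.
HB.instance Definition _ := GRing.isSubringClosed.Build _ padic_compat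
  padic_compat_subring.

Definition padic := {x | x \in padic_compat}.
HB.instance Definition _ := SubChoice.on padic.
HB.instance Definition _ := GRing.SubChoice_isSubComPzRing.Build _ _ padic
  (GRing.subringClosedP _).
End Padic.

(* The group ring A[G]; u g is the coefficient of g in u.  In the Galois groups
   of the library, (g * h)%g is g followed by h (lemma galM).  The basis
   elements are multiplied in the opposite order, so that A[G] acts on the left
   through composition of automorphisms; this is immaterial when G is abelian. *)
Definition group_ring (A : Type) (G : finGroupType) := {ffun G -> A}.

Section GroupRing.
Variables (A : comPzRingType) (G : finGroupType).
HB.instance Definition _ := GRing.Zmodule.copy (group_ring A G) {ffun G -> A}.
Implicit Types u v w : group_ring A G.

Definition gr_elt (g : G) : group_ring A G := [ffun h => (h == g)%:R].
Definition gr_mul u v : group_ring A G :=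
  [ffun k => \sum_(h : G) u (h^-1 * k)%g * v h].

Fact gr_mulA : associative gr_mul.
Proof.
move=> u v w; apply/ffunP=> k; rewrite !ffunE.
under eq_bigr do rewrite ffunE mulr_sumr.
under [RHS]eq_bigr do rewrite ffunE mulr_suml.
rewrite exchange_big /=; apply: eq_bigr => h _.
rewrite (reindex_inj (mulgI h)) /=; apply: eq_bigr => l _.
by rewrite mulKg invMg mulgA mulrA.
Qed.

Fact gr_mul1g : left_id (gr_elt 1%g) gr_mul.
Proof.
move=> u; apply/ffunP=> k; rewrite ffunE (bigD1 k) //= big1 => [|h neq_hk].
  by rewrite ffunE mulVg eqxx mul1r addr0.
by rewrite ffunE -eq_mulVg1 (negPf neq_hk) mul0r.
Qed.

Fact gr_mulg1 : right_id (gr_elt 1%g) gr_mul.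
Proof.
move=> u; apply/ffunP=> k; rewrite ffunE (bigD1 1%g) //= big1 => [|h neq_h1].
  by rewrite ffunE eqxx mulr1 addr0 invg1 mul1g.
by rewrite ffunE (negPf neq_h1) mulr0.
Qed.

Fact gr_mulDl : left_distributive gr_mul +%R.
Proof.
move=> u v w; apply/ffunP=> k; rewrite !ffunE -big_split /=.
by apply: eq_bigr => h _; rewrite ffunE mulrDl.
Qed.

Fact gr_mulDr : right_distributive gr_mul +%R.
Proof.
move=> u v w; apply/ffunP=> k; rewrite !ffunE -big_split /=.
by apply: eq_bigr => h _; rewrite ffunE mulrDr.
Qed.

HB.instance Definition _ := GRing.Zmodule_isPzRing.Build (group_ring A G)
  gr_mulA gr_mul1g gr_mulg1 gr_mulDl gr_mulDr.

Lemma gr_eltM g h : gr_elt (g * h)%g = gr_elt h * gr_elt g.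
Proof.
apply/ffunP=> k; rewrite !ffunE (bigD1 g) //= big1 => [|l neq_lg].
  by rewrite !ffunE eqxx mulr1 addr0 -(can_eq (mulKg g) (g^-1 * k)%g) mulKVg.
by rewrite !ffunE (negPf neq_lg) mulr0.
Qed.
End GroupRing.

Definition gr_map (A : comPzRingType) (G H : finGroupType) (f : G -> H)
    (u : group_ring A G) : group_ring A H :=
  [ffun h => \sum_(g | f g == h) u g].

(* Abelian groups with an action of G by automorphisms.  As for automorphisms
   in the library, g * h acts as g followed by h. *)
HB.mixin Record Zmodule_isGModule (G : finGroupType) V of GRing.Zmodule V := {
  gmod_act : G -> V -> V;
  gmod_actD : forall g, {morph gmod_act g : x y / x + y};
  gmod_act1 : forall x, gmod_act 1%g x = x;
  gmod_actM : forall g h x, gmod_act (g * h)%g x = gmod_act h (gmod_act g x)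
}.

#[short(type="gmodType")]
HB.structure Definition GModule (G : finGroupType) :=
  {V of GRing.Zmodule V & Zmodule_isGModule G V}.

Section LmodQuotient.
Variables (R : pzRingType) (V : lmodType R) (S : seq V).
Local Open Scope quotient_scope.

Definition submod_gen : {pred V} := fun v =>
  `[< forall W : {pred V}, submod_closed W -> {subset S <= W} -> v \in W >].

Fact submod_gen_closed : submod_closed submod_gen.
Proof.
split=> [|c u v /asboolP Su /asboolP Sv]; apply/asboolP=> W Wclosed SW.
  by case: Wclosed.
by case: (Wclosed) => _; apply; [apply: Su | apply: Sv].
Qed.
HB.instance Definition _ := GRing.isZmodClosed.Build V submod_gen
  (GRing.submod_closedB submod_gen_closed).
HB.instance Definition _ := GRing.isSubmodClosed.Build R V submod_gen
  submod_gen_closed.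

Definition lmod_quot := Quotient.quot submod_gen.
HB.instance Definition _ := GRing.Zmodule.on lmod_quot.

Definition lmod_quot_scale (c : R) (x : lmod_quot) : lmod_quot :=
  \pi_(Quotient.quot submod_gen) (c *: repr x).

Fact lmod_quot_pi c v :
  lmod_quot_scale c (\pi_(Quotient.quot submod_gen) v) =
  \pi_(Quotient.quot submod_gen) (c *: v).
Proof.
apply/eqP; rewrite -Quotient.idealrBE -scalerBr rpredZ //.
by rewrite Quotient.idealrBE reprK.
Qed.

Fact lmod_quot_scaleA a b x :
  lmod_quot_scale a (lmod_quot_scale b x) = lmod_quot_scale (a * b) x.
Proof. by rewrite lmod_quot_pi scalerA. Qed.
Fact lmod_quot_scale1 : left_id 1 lmod_quot_scale.
Proof. by move=> x; rewrite /lmod_quot_scale scale1r reprK. Qed.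
Fact lmod_quot_scaleDr : right_distributive lmod_quot_scale +%R.
Proof.
move=> c; elim/quotW=> x; elim/quotW=> y.
by rewrite -[in LHS]raddfD !lmod_quot_pi scalerDr raddfD.
Qed.
Fact lmod_quot_scaleDl x : {morph lmod_quot_scale^~ x : a b / a + b}.
Proof. by move=> a b; rewrite /lmod_quot_scale scalerDl raddfD. Qed.
HB.instance Definition _ := GRing.Zmodule_isLmodule.Build R lmod_quot
  lmod_quot_scaleA lmod_quot_scale1 lmod_quot_scaleDr lmod_quot_scaleDl.
End LmodQuotient.

(* The subgroup qV; it is written V^q when V is a multiplicative group. *)
Section Multiples.
Variables (q : nat) (V : zmodType).

Definition multiples : {pred V} := fun v => `[< exists u, v = u *+ q >].

Fact multiples_closed : zmod_closed multiples.
Proof.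
split=> [|u v /asboolP[x ->] /asboolP[y ->]]; apply/asboolP.
  by exists 0; rewrite mul0rn.
by exists (x - y); rewrite mulrnBl.
Qed.
HB.instance Definition _ := GRing.isZmodClosed.Build V multiples
  multiples_closed.
End Multiples.
Arguments multiples : clear implicits.

Section GactAdditive.
Variables (G : finGroupType) (V : gmodType G) (g : G).
Fact gmod_act_is_nmod_morphism : nmod_morphism (@gmod_act G V g).
Proof.
by split; [apply: (addrI (gmod_act g 0)); rewrite -gmod_actD !addr0 | apply: gmod_actD].
Qed.
HB.instance Definition _ := GRing.isNmodMorphism.Build V V (@gmod_act G V g)
  gmod_act_is_nmod_morphism.
End GactAdditive.

(* V/qV as a module over (Z/qZ)[G]: the coset of v is sent by u to the coset of
   the sum of the u(g) g(v), where the u(g) are represented by integers.  The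
   proof argument is there because 'Z_q is Z/qZ only if q > 1. *)
Definition mod_multiples (q : nat) (q_gt1 : (1 < q)%N) (V : zmodType) :=
  Quotient.quot (multiples q V).

HB.instance Definition _ q q_gt1 V :=
  GRing.Zmodule.on (@mod_multiples q q_gt1 V).

Section ModMultiples.
Variables (q : nat) (q_gt1 : (1 < q)%N) (G : finGroupType) (V : gmodType G).
Local Open Scope quotient_scope.
Local Notation Vq := (mod_multiples q_gt1 V).
Local Notation pi := (\pi_(Quotient.quot (multiples q V))).
Implicit Types u v : group_ring 'Z_q G.

Definition mod_multiples_scale u (x : Vq) : Vq :=
  pi (\sum_(g : G) gmod_act g (repr x) *+ u g).

Fact mod_multiples_modn y n : pi (y *+ (n %% q)) = pi (y *+ n).
Proof.
apply/eqP; rewrite eq_sym -Quotient.idealrBE {1}(divn_eq n q) mulrnDr addrK.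
by apply/asboolP; exists (y *+ (n %/ q)); rewrite mulrnA.
Qed.

Fact mod_multiples_pi u y :
  mod_multiples_scale u (pi y) = pi (\sum_(g : G) gmod_act g y *+ u g).
Proof.
apply/eqP; rewrite -Quotient.idealrBE -sumrB rpred_sum // => g _.
rewrite -mulrnBl -raddfB rpredMn //.
have /asboolP[z ->]: repr (pi y) - y \in multiples q V.
  by rewrite Quotient.idealrBE reprK.
by apply/asboolP; exists (gmod_act g z); rewrite raddfMn.
Qed.

Fact mod_multiples_ZpD y (a b : 'Z_q) :
  pi (y *+ (a + b : 'Z_q)%R) = pi (y *+ a + y *+ b).
Proof.
rewrite /=; move: (a : nat) (b : nat) => c d.
by rewrite Zp_cast // mod_multiples_modn mulrnDr.
Qed.

Fact mod_multiples_ZpM y (a b : 'Z_q) :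
  pi (y *+ (a * b : 'Z_q)%R) = pi (y *+ a *+ b).
Proof.
rewrite /=; move: (a : nat) (b : nat) => c d.
by rewrite Zp_cast // mod_multiples_modn mulrnA.
Qed.

Fact mod_multiples_Zp_sum y (F : G -> 'Z_q) :
  pi (y *+ (\sum_g F g : 'Z_q)%R) = pi (\sum_g y *+ F g).
Proof.
rewrite [RHS]raddf_sum /=.
apply: (big_morph (fun a : 'Z_q => pi (y *+ a))) => [a b|].
  by rewrite mod_multiples_ZpD raddfD.
by rewrite mulr0n raddf0.
Qed.

Fact mod_multiples_scaleA u v x :
  mod_multiples_scale u (mod_multiples_scale v x) =
  mod_multiples_scale (u * v) x.
Proof.
rewrite mod_multiples_pi /mod_multiples_scale; move: (repr x) => y.
under eq_bigr do rewrite raddf_sum /= -sumrMnl.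
rewrite exchange_big /= raddf_sum [RHS]raddf_sum /=.
under [RHS]eq_bigr do rewrite ffunE mod_multiples_Zp_sum raddf_sum.
rewrite [RHS]exchange_big; apply: eq_bigr => g _.
rewrite raddf_sum [RHS](reindex_inj (mulgI g)); apply: eq_bigr => h _.
rewrite mulKg mulrC; apply: etrans (esym (mod_multiples_ZpM _ _ _)).
by rewrite gmod_actM [gmod_act h (_ *+ _)]raddfMn.
Qed.

Fact mod_multiples_scale1 : left_id 1 mod_multiples_scale.
Proof.
move=> x; rewrite /mod_multiples_scale (bigD1 1%g) //= big1 => [|g neq_g1].
  by rewrite ffunE eqxx addr0 gmod_act1 reprK.
by rewrite ffunE (negPf neq_g1).
Qed.

Fact mod_multiples_scaleDr : right_distributive mod_multiples_scale +%R.
Proof.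
move=> u; elim/quotW=> x; elim/quotW=> y.
rewrite -[in LHS]raddfD !mod_multiples_pi -[RHS]raddfD -big_split /=.
by congr pi; apply: eq_bigr => g _; rewrite gmod_actD mulrnDl.
Qed.

Fact mod_multiples_scaleDl x : {morph mod_multiples_scale^~ x : u v / u + v}.
Proof.
move=> u v; rewrite /mod_multiples_scale -[RHS]raddfD -big_split /=.
rewrite !raddf_sum /=; apply: eq_bigr => g _.
by rewrite ffunE mod_multiples_ZpD.
Qed.

HB.instance Definition _ := GRing.Zmodule_isLmodule.Build (group_ring 'Z_q G) Vq
  mod_multiples_scaleA mod_multiples_scale1
  mod_multiples_scaleDr mod_multiples_scaleDl.
End ModMultiples.

Section Presentation.
Variables (p n m : nat) (G : finGroupType) (sigma : G).
Variables (a : 'I_m -> option 'I_n.+1) (d : int).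
Local Notation ZpG := (group_ring (padic p) G).

Definition X_gen_y : 'rV[ZpG]_m.+1 := delta_mx 0 ord0.
Definition X_gen_x (i : 'I_m) : 'rV[ZpG]_m.+1 := delta_mx 0 (lift ord0 i).

(* sigma ^ (p ^ a_i), where None stands for the exponent - oo. *)
Definition X_sigma_pow (i : 'I_m) : ZpG :=
  if a i is Some k then gr_elt _ sigma ^+ (p ^ k) else 0.

(* Each relation u = v is encoded as u - v. *)
Definition X_relations : seq 'rV[ZpG]_m.+1 :=
  (gr_elt _ sigma - d%:~R) *: X_gen_y - \sum_(i < m) X_gen_x i *+ p ^ i
  :: [seq X_sigma_pow i *: X_gen_x i - X_gen_x i | i : 'I_m].

Definition X_module := lmod_quot X_relations.
HB.instance Definition _ := GRing.Lmodule.on X_module.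

Definition X_gact (g : G) (x : X_module) : X_module := gr_elt _ g *: x.

Fact X_gactD g : {morph X_gact g : x y / x + y}.
Proof. by move=> x y; apply: scalerDr. Qed.
Fact X_gact1 x : X_gact 1%g x = x.
Proof. exact: scale1r. Qed.
Fact X_gactM g h x : X_gact (g * h)%g x = X_gact h (X_gact g x).
Proof. by rewrite /X_gact scalerA gr_eltM. Qed.
HB.instance Definition _ := Zmodule_isGModule.Build G X_module
  X_gactD X_gact1 X_gactM.
End Presentation.

(* The multiplicative group of a field, written additively so that its
   quotients can be modules. *)
Definition units (L : fieldType) := {x : L | x != 0}.

Section Units.
Variable L : fieldType.
HB.instance Definition _ := SubChoice.on (units L).
Implicit Types x y z : units L.

Definition units_one : units L := exist _ 1 (oner_neq0 L).
Definition units_inv x : units L :=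
  exist _ (val x)^-1 (etrans (congr1 negb (invr_eq0 _)) (valP x)).
Definition units_mul x y : units L :=
  exist _ (val x * val y) (mulf_neq0 (valP x) (valP y)).

Fact units_mulA : associative units_mul.
Proof. by move=> x y z; apply: val_inj; apply: mulrA. Qed.
Fact units_mulC : commutative units_mul.
Proof. by move=> x y; apply: val_inj; apply: mulrC. Qed.
Fact units_mul1 : left_id units_one units_mul.
Proof. by move=> x; apply: val_inj; apply: mul1r. Qed.
Fact units_mulV : left_inverse units_one units_inv units_mul.
Proof. by move=> x; apply: val_inj; exact: mulVf (valP x). Qed.
HB.instance Definition _ := GRing.isZmodule.Build (units L)
  units_mulA units_mulC units_mul1 units_mulV.
End Units.

Section GaloisUnits.
Variables (F : fieldType) (K : splittingFieldType F).

Fact gal_neq0 (g : gal_of {:K}) (x : units K) : g (val x) != 0.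
Proof. by rewrite fmorph_eq0; exact: (valP x). Qed.
Definition gal_units (g : gal_of {:K}) (x : units K) : units K :=
  exist _ (g (val x)) (gal_neq0 g x).

Fact gal_unitsD g : {morph gal_units g : x y / x + y}.
Proof. by move=> x y; apply: val_inj; apply: rmorphM. Qed.
Fact gal_units1 x : gal_units 1%g x = x.
Proof. by apply: val_inj; apply: gal_id. Qed.
Fact gal_unitsM g h x : gal_units (g * h)%g x = gal_units h (gal_units g x).
Proof. by apply: val_inj; apply: galM; apply: memvf. Qed.
HB.instance Definition _ := Zmodule_isGModule.Build (gal_of {:K}) (units K)
  gal_unitsD gal_units1 gal_unitsM.

(* The subgroup of F^x generated by the norms from M^x and the p-th powers. *)
Definition norm_group (p : nat) (M : {subfield K}) : {pred units F} := fun c =>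
  `[< exists2 b : units K, val b \in M & exists u : units F,
        (val c)%:A = galNorm 1 M (val b) * (val u ^+ p)%:A >].

Fact norm_group_closed p M : zmod_closed (norm_group p M).
Proof.
split=> [|x y /asboolP[b bM [u xE]] /asboolP[c cM [v yE]]]; apply/asboolP.
  exists 0; first exact: mem1v.
  by exists 0; rewrite /= galNorm1 mul1r expr1n.
exists (b - c); first exact: (rpred_div bM cM).
exists (u - v); rewrite /= galNormM galNormV exprMn exprVn.
have algM (s t : F) : (s * t)%:A = s%:A * t%:A :> K.
  by rewrite mulr_algl scalerA.
have algV (s : F) : (s^-1)%:A = (s%:A)^-1 :> K by rewrite -!in_algE fmorphV.
by rewrite !algM !algV xE yE invfM mulrACA.
Qed.
HB.instance Definition _ p M := GRing.isZmodClosed.Build (units F)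
  (norm_group p M) (norm_group_closed p M).
End GaloisUnits.

(* The quotient A/(A :&: B) of two subgroups of V; it is A/B if B is contained
   in A. *)
Section Subquotient.
Variables (V : zmodType) (A B : zmodClosed V).

Definition subgroup := {x | x \in A}.
HB.instance Definition _ := SubChoice.on subgroup.
HB.instance Definition _ := [SubChoice_isSubZmodule of subgroup by <:].

Definition subgroup_cap : {pred subgroup} := fun x => val x \in B.
Fact subgroup_cap_closed : zmod_closed subgroup_cap.
Proof.
by split=> [|x y Bx By]; rewrite unfold_in ?raddf0 ?rpred0 ?raddfB ?rpredB.
Qed.
HB.instance Definition _ := GRing.isZmodClosed.Build subgroup subgroup_cap
  subgroup_cap_closed.

Definition subquotient := Quotient.quot subgroup_cap.
HB.instance Definition _ := GRing.Zmodule.on subquotient.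
End Subquotient.

(* b is a basis of V over A, for the scaling operation s. *)
Definition basis_for (A : pzRingType) (V : zmodType) (s : A -> V -> V)
    (I : choiceType) (b : I -> V) : Prop :=
  (forall v, exists (r : seq I) (c : I -> A),
     v = \sum_(i <- r) s (c i) (b i)) /\
  (forall (r : seq I) (c : I -> A), uniq r ->
     \sum_(i <- r) s (c i) (b i) = 0 -> {in r, forall i, c i = 0}).

(* Possibly infinite ranks and dimensions are cardinals, here given by index
   types of bases. *)
Definition free_of_rank (R : pzRingType) (V : lmodType R) (I : choiceType) :=
  exists b : I -> V, basis_for *:%R b.

(* If pV = 0, V has a unique F_p-vector space structure, with c *: v = v *+ c
   for any natural number c. *)
Definition Fp_dim (p : nat) (V : zmodType) (I : choiceType) :=
  exists b : I -> V, basis_for (fun (c : 'F_p) v => v *+ c) b.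

Definition lmod_iso (R : pzRingType) (V W : lmodType R) :=
  exists f : {linear V -> W}, bijective f.

(* V is W, viewed as an R-module via phi : R -> S. *)
Definition lmod_iso_via (R S : pzRingType) (phi : R -> S)
    (V : lmodType R) (W : lmodType S) :=
  exists f : {additive V -> W},
    bijective f /\ forall r v, f (r *: v) = phi r *: f v.

Definition indecomposable (R : pzRingType) (V : lmodType R) :=
  (exists v : V, v != 0) /\
  forall A B : {pred V}, submod_closed A -> submod_closed B ->
    (forall v, v \in A -> v \in B -> v = 0) ->
    (forall v, exists2 x, x \in A & exists2 y, y \in B & v = x + y) ->
    {in A, forall v, v = 0} \/ {in B, forall v, v = 0}.

Lemma prime_expn_gt1 p m : prime p -> (0 < m)%N -> (1 < p ^ m)%N.
Proof. by move=> p_pr m_gt0; rewrite -(exp1n m) ltn_exp2r ?prime_gt1. Qed.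

(* Main.v *)
(* Write K^x additively, as a module over Z[X] on which X acts as sigma.  Look for
   y and x_0, ..., x_m with (sigma - d) y = \sum_j p^j x_j, where x_j lies in the
   field of index a_j for j < m, such that the norm of this relation, formally
   divided by p, is the root of unity xi.  Such a system exists by Hilbert 90;
   choose one with a lexicographically minimal.  By minimality the norms of y and
   of the x_j are independent for the filtration of F^x by the groups
   N(K_i^x) F^xp.  Complete them to bases of the successive quotients, by norms of
   elements g of the K_i.  Descending along the powers of sigma - 1 and dividing
   by p (which is possible up to multiples of xi, that is, of the norm of the
   relation), one finds that modulo p^m the relations between y, the x_j and the
   g all come from the defining ones, and that these elements generate K^x.  So
   modulo p^m, y and the x_j span a copy of X_(a,d,m), and the g of level i a free
   module over Z/p^m[G_i].  If that copy were decomposable, the projection of y,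
   x_0, ..., x_(m-1) on one of the two summands would lift to a system for c xi
   with c prime to p.  This system is minimal again, so its span is isomorphic to
   the whole copy and, by finiteness, equal to it. *)
From HB Require Import structures.
From mathcomp Require Import all_boot all_order all_algebra all_fingroup cyclic all_field.
From mathcomp Require Import boolp ring zify.
From mathcomp Require classical_sets.
Require Import Defs.

Set Implicit Arguments.
Unset Strict Implicit.
Unset Printing Implicit Defensive.

(** The delicate point is division by p: from p s = 0 one gets only s = c xi. What saves the passage
    from p^k to p^(k+1) is that p times the norm of a system is N_n times its relation. Writing xi
    as that norm therefore changes the multiplier of the defining relation by a multiple of N_n and
    creates no new relation. The formal division of the norm by p rests on N_n x_0 = p N_(n-1) x_0,
    whence the bound on a_0. For p = 2 and n = 1 this bound is too weak and x_0 = 0 is required; the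
    hypothesis on -1 provides such a system.

    Minimality acts by exchange: if the norm of x_j comes from the next level up to pF, then x_j can
    be lowered by moving a part of it into y and x_(j+1). Later entries may grow, so the order has
    to be lexicographic. Modulo p, independence of norms suffices because F_p[G_i] =
    F_p[D]/(D^(p^i)), with D = sigma - 1, is uniserial with socle spanned by N_i. The constant d = 1
    + p e cannot be fixed in advance, since exchanging x_j for x_j - u y changes e. The last term
    p^m x_m absorbs what is known only modulo p^m. *)

Import GRing.Theory Num.Theory.
Local Open Scope ring_scope.

(* The ring C (+) V in which V is an ideal of square zero.  It turns an identity
   between vectors into an identity in a commutative ring. *)
Definition idealization (C : comNzRingType) (V : lmodType C) := (C * V)%type.

Section Idealization.
Variables (C : comNzRingType) (V : lmodType C).
Local Notation E := (idealization V).
HB.instance Definition _ := GRing.Zmodule.on E.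

Definition ideal_mul (u v : E) : E := (u.1 * v.1, u.1 *: v.2 + v.1 *: u.2).
Fact ideal_mulA : associative ideal_mul.
Proof.
case=> [a u] [b v] [c w]; congr pair; first exact: mulrA.
by rewrite /= !scalerDr !scalerA addrA (mulrC c a) (mulrC c b).
Qed.
Fact ideal_mulC : commutative ideal_mul.
Proof. by case=> [a u] [b v]; congr pair; [apply: mulrC | apply: addrC]. Qed.
Fact ideal_mul1 : left_id (1, 0) ideal_mul.
Proof. by case=> a u; rewrite /ideal_mul /= mul1r scale1r scaler0 addr0. Qed.
Fact ideal_mulDl : left_distributive ideal_mul +%R.
Proof.
case=> [a u] [b v] [c w]; congr pair; first exact: mulrDl.
by rewrite /= scalerDl scalerDr addrACA.
Qed.
Fact ideal_1_neq0 : (1, 0) != 0 :> E.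
Proof. by apply/eqP=> -[/eqP]; rewrite oner_eq0. Qed.
HB.instance Definition _ := GRing.Zmodule_isComNzRing.Build E
  ideal_mulA ideal_mulC ideal_mul1 ideal_mulDl ideal_1_neq0.

Definition ideal_scal (c : C) : E := (c, 0).
Fact ideal_scal_additive : additive ideal_scal.
Proof. by move=> c d; congr pair; rewrite /= subr0. Qed.
Fact ideal_scal_multiplicative : multiplicative ideal_scal.
Proof. by split=> // c d; congr pair; rewrite /= !scaler0 addr0. Qed.
HB.instance Definition _ := GRing.isAdditive.Build C E ideal_scal ideal_scal_additive.
HB.instance Definition _ := GRing.isMultiplicative.Build C E ideal_scal
  ideal_scal_multiplicative.

Definition ideal_vec (v : V) : E := (0, v).
Fact ideal_vec_additive : additive ideal_vec.
Proof. by move=> u v; congr pair; rewrite /= subr0. Qed.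
HB.instance Definition _ := GRing.isAdditive.Build V E ideal_vec ideal_vec_additive.

Lemma ideal_vecZ c v : ideal_vec (c *: v) = ideal_scal c * ideal_vec v.
Proof. by congr pair; rewrite /= ?mulr0 // scale0r addr0. Qed.
Lemma ideal_vecD u v : ideal_vec (u + v) = ideal_vec u + ideal_vec v.
Proof. exact: raddfD. Qed.
Lemma ideal_vecN u : ideal_vec (- u) = - ideal_vec u.
Proof. exact: raddfN. Qed.
Lemma ideal_vec0 : ideal_vec 0 = 0.
Proof. by []. Qed.
Lemma ideal_vec_inj : injective ideal_vec. Proof. by move=> u v []. Qed.
End Idealization.

Ltac module := apply: ideal_vec_inj;
  rewrite ?(ideal_vecD, ideal_vecN, ideal_vec0, ideal_vecZ); ring.

(** * Norm polynomials *)

Lemma exprD_prime (C : comPzRingType) p (a b : C) : prime p ->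
  exists c, (a + b) ^+ p = a ^+ p + b ^+ p + p%:R * c.
Proof.
case: p => // p p_pr; rewrite exprDn big_ord_recl big_ord_recr /=.
rewrite subn0 expr0 bin0 mulr1 mulr1n subnn expr0 mul1r binn mulr1n.
have dvd_p (i : 'I_p) : exists c,
    a ^+ (p.+1 - bump 0 i) * b ^+ bump 0 i *+ 'C(p.+1, bump 0 i) = p.+1%:R * c.
  have /dvdnP[k ->] : (p.+1 %| 'C(p.+1, bump 0 i))%N.
    by rewrite prime_dvd_bin //= /bump leq0n add1n ltnS ltn_ord.
  exists (a ^+ (p.+1 - bump 0 i) * b ^+ bump 0 i *+ k).
  by rewrite mulrnA mulr_natl.
have [c ->] : exists c, \sum_(i < p) a ^+ (p.+1 - bump 0 i) * b ^+ bump 0 i *+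
    'C(p.+1, bump 0 i) = p.+1%:R * c.
  elim/big_rec: _ => [|i x _ [c ->]]; first by exists 0; rewrite mulr0.
  by have [d ->] := dvd_p i; exists (d + c); rewrite mulrDr.
by exists c; rewrite -addrA; congr (_ + _); rewrite addrC.
Qed.

Section CyclotomicPolynomials.
Variable p : nat.
Hypothesis p_pr : prime p.
Local Notation Zx := {poly int}.
Local Notation D := ('X - 1 : Zx).
Local Notation T i := ('X^(p ^ i) - 1 : Zx).

(** On [K_i^x], written additively, [Nm i] acts as the norm to F, and on [K_(i+1)^x] the polynomial
    [Mm i] acts as the norm to [K_i]. *)
Definition Nm i : Zx := \sum_(k < p ^ i) 'X^k.
Definition Mm i : Zx := \sum_(k < p) ('X^(p ^ i)) ^+ k.

Lemma subX1E i : T i = D * Nm i.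
Proof. exact: subrX1. Qed.

Lemma subXM i : T i.+1 = T i * Mm i.
Proof. by rewrite expnSr exprM subrX1. Qed.

Lemma D_neq0 : D != 0. Proof. by rewrite -polyC1 polyXsubC_eq0. Qed.

Lemma NmS i : Nm i.+1 = Nm i * Mm i.
Proof. by apply: (mulfI D_neq0); rewrite mulrA -!subX1E subXM. Qed.

Lemma Nm0 : Nm 0 = 1. Proof. by rewrite /Nm big_ord1. Qed.

Lemma subX_dvd i j : (i <= j)%N -> exists c, T j = T i * c.
Proof.
move=> /subnKC <-; elim: (j - i)%N => [|k [c cE]]; first by exists 1; rewrite addn0 mulr1.
by exists (c * Mm (i + k)%N); rewrite addnS subXM cE mulrA.
Qed.

Lemma Nm_horner i : (Nm i).[1] = (p ^ i)%:R.
Proof.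
rewrite /Nm horner_sum (eq_bigr (fun=> 1)) ?sumr_const ?card_ord // => k _.
by rewrite hornerXn expr1n.
Qed.

Lemma Mm_mod i : exists g, Mm i = p%:R + T i * g.
Proof.
exists (\sum_(k < p) \sum_(j < k) ('X^(p ^ i)) ^+ j).
rewrite mulr_sumr; under [in RHS]eq_bigr do rewrite -subrX1.
by rewrite sumrB sumr_const card_ord [X in _ + X]addrC addrA subrr add0r.
Qed.

Lemma poly_taylor1 (q : Zx) : exists r, q = q.[1]%:P + D * r.
Proof.
have /factor_theorem[r rE] : root (q - q.[1]%:P) 1.
  by rewrite /root !hornerE subrr.
by exists r; rewrite mulrC -polyC1 -rE addrCA subrr addr0.
Qed.

Lemma natp_neq0 : p%:R != 0 :> Zx.
Proof. by rewrite -polyC_natr polyC_eq0 pnatr_eq0 -lt0n prime_gt0. Qed.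

Lemma D1 : D.[1] = 0.
Proof. by rewrite -polyC1 hornerXsubC subrr. Qed.

Lemma horner_natr k x : (k%:R : Zx).[x] = k%:R.
Proof. by rewrite -polyC_natr hornerC. Qed.

(** Modulo p the ring is a domain in which D is not zero. *)
Lemma cancelD q u : D * q = p%:R * u -> exists r, q = p%:R * r.
Proof.
move=> qE; have := congr1 (fun r => r.[1]) qE.
rewrite !hornerM horner_natr D1 mul0r => /esym/eqP.
rewrite mulf_eq0 pnatr_eq0 -[p == 0]negbK -lt0n prime_gt0 //= => /eqP u1.
have [r uE] := poly_taylor1 u; rewrite u1 add0r in uE.
exists r; apply: (mulfI D_neq0); rewrite qE uE; ring.
Qed.

Lemma cancelDn k q u : D ^+ k * q = p%:R * u -> exists r, q = p%:R * r.
Proof.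
elim: k u => [|k IHk] u; first by rewrite expr0 mul1r => ->; exists u.
by rewrite exprS -mulrA => /cancelD[r /IHk].
Qed.

(** Frobenius: modulo p, the group ring of G_i becomes the truncated polynomial ring
    F_p[D]/(D^(p^i)). *)
Lemma frobX i : exists u, T i = D ^+ (p ^ i) + p%:R * u.
Proof.
elim: i => [|i [u uE]]; first by exists 0; rewrite expr1 mulr0 addr0.
have XE : 'X^(p ^ i) = 1 + (D ^+ (p ^ i) + p%:R * u) by rewrite -uE; ring.
rewrite expnSr exprM XE.
have [c1 ->] := exprD_prime 1 (D ^+ (p ^ i) + p%:R * u) p_pr.
have [c2 ->] := exprD_prime (D ^+ (p ^ i)) (p%:R * u) p_pr.
rewrite expr1n exprMn exprM.
exists (p%:R ^+ p.-1 * u ^+ p + c2 + c1).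
have -> : (p%:R : Zx) ^+ p = p%:R * p%:R ^+ p.-1.
  by rewrite -exprS prednK // prime_gt0.
ring.
Qed.

(** Modulo p, the norm is thus the highest nonzero power of D in F_p[G_i], which spans the socle. *)
Lemma frobN i : exists u, Nm i = D ^+ (p ^ i).-1 + p%:R * u.
Proof.
have [u] := frobX i; rewrite subX1E.
have -> : D ^+ (p ^ i) = D * D ^+ (p ^ i).-1.
  by rewrite -exprS prednK // expn_gt0 prime_gt0.
move=> uE; have /cancelD[r rE] : D * (Nm i - D ^+ (p ^ i).-1) = p%:R * u.
  by rewrite mulrBr uE; ring.
by exists r; rewrite -rE; ring.
Qed.

(** Expansion at 1 to second order. It is needed for n = 1, where the coefficient C(p,2) of D
    matters: it is divisible by p only for odd p. *)
Lemma Mm0_mod : exists h, Mm 0 = p%:R + 'C(p, 2)%:R * D + D ^+ 2 * h.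
Proof.
have [h hE] := poly_taylor1 (Mm 0); have [h' h'E] := poly_taylor1 h.
have M1 : (Mm 0).[1] = p%:R.
  rewrite -[Mm 0]mul1r -Nm0 -NmS Nm_horner; by rewrite expn1.
have dM : (Mm 0)^`().[1] = h.[1].
  rewrite {1}hE derivD derivC add0r derivM hornerD !hornerM D1 mul0r addr0.
  by rewrite -polyC1 derivXsubC hornerC mul1r.
exists h'; rewrite hE M1 h'E -dM.
suff -> : (Mm 0)^`().[1] = 'C(p, 2)%:R by rewrite !polyC_natr; ring.
have -> : (Mm 0)^`() = \sum_(k < p) 'X^(k.-1) *+ k.
  rewrite /Mm expn0 expr1 raddf_sum; by apply: eq_bigr => k _; rewrite /= derivXn.
rewrite horner_sum; under eq_bigr => k _ do rewrite hornerMn hornerXn expr1n.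
by rewrite -natr_sum -(bin2_sum p) big_mkord.
Qed.
End CyclotomicPolynomials.

(** * Kummer modules *)

(* The properties of K^x, as a module over Z[X], which the proof uses. *)
Section KummerModule.
Variables (p n m : nat) (A : lmodType {poly int}) (xi : A).
Local Notation Zx := {poly int}.
Local Notation D := ('X - 1 : Zx).
Local Notation T i := ('X^(p ^ i) - 1 : Zx).
Local Notation N := (Nm p).
Local Notation M := (Mm p).
Local Notation p' := (p%:R : Zx).

(** In the application this is membership in [K_i^x], the field [K_i] being fixed by sigma^(p^i). *)
Definition fixed i (z : A) := T i *: z = 0.

(** [km_hilbert90] concerns the extension K_(i+1)/K_i, whose group is generated by sigma^(p^i).
    [km_p2n1] is the hypothesis on -1, which is xi when p = 2. *)
Record kummer_module : Prop := KummerModule {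
  km_prime : prime p;
  km_n_gt0 : (0 < n)%N;
  km_m_gt0 : (0 < m)%N;
  km_fixed : forall z, fixed n z;
  km_hilbert90 : forall i z, (i < n)%N -> fixed i.+1 z -> M i *: z = 0 ->
    exists2 h, fixed i.+1 h & z = T i *: h;
  km_torsion : forall z, p' *: z = 0 -> exists c : int, z = c%:P *: xi;
  km_xi_neq0 : xi != 0;
  km_xi_p : p' *: xi = 0;
  km_xi_fixed : fixed 0 xi;
  km_p2n1 : p = 2%N -> n = 1%N -> exists b, xi = N n *: b
}.

Hypothesis kmA : kummer_module.
Let p_pr := km_prime kmA.
Let n_gt0 := km_n_gt0 kmA.

Lemma fixedZ i q z : fixed i z -> fixed i (q *: z).
Proof. by move=> zK; rewrite /fixed scalerA mulrC -scalerA zK scaler0. Qed.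

Lemma fixedD i z w : fixed i z -> fixed i w -> fixed i (z + w).
Proof. by move=> zK wK; rewrite /fixed scalerDr zK wK addr0. Qed.

Lemma fixedN i z : fixed i z -> fixed i (- z).
Proof. by move=> zK; rewrite /fixed scalerN zK oppr0. Qed.

Lemma fixedB i z w : fixed i z -> fixed i w -> fixed i (z - w).
Proof. by move=> zK wK; apply/fixedD/fixedN. Qed.

Lemma fixed00 i : fixed i 0. Proof. exact: scaler0. Qed.

Lemma fixed_sum i (I : Type) (r : seq I) (P : pred I) (f : I -> A) :
  (forall j, P j -> fixed i (f j)) -> fixed i (\sum_(j <- r | P j) f j).
Proof. by move=> fK; elim/big_rec: _ => [|j z Pj zK]; [apply: fixed00 | apply/fixedD/zK/fK]. Qed.

Lemma fixedW i j z : (i <= j)%N -> fixed i z -> fixed j z.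
Proof.
by move=> /(subX_dvd p)[c cE] zK; rewrite /fixed cE mulrC -scalerA zK scaler0.
Qed.

Lemma fixed0D z : fixed 0 z <-> D *: z = 0.
Proof. by rewrite /fixed expn0 expr1. Qed.

Lemma fixed0Z q z : fixed 0 z -> q *: z = (q.[1])%:P *: z.
Proof.
have [r qE] := poly_taylor1 q.
by move=> /fixed0D zF; rewrite {1}qE scalerDl mulrC -scalerA zF scaler0 addr0.
Qed.

Lemma fixed_Nm i z : fixed i z -> fixed 0 (N i *: z).
Proof. by move=> zK; apply/fixed0D; rewrite scalerA -subX1E. Qed.

Lemma Mm_fixed i z : fixed i z -> M i *: z = p' *: z.
Proof.
have [g ->] := Mm_mod p i => zK.
by rewrite scalerDl [_ * g]mulrC -scalerA zK scaler0 addr0.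
Qed.

Lemma Nm_n q (z : A) : N n *: (q *: z) = (q.[1])%:P *: (N n *: z).
Proof. rewrite scalerA mulrC -scalerA; exact/fixed0Z/fixed_Nm/(km_fixed kmA). Qed.

Lemma fixed_M i z : fixed i.+1 z -> fixed i (M i *: z).
Proof. by move=> zK; rewrite /fixed scalerA -subXM. Qed.

Lemma Nm_fixedS i z : fixed i z -> N i.+1 *: z = p' *: (N i *: z).
Proof. by move=> zK; rewrite NmS -scalerA (Mm_fixed zK) scalerA mulrC -scalerA. Qed.

(* The idea: if [S] is the sum over [G_i], then [S v - f] has norm zero down to
   [K_i], so [S v - f = S D h], and [v - D h] is fixed because its [S]-image is. *)
Lemma norm_p_fixed i v f : (i < n)%N -> fixed i.+1 v -> fixed 0 f ->
  N i.+1 *: v = p' *: f ->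
  exists h k, [/\ fixed i.+1 h, fixed i k, v = D *: h + k & N i *: k = f].
Proof.
move=> lt_in vK fF Nv.
have uK : fixed i.+1 (N i *: v - f).
  exact: fixedB (fixedZ _ vK) (fixedW (leq0n _) fF).
have Mu : M i *: (N i *: v - f) = 0.
  rewrite scalerBr scalerA mulrC -NmS Nv (Mm_fixed (fixedW (leq0n _) fF)).
  exact: subrr.
have [h hK uE] := km_hilbert90 kmA lt_in uK Mu.
have NE : N i *: (v - D *: h) = f.
  rewrite scalerBr scalerA [N i * _]mulrC -subX1E -uE; module.
exists h, (v - D *: h); split=> //; last by module.
by rewrite /fixed subX1E -scalerA NE; apply/fixed0D.
Qed.

(* The fields are shifted by one, so that index 0 stands for the trivial group. *)
Definition fixed' i (z : A) := if i is j.+1 then fixed j z else z = 0.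

Lemma fixed'W i j z : (i <= j)%N -> fixed' i z -> fixed' j z.
Proof.
case: i j => [|i] [|j] //= le_ij; first by move=> ->; apply: fixed00.
exact: fixedW.
Qed.

Lemma fixed'D i z w : fixed' i z -> fixed' i w -> fixed' i (z + w).
Proof. by case: i => [-> ->|i]; [apply: addr0 | apply: fixedD]. Qed.

Lemma fixed'Z i q z : fixed' i z -> fixed' i (q *: z).
Proof. by case: i => [->|i]; [apply: scaler0 | apply: fixedZ]. Qed.

(** There is no field below level 0, but there N_0 is the identity and v = p f. The term p f0 covers
    this case. *)
Lemma norm_p_fixed' i v f : (i <= n)%N -> fixed i v -> fixed 0 f ->
  N i *: v = p' *: f ->
  exists h k f0, [/\ fixed i h, fixed' i k, fixed i f0,
    v = D *: h + k + p' *: f0 & (0 < i)%N -> f0 = 0].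
Proof.
case: i => [|i] lt_in vK fF Nv.
  exists 0, 0, f; split=> //; try exact: fixed00.
  by move: Nv; rewrite Nm0 scale1r scaler0 !add0r.
have [h [k [hK kK -> _]]] := norm_p_fixed lt_in vK fF Nv.
by exists h, k, 0; split=> //; [apply: fixed00 | rewrite scaler0 addr0].
Qed.

End KummerModule.

(** * Minimal systems *)

Section Lexicographic.
Variable B : nat.

(** The entries are read as digits in base [B], the first being the most significant, so that
    lexicographic comparison of tuples with entries below [B] becomes comparison of numbers. *)
Fixpoint weight m (a : nat -> nat) := if m is k.+1 then weight k a * B + a k else 0%N.

Lemma eq_weight m a b : (forall k, (k < m)%N -> a k = b k) -> weight m a = weight m b.
Proof.
elim: m => //= m IHm eq_ab; rewrite eq_ab // IHm // => k lt_km.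
exact/eq_ab/ltnW.
Qed.

Lemma ltn_weight m a b j : (j < m)%N -> (forall k, (k < j)%N -> a k = b k) ->
  (a j < b j)%N -> (forall k, (k < m)%N -> (a k < B)%N) -> (weight m a < weight m b)%N.
Proof.
move=> lt_jm eq_ab lt_ab a_lt; elim: m lt_jm a_lt => //= m IHm lt_jm a_lt.
have [lt_jm'|le_mj] := ltnP j m.
  have lt_w := IHm lt_jm' (fun k lt_km => a_lt k (ltnW lt_km)).
  apply: leq_trans (leq_addr _ _); apply: leq_trans (leq_mul lt_w (leqnn B)).
  by rewrite mulSn [ltnRHS]addnC ltn_add2l a_lt.
have eq_jm : j = m by apply/eqP; rewrite eqn_leq le_mj -ltnS lt_jm.
by rewrite (@eq_weight m a b) ?ltn_add2l -?eq_jm.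
Qed.
End Lexicographic.

Section Systems.
Variables (p n m : nat) (A : lmodType {poly int}) (xi : A).
Local Notation Zx := {poly int}.
Local Notation D := ('X - 1 : Zx).
Local Notation N := (Nm p).
Local Notation M := (Mm p).
Local Notation p' := (p%:R : Zx).
Local Notation fixed := (fixed p).
Local Notation fixed' := (fixed' p).
Hypothesis kmA : kummer_module p n m xi.
Let p_pr := km_prime kmA.
Let n_gt0 := km_n_gt0 kmA.
Let m_gt0 := km_m_gt0 kmA.
Implicit Types (x : nat -> A) (y z : A) (a : nat -> nat) (e : int).

Definition wsum x : A := \sum_(j < m) p' ^+ j *: x j.+1.
Definition wsys e y x : A := e%:P *: y + wsum x.

(* The relation [(sigma - d) y = \sum_(j <= m) p^j x_j] with [d = 1 + p e], split
   as [D y = x_0 + p W].  The element [norm_sys] is the formal quotient by [p] of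
   the norm of this relation, hence a [p]-torsion element. *)
Definition norm_sys e y x : A := N n *: wsys e y x + N n.-1 *: x 0%N.

(** [a j = 0] encodes the exponent -oo and [a j = i.+1] the exponent i. [x m] is an arbitrary
    element of K. The norm c is a parameter because the two components of a system in a direct sum
    have norms other than xi. *)
Record system a e y x (c : A) : Prop := System {
  sys_fixed : forall j, (j < m)%N -> fixed' (a j) (x j);
  sys_rel : D *: y = x 0%N + p' *: wsys e y x;
  sys_norm : norm_sys e y x = c
}.

(** With the shift of indices, [a 0 <= n] puts x_0 into K_(n-1). This bound, with x_0 = 0 for p = 2
    and n = 1, also makes the norm of y divisible by p in K^x ([len_y_le]). *)
Record admissible a : Prop := Admissible {
  adm_bound : forall j, (j < m)%N -> (a j <= n.+1)%N;
  adm_0 : (a 0 <= n)%N;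
  adm_p2n1 : p = 2%N -> n = 1%N -> a 0%N = 0%N
}.

Definition solvable_sys a := exists e y x, system a e y x xi.

Record minimal_sys a : Prop := MinimalSys {
  min_adm : admissible a;
  min_solv : solvable_sys a;
  min_weight : forall b, admissible b -> solvable_sys b ->
    (weight n.+2 m a <= weight n.+2 m b)%N
}.

Lemma fixed'_top z : fixed' n.+1 z. Proof. exact: km_fixed kmA z. Qed.

Lemma ex_system : exists2 a, admissible a & solvable_sys a.
Proof.
have [[p2 n1]|neq] : p = 2%N /\ n = 1%N \/ (p = 2%N -> n = 1%N -> False) by lia.
  have [b bE] := km_p2n1 kmA p2 n1.
  (* Since xi = N_1 b and 2 xi = 0, the element 2 b has norm zero and equals D h by Hilbert 90. Then
     y = h, x_0 = 0, x_1 = b is a system with e = 0. *)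
  have pb_fixed : fixed 1 (p' *: b) by by rewrite -n1; apply: km_fixed kmA _.
  have [] := km_hilbert90 kmA (z := p' *: b) (i := 0) n_gt0 pb_fixed.
    have <- : N n = M 0 by rewrite n1 NmS Nm0 mul1r.
    rewrite scalerA mulrC -scalerA -bE.
    exact: km_xi_p kmA.
  move=> h _ hE; exists (fun k => if k == 0%N then 0%N else n.+1).
    by split=> // -[|j] _ /=; rewrite ?leqnn.
  exists 0, h, (fun k => if k == 1%N then b else 0).
  have wE : wsys 0 h (fun k => if k == 1%N then b else 0) = b.
    rewrite /wsys /wsum (bigD1 (Ordinal m_gt0)) //= big1 => [|j].
      by rewrite scale0r expr0 scale1r add0r addr0.
    case: j => [[|j] lt_jm] //= _; exact: scaler0.
  split.
  - by case=> [|[|j]] // _ /=; [exact: fixed'_top|exact: fixed00].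
  - by rewrite wE /= add0r hE expn0 expr1.
  - by rewrite /norm_sys wE /= scaler0 addr0 -bE.
(* The norm of 0 is 0 = p xi, so 0 = D h + k with k in K_(n-1) and N_(n-1) k = xi. Then y = -h, x_0
   = k is a system with e = 0. *)
have [||||h [k [_ kK hE Nk]]] := @norm_p_fixed p n m A xi kmA n.-1 0 xi.
- by rewrite prednK.
- exact: fixed00.
- exact: km_xi_fixed kmA.
- by rewrite scaler0 (km_xi_p kmA).
exists (fun k => if k == 0%N then n else 0%N).
  split=> //= [[|j] _|p2 n1] //=; by case: neq.
exists 0, (- h), (fun j => if j == 0%N then k else 0).
have wE : wsys 0 (- h) (fun j => if j == 0%N then k else 0) = 0.
  by rewrite /wsys /wsum big1 ?scale0r ?addr0 // => j _; exact: scaler0.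
split.
- by case=> [|j] //= _; rewrite -(prednK n_gt0).
- rewrite wE scaler0 addr0 scalerN /=; apply/eqP; rewrite eq_sym -addr_eq0.
  by rewrite addrC hE.
- by rewrite /norm_sys wE scaler0 add0r.
Qed.

Lemma ex_minimal_sys : exists a, minimal_sys a.
Proof.
pose P k := `[< exists a, [/\ admissible a, solvable_sys a & weight n.+2 m a = k] >].
have [a adm_a sol_a] := ex_system.
have exP : exists k, P k by exists (weight n.+2 m a); apply/asboolP; exists a.
case: (ex_minnP exP) => k /asboolP[b [adm_b sol_b <-]] k_min.
by exists b; split=> // c adm_c sol_c; apply/k_min/asboolP; exists c.
Qed.

Lemma minimal_ltF a b j : minimal_sys a -> admissible b -> solvable_sys b ->
  (j < m)%N -> (forall k, (k < j)%N -> b k = a k) -> (b j < a j)%N -> False.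
Proof.
move=> min_a adm_b sol_b lt_jm eq_ba lt_ba.
have := min_weight min_a adm_b sol_b; apply/negP; rewrite -ltnNge.
by apply: (ltn_weight lt_jm eq_ba lt_ba) => k lt_km; apply: adm_bound adm_b _ lt_km.
Qed.

Definition delta_fun j z : nat -> A := fun k => if k == j then z else 0.

Lemma wsumD x1 x2 : wsum (fun k => x1 k + x2 k) = wsum x1 + wsum x2.
Proof. by rewrite /wsum -big_split /=; apply: eq_bigr => j _; rewrite scalerDr. Qed.

Lemma wsumN x : wsum (fun k => - x k) = - wsum x.
Proof. by rewrite /wsum -sumrN; apply: eq_bigr => j _; rewrite scalerN. Qed.

Lemma wsumZ q x : wsum (fun k => q *: x k) = q *: wsum x.
Proof.
by rewrite /wsum scaler_sumr; apply: eq_bigr => j _; rewrite !scalerA mulrC.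
Qed.

Lemma wsum_delta0 z : wsum (delta_fun 0 z) = 0.
Proof. by rewrite /wsum big1 // => j _; apply: scaler0. Qed.

Lemma wsum_deltaS j z : (j < m)%N -> wsum (delta_fun j.+1 z) = p' ^+ j *: z.
Proof.
move=> lt_jm; rewrite /wsum (bigD1 (Ordinal lt_jm)) //= /delta_fun eqxx.
rewrite big1 ?addr0 // => i neq_ij; rewrite eqSS ifN ?scaler0 //.
Qed.

(** If [a j <= a k], then x_j lies in the field of x_k, and the term p^j x_j can be merged into p^k
    x_k. This leaves x_j = 0 and a smaller tuple. In particular each level contains at most one
    x_j. *)
Lemma minimal_increasing a k j : minimal_sys a -> (k < j < m)%N -> (0 < a j)%N ->
  (a k < a j)%N.
Proof.
move=> min_a /andP[lt_kj lt_jm] aj_gt0; rewrite ltnNge; apply/negP => le_jk.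
have [e [y [x [xK rel nrm]]]] := min_solv min_a.
have [adm_b adm_c adm_d] := min_adm min_a.
pose b i := if i == j then 0%N else a i.
pose x2 i := x i + delta_fun k (p' ^+ (j - k) *: x j) i + delta_fun j (- x j) i.
apply: (@minimal_ltF a b j min_a) => //; last 1 first.
- by rewrite /b eqxx.
- split; rewrite /b.
  + by move=> i lt_im; case: eqP => // _; apply: adm_b.
  + by case: eqP => // _.
  + by move=> p2 n1; case: eqP => // _; apply: adm_d.
- exists e, y, x2.
  have x2E : wsum x2 = wsum x + wsum (delta_fun k (p' ^+ (j - k) *: x j)) +
     wsum (delta_fun j (- x j)) by rewrite -!wsumD.
  have [i def_j] : exists i, j = i.+1 by exists j.-1; lia.
  have wj : wsum (delta_fun j (- x j)) = - (p' ^+ i *: x j).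
    by rewrite {1}def_j wsum_deltaS ?scalerN //; lia.
  rewrite /norm_sys /wsys in rel nrm.
  split.
  + move=> l lt_lm; rewrite /x2 /b /delta_fun; case: eqP => [->|_].
      by rewrite (gtn_eqF lt_kj) addr0 /= subrr.
    rewrite addr0; case: eqP => [->|_]; last by rewrite addr0; apply: xK.
    apply/fixed'D/fixed'Z; first by apply/xK; lia.
    exact/(fixed'W le_jk)/xK.
  + rewrite /norm_sys /wsys x2E wj rel {1}/x2 /delta_fun [0%N == j]ltn_eqF; last by lia.
    case: eqP => [k0|/eqP nk0].
      rewrite -k0 wsum_delta0 subn0 {1}def_j exprS; module.
    rewrite -(prednK (n := k)) ?lt0n; last by lia.
    rewrite wsum_deltaS; last by lia.
    rewrite scalerA -exprD; have -> : (k.-1 + (j - k.-1.+1) = i)%N by lia.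
    module.
  + rewrite /norm_sys /wsys x2E wj -[RHS]nrm {1}/x2 /delta_fun [0%N == j]ltn_eqF; last by lia.
    case: eqP => [k0|/eqP nk0].
      (* Merging into x_0 replaces p^(j-1) N_n x_j by p^j N_(n-1) x_j in the norm; they agree
         because x_j lies in K_(n-1), like x_0. *)
      have pE : p' ^+ j = p' ^+ i * p' by rewrite {1}def_j exprSr.
      rewrite -k0 wsum_delta0 subn0 pE.
      have xjK : fixed n.-1 (x j).
        have /fixed'W/(_ (xK _ lt_jm)) : (a j <= n.-1.+1)%N.
          by rewrite prednK // (leq_trans le_jk) // -k0.
        by [].
      have Nxj : N n *: x j = p' *: (N n.-1 *: x j).
        by rewrite -(Nm_fixedS xjK) prednK.
      have -> : (N n *: (e%:P *: y + (wsum x + 0 - p' ^+ i *: x j)) =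
         N n *: (e%:P *: y + wsum x) - p' ^+ i *: (N n *: x j)) by module.
      rewrite Nxj; module.
    rewrite -(prednK (n := k)) ?lt0n; last by lia.
    rewrite wsum_deltaS; last by lia.
    rewrite scalerA -exprD; have -> : (k.-1 + (j - k.-1.+1) = i)%N by lia.
    module.
- by move=> i lt_ij; rewrite /b ltn_eqF.
Qed.
End Systems.

Section MinimalSystems.
Variables (p n m : nat) (A : lmodType {poly int}) (xi : A).
Local Notation Zx := {poly int}.
Local Notation D := ('X - 1 : Zx).
Local Notation N := (Nm p).
Local Notation M := (Mm p).
Local Notation p' := (p%:R : Zx).
Local Notation fixed := (fixed p).
Hypothesis kmA : kummer_module p n m xi.
Let p_pr := km_prime kmA.
Let n_gt0 := km_n_gt0 kmA.
Let m_gt0 := km_m_gt0 kmA.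
Local Notation wsum := (wsum p m).
Local Notation wsys := (wsys p m).
Local Notation system := (system p n m).
Implicit Types (x : nat -> A) (y z : A) (a : nat -> nat) (e : int).

Lemma eq_scale_p z f : fixed 0 f -> p' *: z = p' *: f -> fixed 0 z.
Proof.
move=> fF zE; have /(km_torsion kmA)[c cE] : p' *: (z - f) = 0.
  by rewrite scalerBr zE subrr.
rewrite -(subrK f z) cE; apply: fixedD fF.
exact/fixedZ/(km_xi_fixed kmA).
Qed.

(** Otherwise one builds b with D b = xi, a Kummer generator of K_1 over F, for which p b is p times
    an element of F. By [eq_scale_p] b itself is then in F, so that D b = 0. *)
Lemma norm_y_neq a e y x f : admissible p n m a -> system a e y x xi ->
  fixed 0 f -> N n *: y = p' *: f -> False.
Proof.
move=> adm_a [xK rel nrm] fF Ny; move: rel nrm; rewrite /norm_sys.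
set W := wsys e y x => rel nrm.
suff [b Db [f' fF' bE]] : exists2 b, D *: b = xi & exists2 f', fixed 0 f' & p' *: b = p' *: f'.
  have /fixed0D := eq_scale_p fF' bE; rewrite Db => xi0.
  by case/eqP: (km_xi_neq0 kmA).
have [n1|n_gt1] : n = 1%N \/ (1 < n)%N by lia.
  move: nrm Ny; rewrite n1 Nm0 NmS Nm0 mul1r scale1r => nrm Ny.
  have [h hE] := Mm0_mod p; set C := 'C(p, 2) in hE.
  (* D (C + D h) = M_0 - p, so D b = x_0 + M_0 W, which is the norm of the system. *)
  pose b := y + (C%:R + D * h) *: W.
  have MWF : fixed 0 (M 0 *: W).
    have NM : N 1 = M 0 by rewrite NmS Nm0 mul1r.
    by rewrite -NM; apply: fixed_Nm; rewrite -n1; apply: km_fixed kmA _.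
  have Db : D *: b = xi.
    rewrite -nrm hE; have -> : x 0%N = D *: y - p' *: W by rewrite rel; module.
    rewrite /b; module.
  (* Here p b = N_1 y + C M_0 W - C xi. For odd p, C is a multiple of p. For p = 2, C = 1 and
     admissibility gives x_0 = 0, so that M_0 W = xi and the last two terms cancel. *)
  exists b => //; exists (f + (if p == 2 then 0 else (p.-1./2%:R : Zx) *: (M 0 *: W))).
    apply: fixedD fF _; case: eqP => _; first exact: fixed00.
    exact: fixedZ.
  have MbE : M 0 *: b = p' *: b + C%:R *: xi.
    have Dxi := km_xi_fixed kmA; move/fixed0D in Dxi.
    rewrite hE; transitivity (p' *: b + C%:R *: (D *: b) + h *: (D *: (D *: b))).
      by module.
    by rewrite Db Dxi scaler0 addr0.
  have {}MbE : p' *: b = M 0 *: y + C%:R *: (M 0 *: W) - C%:R *: xi.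
    have /fixed0D DM := MWF.
    transitivity (M 0 *: b - C%:R *: xi); first by rewrite MbE; module.
    rewrite /b; transitivity (M 0 *: y + C%:R *: (M 0 *: W)
      + h *: (D *: (M 0 *: W)) - C%:R *: xi); first by module.
    by rewrite DM scaler0 addr0.
  case: eqP => [p2|/eqP neq_p2].
    have C1 : C%:R = 1 :> Zx by rewrite /C p2.
    have x00 : x 0%N = 0.
      by have := xK 0%N m_gt0; rewrite (adm_p2n1 adm_a p2 n1).
    have MW : M 0 *: W = xi by rewrite -nrm x00 addr0.
    by rewrite MbE Ny C1 MW; module.
  have CE : C%:R = p' * p.-1./2%:R :> Zx.
    rewrite /C bin2 -natrM; congr (_%:R).
    have p_odd : odd p by case: (even_prime p_pr) neq_p2 => [->|].
    by rewrite -divn2 -muln_divA ?divn2 // dvdn2 -subn1 oddB ?prime_gt0 // p_odd.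
  rewrite MbE Ny CE; transitivity (p' *: (f + p.-1./2%:R *: (M 0 *: W)) - p.-1./2%:R *: (p' *: xi)).
    by module.
  by rewrite (km_xi_p kmA) scaler0 subr0.
have nE : n = n.-1.+1 by rewrite prednK.
have [g gE] := Mm_mod p n.-1.
have NE : N n = N n.-1 * M n.-1 by rewrite {1}nE NmS.
(* As M_(n-1) = p + T_(n-1) g, the term in W turns p N_(n-1) W into N_n W, and D N_(n-1) al becomes
   the norm of the system. *)
pose al := y + (N n.-1 * g) *: W.
have Db : D *: (N n.-1 *: al) = xi.
  rewrite -nrm NE gE subX1E.
  have -> : x 0%N = D *: y - p' *: W by rewrite rel; module.
  rewrite /al; module.
exists (N n.-1 *: al) => //.
have bK : fixed n.-1 (N n.-1 *: al).
  apply: (@fixedW _ _ 1); first by lia.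
  rewrite /fixed subXM expn0 expr1 mulrC -scalerA Db (Mm_fixed (i := 0)) ?(km_xi_p kmA) //.
  exact: km_xi_fixed kmA.
rewrite -(Mm_fixed bK) scalerA mulrC -NE {1}/al scalerDr Ny (Nm_n kmA).
exists (f + ((p ^ n.-2)%:R * g.[1])%:P *: (N n *: W)).
  by apply: fixedD fF _; apply/fixedZ/fixed_Nm/(km_fixed kmA).
rewrite hornerM Nm_horner.
(* Because n > 1, the contribution of W to N_n al is also p times an element of F. *)
have -> : (p ^ n.-1)%:R = p%:R * (p ^ n.-2)%:R :> int.
  by rewrite -natrM -expnS; congr ((p ^ _)%:R); lia.
rewrite -mulrA polyCM polyC_natr; module.
Qed.

(** The element x_j - M_i z has norm p f, so it is D h + k up to a multiple of p, with k one level
    lower. Since M_i z is p z modulo D, also x_j = k + D H + p Z. Then x_j can be replaced by k,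
    with D H moved into y and p Z into x_(j+1), against minimality. *)
Lemma minimal_norm_neq a i j e y x z f : minimal_sys p n m xi a ->
    system a e y x xi -> (j < m)%N -> a j = i.+1 ->
    fixed i.+1 z -> (i < n)%N \/ z = 0 -> fixed 0 f ->
  N i *: x j = N i *: (M i *: z) + p' *: f -> False.
Proof.
move=> min_a [xK rel nrm] lt_jm aj zK hz fF Nx.
have [adm_b adm_c adm_d] := min_adm min_a.
have le_in : (i <= n)%N by rewrite -ltnS -aj adm_b.
have xjK : fixed i (x j) by have := xK _ lt_jm; rewrite aj.
have [|h [k [f0 [hK kK f0K vE _]]]] := norm_p_fixed' kmA le_in (fixedB xjK (fixed_M zK)) fF.
  by rewrite scalerBr Nx; module.
have [g gE] := Mm_mod p i; rewrite subX1E in gE.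
pose H := h + (N i * g) *: z; pose Z := z + f0.
have xjE : x j = k + D *: H + p' *: Z.
  by rewrite -[LHS](subrK (M i *: z)) vE gE /H /Z; module.
have lift_fixed (w : A) : fixed i w -> fixed i.+1 w by apply: fixedW.
have HK : fixed i.+1 H by apply: fixedD; [apply: lift_fixed | apply: fixedZ].
have ZK : fixed i.+1 Z by apply: fixedD; [|apply: lift_fixed].
(* Entry j drops by one. Entry j + 1 may grow to that of K_(i+1), where H and Z live; the cap n + 1
   stands for K itself. *)
pose b l := if l == j then i else if l == j.+1 then maxn (a l) (minn i.+2 n.+1) else a l.
(* Subtracting p^j H from y removes p^j D H from the relation but adds p^(j+1) e H, which goes into
   x_(j+1) together with Z. *)
pose y2 := y - p' ^+ j *: H.
pose x2 l := x l + delta_fun j (k - x j) l + delta_fun j.+1 (Z + e%:P *: H) l.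
apply: (@minimal_ltF p n m A xi a b j min_a) => //; last 1 first.
- by rewrite /b eqxx aj.
- split; rewrite /b.
  + move=> l lt_lm; case: eqP => _; first exact: leqW.
    by case: eqP => _; rewrite ?geq_max ?adm_b // geq_minr.
  + case: eqP => // j0; by rewrite -ltnS -aj -j0 (leq_trans adm_c).
  + move=> p2 n1; case: eqP => [j0|_]; last exact: adm_d.
    by have := aj; rewrite -j0 adm_d.
- exists e, y2, x2.
  have x2E : wsum x2 = wsum x + wsum (delta_fun j (k - x j)) +
     p' ^+ j *: (Z + e%:P *: H) by rewrite -(wsum_deltaS p _ lt_jm) -!wsumD.
  have DNn (w : A) : N n *: (D *: w) = 0.
    by rewrite scalerA mulrC -subX1E; exact: (km_fixed kmA w).
  rewrite /norm_sys /wsys in rel nrm.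
  split.
  + move=> l lt_lm; rewrite /x2 /b /delta_fun; case: eqP => [->|_].
      by rewrite ltn_eqF // addr0 addrCA subrr addr0.
    rewrite addr0; case: eqP => _; last by rewrite addr0; apply: xK.
    apply: fixed'D; first exact: fixed'W (leq_maxl _ _) (xK _ lt_lm).
    apply: (@fixed'W _ _ (minn i.+2 n.+1)); first exact: leq_maxr.
    case: (ltnP i n) => [lt_in|le_ni].
      by rewrite (minn_idPl _) //=; apply/fixedD/fixedZ.
    have -> : minn i.+2 n.+1 = n.+1 by lia.
    exact: (fixed'_top kmA).
  + rewrite /wsys x2E {1}/x2 /delta_fun /=; case: eqP => [j0|/eqP].
      rewrite -j0 wsum_delta0 addr0 in lt_jm xjE *.
      have {}rel : D *: y = k + D *: H + p' *: Z + p' *: (e%:P *: y + wsum x).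
        by rewrite rel xjE.
      rewrite /y2 -j0 scalerBr rel; have -> : x 0%N + (k - x 0%N) = k by module.
      module.
    rewrite eq_sym -lt0n => j_gt0; have jE : j = j.-1.+1 by rewrite prednK.
    have kE : k - x j = - (D *: H + p' *: Z) by rewrite xjE; module.
    have pE : p' ^+ j = p' ^+ j.-1 * p' by rewrite {1}jE exprSr.
    rewrite {1}jE wsum_deltaS; last by lia.
    rewrite kE /y2 pE scalerBr rel; module.
  + rewrite /norm_sys /wsys x2E {1}/x2 /delta_fun /= -[RHS]nrm.
    case: eqP => [j0|/eqP].
      rewrite -j0 wsum_delta0 /y2 -j0.
      have nE : n = n.-1.+1 by rewrite prednK.
      have le_in1 : (i <= n.-1)%N.
        by have := aj; rewrite -j0; lia.
      (* For j = 0 the norm loses N_(n-1) (x_0 - k) and gains N_n Z, as the two terms in e H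
         cancel. *)
      have kE : N n.-1 *: (x 0%N - k) = N n *: Z.
        have -> : x 0%N - k = D *: h + p' *: f0 + M i *: z.
          by rewrite j0 -[x j](subrK (M i *: z)) vE; module.
        have h0 : N n.-1 *: (D *: h) = 0.
          rewrite scalerA mulrC -subX1E; exact: fixedW hK.
        have f00 : N n *: f0 = N n.-1 *: (p' *: f0).
          by rewrite {1}nE (Nm_fixedS (fixedW le_in1 f0K)); module.
        have z0 : N n *: z = N n.-1 *: (M i *: z).
          move: le_in1; rewrite leq_eqVlt => /orP[/eqP ->|lt_in1].
            by rewrite {1}nE NmS; module.
          have zK1 := fixedW lt_in1 zK.
          rewrite {1}nE (Nm_fixedS zK1) gE.
          transitivity (p' *: (N n.-1 *: z) + (N i * g) *: (D * N n.-1 *: z)).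
            by rewrite -subX1E zK1 scaler0 addr0.
          by module.
        rewrite !scalerDr h0 f00 z0; module.
      transitivity (N n *: (e%:P *: y + wsum x) + N n.-1 *: x 0%N +
        (N n *: Z - N n.-1 *: (x 0%N - k))); first by module.
      by rewrite kE subrr addr0.
    rewrite eq_sym -lt0n => j_gt0; have jE : j = j.-1.+1 by rewrite prednK.
    have kE : k - x j = - (D *: H + p' *: Z) by rewrite xjE; module.
    have pE : p' ^+ j = p' ^+ j.-1 * p' by rewrite {1}jE exprSr.
    rewrite {1}jE wsum_deltaS; last by lia.
    rewrite kE /y2 pE.
    transitivity (N n *: (e%:P *: y + wsum x) + N n.-1 *: x 0%N -
        p' ^+ j.-1 *: (N n *: (D *: H))); first by module.
    by rewrite DNn scaler0 subr0.
- by move=> l lt_lj; rewrite /b !ltn_eqF // ltnW.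
Qed.

(** Replacing x_j by x_j - u y is compensated by replacing e by e + p^(j-1) u. The tuple stays the
    same since x_j is only required to lie in K, and the multiple of N_n y disappears. *)
Lemma minimal_norm_top a j e y x u f : minimal_sys p n m xi a ->
    system a e y x xi -> (j < m)%N -> a j = n.+1 -> fixed 0 f ->
  N n *: x j = u%:P *: (N n *: y) + p' *: f -> False.
Proof.
move=> min_a [xK rel nrm] lt_jm aj fF Nx.
have [adm_b adm_c adm_d] := min_adm min_a.
have j_gt0 : (0 < j)%N.
  by rewrite lt0n; apply: contraTneq adm_c => j0; rewrite -j0 aj ltnn.
have jE : j = j.-1.+1 by rewrite prednK.
pose x2 l := x l + delta_fun j (- (u%:P *: y)) l.
pose e2 := e + p%:R ^+ j.-1 * u.
have wE : wsys e2 y x2 = wsys e y x.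
  rewrite /wsys; have -> : wsum x2 = wsum x + wsum (delta_fun j (- (u%:P *: y))).
    by rewrite -!wsumD.
  rewrite {1}jE wsum_deltaS; last by lia.
  by rewrite /e2 polyCD polyCM polyC_exp polyC_natr; module.
have x20 : x2 0%N = x 0%N by rewrite /x2 /delta_fun ltn_eqF ?addr0.
have x2j : x2 j = x j - u%:P *: y by rewrite /x2 /delta_fun eqxx.
have sys2 : system a e2 y x2 xi.
  split; rewrite /norm_sys ?wE ?x20 //.
  move=> l lt_lm; rewrite /x2 /delta_fun; case: eqP => [->|_].
    by rewrite aj; apply: km_fixed kmA _.
  by rewrite addr0; apply: xK.
apply: (minimal_norm_neq min_a sys2 lt_jm aj (z := 0) _ _ fF); first exact: fixed00.
  by right.
by rewrite x2j scalerBr Nx !scaler0 add0r; module.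
Qed.
End MinimalSystems.

(** * Relations modulo powers of p *)

Section PrimePowerIdeals.
Variable p : nat.
Hypothesis p_pr : prime p.
Local Notation Zx := {poly int}.
Local Notation D := ('X - 1 : Zx).
Local Notation T i := ('X^(p ^ i) - 1 : Zx).
Local Notation p' := (p%:R : Zx).

Definition pideal k (P c : Zx) := exists b b', c = p' ^+ k * b + P * b'.

Lemma pidealD k P c d : pideal k P c -> pideal k P d -> pideal k P (c + d).
Proof. by move=> [b [b' ->]] [f [f' ->]]; exists (b + f), (b' + f'); ring. Qed.

(** The socle of F_p[X]/(D^(L+1)) as a module over F_p[D] is spanned by D^L. *)
Lemma pidealD_head L c : pideal 1 (D ^+ L.+1) (D * c) ->
  exists (v : int) b b', c = v%:P * D ^+ L + p' * b + D ^+ L.+1 * b'.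
Proof.
move=> [u [w]]; rewrite expr1 exprS => cE.
have /(cancelD p_pr)[r rE] : D * (c - D ^+ L * w) = p' * u.
  by rewrite mulrBr cE; ring.
have [w' wE] := poly_taylor1 w.
exists w.[1], r, w'; rewrite -[c](subrK (D ^+ L * w)) rE {1}wE; ring.
Qed.

Lemma pideal_frob l c : pideal 1 (D ^+ (p ^ l)) c -> pideal 1 (T l) c.
Proof.
have [u uE] := frobX p_pr l; move=> [b [b' ->]].
by exists (b - u * b'), b'; rewrite uE !expr1; ring.
Qed.

Lemma dvdz_polyC (v : int) : (p %| v)%Z -> exists u : int, v%:P = p' * u%:P.
Proof.
by case/dvdzP=> u ->; exists u; rewrite mulrC polyCM /= -polyC_natr natz.
Qed.

Lemma inv_modz (v : int) : ~ (p %| v)%Z -> exists (u k : int), v%:P * u%:P = 1 + p' * k%:P.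
Proof.
move=> ndvd; have /coprimezP[[u k] /= uE] : coprimez v p.
  rewrite coprimezE absz_nat coprime_sym prime_coprime //.
  by apply/negP => dvd; apply: ndvd; rewrite dvdzE absz_nat.
exists u, (- k); have := congr1 polyC uE.
rewrite polyCD !polyCM /= [(p%:Z)%:P](_ : _ = p'); last by rewrite -polyC_natr natz.
rewrite polyC1 polyCN => {}uE.
transitivity (u%:P * v%:P + k%:P * p' - p' * k%:P); first by ring.
by rewrite uE; ring.
Qed.
End PrimePowerIdeals.

Section Independence.
Variables (p n m : nat) (A : lmodType {poly int}) (xi : A).
Local Notation Zx := {poly int}.
Local Notation D := ('X - 1 : Zx).
Local Notation T i := ('X^(p ^ i) - 1 : Zx).
Local Notation N := (Nm p).
Local Notation p' := (p%:R : Zx).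
Local Notation fixed := (fixed p).
Hypothesis kmA : kummer_module p n m xi.
Let p_pr := km_prime kmA.
Let n_gt0 := km_n_gt0 kmA.
Let m_gt0 := km_m_gt0 kmA.
Local Notation wsum := (wsum p m).
Local Notation wsys := (wsys p m).
Local Notation system := (system p n m).
Local Notation pideal := (pideal p).

Lemma xi_dvd (c : int) : (p %| c)%Z -> c%:P *: xi = 0.
Proof. by move=> /dvdz_polyC[u ->]; rewrite mulrC -scalerA (km_xi_p kmA) scaler0. Qed.

(** Each D^t c_i is killed by D in F_p[G_l] with l = [l i], hence is a multiple v_i N_l there; if p
    divides v_i, it is zero. A relation is thus turned into one between norms. *)
Lemma socle_family (I : eqType) (r : seq I) (l : I -> nat) (g : I -> A) (c : I -> Zx) t :
    {in r, forall i, fixed (l i) (g i)} ->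
    {in r, forall i, pideal 1 (D ^+ (p ^ l i)) (D ^+ t.+1 * c i)} ->
  exists (v : I -> int) w,
    D ^+ t *: (\sum_(i <- r) c i *: g i) =
      \sum_(i <- r) (v i)%:P *: (N (l i) *: g i) + p' *: w /\
    {in r, forall i, (p %| v i)%Z -> pideal 1 (D ^+ (p ^ l i)) (D ^+ t * c i)}.
Proof.
move=> gK cI.
have /choice[v vP] : forall i, exists v : int, i \in r ->
   (exists w, D ^+ t *: (c i *: g i) = v%:P *: (N (l i) *: g i) + p' *: w) /\
   ((p %| v)%Z -> pideal 1 (D ^+ (p ^ l i)) (D ^+ t * c i)).
  move=> i; have [i_r|i_r] := boolP (i \in r); last by exists 0.
  have Lgt0 : (0 < p ^ l i)%N by rewrite expn_gt0 prime_gt0.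
  have := cI i i_r; rewrite exprS -mulrA -{1}(prednK Lgt0).
  case/(pidealD_head p_pr)=> v [b [b' cE]]; rewrite prednK // in cE.
  exists v => _; split.
    have [u uE] := frobX p_pr (l i); have [s sE] := frobN p_pr (l i).
    exists ((b - v%:P * s - u * b') *: g i).
    have giK : T (l i) *: g i = 0 := gK i i_r.
    rewrite scalerA cE; transitivity
      ((v%:P * (D ^+ (p ^ l i).-1 + p' * s)) *: g i + p' *: ((b - v%:P * s - u * b') *: g i)
      + b' *: ((D ^+ (p ^ l i) + p' * u) *: g i)); first by module.
    by rewrite -uE giK scaler0 addr0 -sE; module.
  case/dvdz_polyC=> u vE; rewrite cE vE.
  by exists (u%:P * D ^+ (p ^ l i).-1 + b), b'; rewrite expr1; ring.
have [w wE] : exists w, D ^+ t *: (\sum_(i <- r) c i *: g i) =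
      \sum_(i <- r) (v i)%:P *: (N (l i) *: g i) + p' *: w.
  rewrite scaler_sumr !big_seq; apply: (big_ind2 (fun s1 s2 => exists w, s1 = s2 + p' *: w)).
  - by exists 0; rewrite scaler0 addr0.
  - by move=> s1 s2 t1 t2 [w1 ->] [w2 ->]; exists (w1 + w2); module.
  - by move=> i i_r; case: (vP i i_r).
by exists v, w; split=> // i i_r; case: (vP i i_r).
Qed.

Section System.
Variables (a : nat -> nat) (e : int) (y : A) (x : nat -> A).
Hypothesis adm_a : admissible p n m a.
Hypothesis sys : system a e y x xi.

(** Modulo p, D y is x_0, and x_0 is killed by D^(p^i) if it lies in K_i. So D^[len_y] kills y
    modulo p. *)
Definition len_y := if a 0 is i.+1 then (p ^ i).+1 else 1%N.

Lemma sys_rel_full : (D - p' * e%:P) *: y =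
  \sum_(j < m) p' ^+ j *: x j + p' ^+ m *: x m.
Proof.
have -> : \sum_(j < m) p' ^+ j *: x j + p' ^+ m *: x m = x 0%N + p' *: wsum x.
  transitivity (\sum_(j < m.+1) p' ^+ j *: x j); first by rewrite big_ord_recr.
  rewrite big_ord_recl expr0 scale1r /wsum scaler_sumr.
  by congr (_ + _); apply: eq_bigr => j _; rewrite scalerA -exprS.
have := sys_rel sys; rewrite /wsys => rel.
rewrite scalerBl rel; module.
Qed.

Definition norm_coef j := if j is i.+1 then p' ^+ i * N n else N n.-1.

Lemma sys_norm_full : xi = (e%:P * N n) *: y +
  \sum_(j < m) norm_coef j *: x j + (p' ^+ m.-1 * N n) *: x m.
Proof.
rewrite -[LHS](sys_norm sys) /norm_sys /wsys.
have mE : m = m.-1.+1 by rewrite prednK.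
have -> : \sum_(j < m) norm_coef j *: x j =
    N n.-1 *: x 0%N + \sum_(0 <= j < m.-1) norm_coef j.+1 *: x j.+1.
  by rewrite -(big_mkord xpredT (fun j => norm_coef j *: x j)) {1}mE big_nat_recl.
have -> : wsum x = \sum_(0 <= j < m.-1) p' ^+ j *: x j.+1 + p' ^+ m.-1 *: x m.
  rewrite /wsum -(big_mkord xpredT (fun j => p' ^+ j *: x j.+1)) {1}mE.
  by rewrite big_nat_recr //= -mE.
have -> : \sum_(0 <= j < m.-1) norm_coef j.+1 *: x j.+1 =
    N n *: \sum_(0 <= j < m.-1) p' ^+ j *: x j.+1.
  by rewrite scaler_sumr; apply: eq_bigr => j _; rewrite scalerA [N n * _]mulrC.
module.
Qed.

(** p^(n-1) + 1 exceeds p^n - 1 only for p = 2 and n = 1, where admissibility forces x_0 = 0. As N_n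
    is D^(p^n - 1) modulo p, the norm of y is then a p-th power in K^x. *)
Lemma len_y_le : (len_y <= (p ^ n).-1)%N.
Proof.
have := adm_0 adm_a; have := adm_p2n1 adm_a; rewrite /len_y.
have p_gt1 := prime_gt1 p_pr.
have p_n : (p ^ n = p * p ^ n.-1)%N by rewrite -expnS prednK.
have pn1 : (0 < p ^ n.-1)%N by rewrite expn_gt0 prime_gt0.
case: (a 0%N) => [|i] adm2 lt_in; first by rewrite p_n; nia.
have le_p : (p ^ i <= p ^ n.-1)%N by rewrite leq_exp2l //; lia.
have [p2|p3] : p = 2%N \/ (2 < p)%N by lia.
  have n1 : (1 < n)%N by case: (n) (n_gt0) adm2 => [|[|]] // _ /(_ p2 (erefl _)).
  have : (2 <= p ^ n.-1)%N.
    by rewrite -{1}(expn1 2) p2 leq_exp2l //; lia.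
  rewrite p_n p2 in le_p *; lia.
rewrite p_n; nia.
Qed.

Lemma len_yP : exists w, D ^+ len_y *: y = p' *: w.
Proof.
have rel := sys_rel sys; rewrite /len_y; have := sys_fixed sys m_gt0.
case: (a 0%N) => [|i] /= x0K.
  by exists (wsys e y x); rewrite expr1 rel x0K add0r.
have [u uE] := frobX p_pr i.
exists (D ^+ (p ^ i) *: wsys e y x - u *: x 0%N).
rewrite exprSr -scalerA rel; transitivity (T i *: x 0%N + p' *: (D ^+ (p ^ i) *: wsys e y x - u *: x 0%N)).
  by rewrite uE; module.
by rewrite x0K add0r.
Qed.

Lemma norm_y_p : exists w, N n *: y = p' *: w.
Proof.
have [w wE] := len_yP; have [u uE] := frobN p_pr n.
exists (D ^+ ((p ^ n).-1 - len_y) *: w + u *: y).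
have DE : D ^+ (p ^ n).-1 = D ^+ ((p ^ n).-1 - len_y) * D ^+ len_y.
  by rewrite -exprD subnK // len_y_le.
rewrite uE DE scalerDl -scalerA wE; module.
Qed.

(** Kummer theory: the elements of F that become p-th powers in K are, modulo F^xp, the powers of
    one class, and N_n y represents it. If f = p w, then D w is a multiple of xi; the same holds for
    N_n y = p w0, where D w0 is not zero by [norm_y_neq]. *)
Lemma fixed0_p f w : fixed 0 f -> f = p' *: w ->
  exists (c : int) f', fixed 0 f' /\ f = c%:P *: (N n *: y) + p' *: f'.
Proof.
move=> fF fE; have [w0 w0E] := norm_y_p.
have tors (z : A) : fixed 0 (p' *: z) -> exists c : int, D *: z = c%:P *: xi.
  move/fixed0D => zF; apply: (km_torsion kmA).
  by transitivity (D *: (p' *: z)); first module.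
have [c cE] : exists c : int, D *: w = c%:P *: xi by apply: tors; rewrite -fE.
have [c0 c0E] : exists c : int, D *: w0 = c%:P *: xi.
  by apply: tors; rewrite -w0E; apply/fixed_Nm/(km_fixed kmA).
have [/xi_dvd c00|/negP/(inv_modz p_pr)[b [k bE]]] := boolP (p %| c0)%Z.
  case: (norm_y_neq kmA adm_a sys _ w0E); apply/fixed0D.
  by rewrite c0E.
exists (c * b), (w - (c * b)%:P *: w0); split.
  apply/fixed0D; rewrite scalerBr cE scalerA mulrC -scalerA c0E scalerA polyCM.
  have -> : (c%:P * b%:P * c0%:P = c%:P + p' * (c%:P * k%:P) :> Zx).
    by transitivity (c%:P * (c0%:P * b%:P)); [ring | rewrite bE; ring].
  transitivity (- (c%:P * k%:P) *: (p' *: xi)); first by module.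
  by rewrite (km_xi_p kmA) scaler0.
by rewrite w0E fE; module.
Qed.

Section Family.
Variables (I : eqType) (r : seq I) (l : I -> nat) (g : I -> A).
Hypothesis gK : {in r, forall t, fixed (l t) (g t)}.

(** Independence in F^x/F^xp, with integers in place of coefficients in F_p. An index with [a j = 0]
    has x_j = 0, so its coefficient is left free. *)
Definition lin_indep := forall (u0 : int) (u : 'I_m -> int) (v : I -> int) f,
  fixed 0 f ->
  u0%:P *: (N n *: y) + \sum_(j < m) (u j)%:P *: (N (a j).-1 *: x j)
    + \sum_(t <- r) (v t)%:P *: (N (l t) *: g t) = p' *: f ->
  [/\ (p %| u0)%Z, forall j : 'I_m, (0 < a j)%N -> (p %| u j)%Z
    & {in r, forall t, (p %| v t)%Z}].

Hypothesis indep : lin_indep.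

Let P (j : 'I_m) := (0 < j)%N && (0 < a j)%N.

Lemma x_fixed (j : 'I_m) : fixed (a j).-1 (x j).
Proof.
have := sys_fixed sys (ltn_ord j); case: (a j) => [|i] //= ->.
exact: fixed00.
Qed.

Lemma sum_a0 (c : 'I_m -> Zx) : \sum_(j < m) c j *: x j =
  c (Ordinal m_gt0) *: x 0%N + \sum_(j < m | P j) c j *: x j.
Proof.
rewrite (bigD1 (Ordinal m_gt0)) //=; congr (_ + _).
rewrite [LHS](bigID (fun j : 'I_m => (0 < a j)%N)) /= [X in _ + X]big1 ?addr0.
  apply: eq_bigl => j; rewrite /P; congr (_ && _).
  by rewrite lt0n -val_eqE.
move=> j /andP[_ aj0]; have := sys_fixed sys (ltn_ord j).
by case: (a j) aj0 => //= _ ->; rewrite scaler0.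
Qed.

(** Descent on t: D^t times the relation is a relation between norms, whose coefficients are
    divisible by p by independence, so the hypotheses already hold for t. The term in x_0 is
    excluded because x_0 is D y modulo p. *)
Lemma kernel_mod_p_step t (al : Zx) (be : 'I_m -> Zx) (ga : I -> Zx) w :
    al *: y + \sum_(j < m | P j) be j *: x j + \sum_(i <- r) ga i *: g i = p' *: w ->
    pideal 1 (D ^+ len_y) (D ^+ t * al) ->
    (forall j, P j -> pideal 1 (D ^+ (p ^ (a j).-1)) (D ^+ t * be j)) ->
    {in r, forall i, pideal 1 (D ^+ (p ^ l i)) (D ^+ t * ga i)} ->
  [/\ pideal 1 (D ^+ len_y) al, forall j, P j -> pideal 1 (D ^+ (p ^ (a j).-1)) (be j)
    & {in r, forall i, pideal 1 (D ^+ (p ^ l i)) (ga i)}].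
Proof.
move=> rel; elim: t => [|t IHt] alI beI gaI.
  split; first by rewrite -[al]mul1r -[1](expr0 D).
    by move=> j /beI; rewrite expr0 mul1r.
  by move=> i /gaI; rewrite expr0 mul1r.
have LE : len_y = len_y.-1.+1 by rewrite /len_y; case: (a 0%N).
move: alI; rewrite exprS -mulrA {1}LE => /(pidealD_head p_pr)[v0 [b [b' alE]]].
rewrite -LE in alE.
pose rP := [seq j <- index_enum 'I_m | P j].
have mem_rP j : (j \in rP) = P j by rewrite mem_filter mem_index_enum andbT.
have [|j|v [wv [vE vI]]] := @socle_family _ rP (fun j => (a j).-1) (fun j => x j) be t.
- by move=> j _; apply: x_fixed.
- by rewrite mem_rP; apply: beI.
have [z [wz [zE zI]]] := socle_family gK gaI.
rewrite !big_filter in vE.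
have [wy wyE] := len_yP.
pose u j := if P j then v j else if (j : nat) == 0%N then v0 else 0.
pose f := \sum_(j < m) (u j)%:P *: (N (a j).-1 *: x j)
  + \sum_(i <- r) (z i)%:P *: (N (l i) *: g i).
have fF : fixed 0 f.
  apply: fixedD; last rewrite big_seq; apply: fixed_sum => i i_r.
    by apply/fixedZ/fixed_Nm/x_fixed.
  by apply/fixedZ/fixed_Nm/gK.
have uE : \sum_(j < m) (u j)%:P *: (N (a j).-1 *: x j) =
    (if (0 < a 0)%N then v0 else 0)%:P *: (N (a 0).-1 *: x 0%N)
    + \sum_(j < m | P j) (v j)%:P *: (N (a j).-1 *: x j).
  transitivity (\sum_(j < m) ((u j)%:P * N (a j).-1) *: x j).
    by apply: eq_bigr => j _; rewrite scalerA.
  rewrite sum_a0 {1}/u /P /= scalerA; congr (_ + _).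
    case: ifP => // a00; have := sys_fixed sys m_gt0.
    by move/negbT: a00; rewrite -eqn0Ngt => /eqP -> /= ->; rewrite !scaler0.
  by apply: eq_bigr => j Pj; rewrite /u /P ifT // scalerA.
have alE' : (D ^+ t * al) *: y = v0%:P *: (D ^+ len_y.-1 *: y) + p' *: (b *: y + b' *: wy).
  rewrite alE; transitivity (v0%:P *: (D ^+ len_y.-1 *: y) + p' *: (b *: y)
    + b' *: (D ^+ len_y *: y)); first by module.
  by rewrite wyE; module.
have rel' : v0%:P *: (D ^+ len_y.-1 *: y)
    + (\sum_(j < m | P j) (v j)%:P *: (N (a j).-1 *: x j)
    + \sum_(i <- r) (z i)%:P *: (N (l i) *: g i))
    = p' *: (D ^+ t *: w - b *: y - b' *: wy - wv - wz).
  transitivity ((D ^+ t * al) *: y - p' *: (b *: y + b' *: wy)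
    + (D ^+ t *: \sum_(j < m | P j) be j *: x j - p' *: wv)
    + (D ^+ t *: (\sum_(i <- r) ga i *: g i) - p' *: wz)).
    by rewrite alE' vE zE; module.
  transitivity (D ^+ t *: (al *: y + \sum_(j < m | P j) be j *: x j
     + \sum_(i <- r) ga i *: g i) - p' *: (b *: y + b' *: wy + wv + wz)); first by module.
  by rewrite rel; module.
move: rel'; set w2 := (_ - wz) => rel'.
(* If x_0 lies in K_i, then D^(p^i) y is N_i x_0 modulo p, so v0 acts as the coefficient of N_i x_0.
   If x_0 = 0, the term is v0 y itself; applying N_n, which multiplies f by p^n, shows that p
   divides v0. *)
have [w3 [fE v0E]] : exists w, f = p' *: w /\ (a 0 = 0%N -> (p %| v0)%Z).
  have := sys_fixed sys m_gt0; have := sys_rel sys; move: rel' uE.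
  rewrite /len_y; case: (a 0%N) => [|i] /= rel' uE Dy x0K.
    rewrite x0K !scaler0 add0r in uE; rewrite -uE -/f scale1r in rel'.
    suff v00 : (p %| v0)%Z.
      have /dvdz_polyC[v1 v1E] := v00.
      exists (w2 - v1%:P *: y); split=> //.
      transitivity (v0%:P *: y + f - v0%:P *: y); first by module.
      by rewrite rel' v1E; module.
    have [] // := @indep v0 (fun=> 0) (fun=> 0) (N n *: w2 - (p%:R ^+ n.-1)%:P *: f).
      by apply: fixedB; [apply/fixed_Nm/(km_fixed kmA) | apply: fixedZ].
    rewrite !big1 ?addr0; last first; try by move=> *; rewrite scale0r.
    transitivity (N n *: (v0%:P *: y + f) - N n *: f); first by module.
    rewrite rel' (fixed0Z (N n) fF) Nm_horner.
    have -> : (p ^ n)%:R = p%:R * p%:R ^+ n.-1 :> int.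
      by rewrite -exprS prednK // natrX.
    by rewrite polyCM polyC_natr; module.
  have [s sE] := frobN p_pr i.
  exists (w2 - v0%:P *: (D ^+ (p ^ i).-1 *: wsys e y x - s *: x 0%N)); split=> //.
  have DE : D ^+ (p ^ i) *: y = D ^+ (p ^ i).-1 *: (D *: y).
    by rewrite scalerA -exprSr prednK // expn_gt0 prime_gt0.
  rewrite /f uE; transitivity ((v0%:P *: (D ^+ (p ^ i) *: y) +
   (\sum_(j < m | P j) (v j)%:P *: (N (a j).-1 *: x j)
    + \sum_(i <- r) (z i)%:P *: (N (l i) *: g i)))
     - v0%:P *: (D ^+ (p ^ i) *: y) + v0%:P *: (N i *: x 0%N)).
    by module.
  rewrite rel' DE Dy sE; module.
(* f lies in F but is divisible by p only in K; the discrepancy is a multiple of N_n y, to which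
   independence also applies. *)
have [c [f' [f'F fE']]] := fixed0_p fF fE.
have [|_ uI zI'] := @indep (- c) u z f' f'F.
  by rewrite -addrA -/f fE' polyCN; module.
apply: IHt.
- suff /dvdz_polyC[v1 v1E] : (p %| v0)%Z.
    by rewrite alE v1E; exists (v1%:P * D ^+ len_y.-1 + b), b'; ring.
  have [a00|a0] := posnP (a 0%N); first exact: v0E.
  by have := uI (Ordinal m_gt0) a0; rewrite /u /P.
- move=> j Pj; apply: vI; first by rewrite mem_rP.
  by have /andP[_ aj] := Pj; have := uI j aj; rewrite /u Pj.
- by move=> i i_r; apply: zI => //; apply: zI'.
Qed.
End Family.
End System.
End Independence.

Section Kernel.
Variables (p n m : nat) (A : lmodType {poly int}) (xi : A).
Local Notation Zx := {poly int}.
Local Notation D := ('X - 1 : Zx).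
Local Notation T i := ('X^(p ^ i) - 1 : Zx).
Local Notation N := (Nm p).
Local Notation M := (Mm p).
Local Notation p' := (p%:R : Zx).
Local Notation fixed := (fixed p).
Hypothesis kmA : kummer_module p n m xi.
Let p_pr := km_prime kmA.
Let n_gt0 := km_n_gt0 kmA.
Let m_gt0 := km_m_gt0 kmA.
Local Notation wsys := (wsys p m).
Local Notation system := (system p n m).
Local Notation pideal := (pideal p).
Variables (a : nat -> nat) (e : int) (y : A) (x : nat -> A).
Hypothesis adm_a : admissible p n m a.
Hypothesis sys : system a e y x xi.
Local Notation len_y := (len_y p a).
Variables (I : eqType) (r : seq I) (l : I -> nat) (g : I -> A).
Hypothesis l_le : {in r, forall t, (l t <= n)%N}.
Hypothesis gK : {in r, forall t, fixed (l t) (g t)}.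
Hypothesis indep : lin_indep p n m a y x r l g.
Let P (j : 'I_m) := (0 < j)%N && (0 < a j)%N.
Local Notation j0 := (Ordinal m_gt0).

(* Modulo [p^k], the coefficients are those of [q] times the relation [sys_rel_full]. *)
Definition in_rel k (q al : Zx) (be : 'I_m -> Zx) (ga : I -> Zx) :=
  [/\ pideal k (T n) (al - q * (D - p' * e%:P)),
      forall j : 'I_m, (0 < a j)%N -> pideal k (T (a j).-1) (be j + q * p' ^+ j)
    & {in r, forall i, pideal k (T (l i)) (ga i)}].

Lemma len_y_leq : (len_y <= p ^ n)%N.
Proof. exact: leq_trans (len_y_le kmA adm_a) (leq_pred _). Qed.

Lemma pidealDn L L' c : (L <= L')%N -> pideal 1 (D ^+ L) (D ^+ L' * c).
Proof.
by move=> /subnK <-; rewrite exprD; exists 0, (D ^+ (L' - L) * c); ring.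
Qed.

(** x_0 is eliminated by x_0 = D y - p W, and D^(p^n) is high enough to start the descent. The
    multiple of D^[len_y] that remains in the coefficient of y gives q. *)
Lemma kernel_mod_p al be ga w :
    al *: y + \sum_(j < m) be j *: x j + \sum_(i <- r) ga i *: g i = p' *: w ->
  exists q, in_rel 1 q al be ga.
Proof.
rewrite (sum_a0 kmA sys) => rel.
pose b0 := if (0 < a 0)%N then be j0 else 0.
have b0E : be j0 *: x 0%N = b0 *: x 0%N.
  have := sys_fixed sys m_gt0; rewrite /b0; case: (a 0%N) => //= ->.
  by rewrite !scaler0.
have p_gt1 := prime_gt1 p_pr.
have [||j Pj|i i_r|alI beI gaI] := @kernel_mod_p_step _ _ _ _ _ kmA _ _ _ _ adm_a sys _ r l g
   gK indep (p ^ n)%N (al + b0 * D) be ga (w + b0 *: wsys e y x).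
- rewrite scalerDl -scalerA (sys_rel sys).
  transitivity (al *: y + (b0 *: x 0%N + \sum_(j < m | P j) be j *: x j)
    + \sum_(i <- r) ga i *: g i + p' *: (b0 *: wsys e y x)); first by module.
  by rewrite -b0E rel; module.
- exact/pidealDn/len_y_leq.
- apply: pidealDn; rewrite leq_exp2l // -ltnS.
  by have := adm_bound adm_a (ltn_ord j); case/andP: Pj; lia.
- by apply: pidealDn; rewrite leq_exp2l // l_le.
have [b [b' alE]] := alI.
have alE' : al = p' * b + D ^+ len_y * b' - b0 * D by rewrite -(addrK (b0 * D) al) alE expr1.
have Pj_in q j : P j -> pideal 1 (T (a j).-1) (be j + q * p' ^+ j).
  move=> Pj; apply: pidealD; first exact/(pideal_frob p_pr)/beI.
  have /andP[j_gt0 _] := Pj; rewrite -(prednK j_gt0) exprS.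
  by exists (q * p' ^+ j.-1), 0; ring.
case: (posnP (a 0%N)) => a0.
  exists b'; split.
  - exists (b + b' * e%:P), 0; rewrite alE' /b0 a0 /len_y a0 !expr1; ring.
  - move=> j aj; apply: Pj_in; rewrite /P aj andbT lt0n.
    by apply: contraTneq aj => ->; rewrite a0.
  - by move=> i i_r; apply/(pideal_frob p_pr)/gaI.
have [u uE] := frobX p_pr (a 0%N).-1.
have LE : D ^+ len_y = D * D ^+ (p ^ (a 0%N).-1).
  by rewrite -exprS /len_y; case: (a 0%N) a0.
exists (D ^+ (p ^ (a 0%N).-1) * b' - b0); split.
- by exists (b + (D ^+ (p ^ (a 0%N).-1) * b' - b0) * e%:P), 0; rewrite alE' LE expr1; ring.
- move=> j aj; have [Pj|] := boolP (P j); first exact: Pj_in.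
  rewrite /P aj andbT -eqn0Ngt => /eqP jE.
  have -> : j = j0 by apply: val_inj.
  exists (- u * b'), b'; rewrite /b0 a0 /= uE expr0 expr1; ring.
- by move=> i i_r; apply/(pideal_frob p_pr)/gaI.
Qed.

Lemma kernel_mod_expp k al be ga w : (k <= m)%N ->
    al *: y + \sum_(j < m) be j *: x j + \sum_(i <- r) ga i *: g i = p' ^+ k *: w ->
  exists q, in_rel k q al be ga.
Proof.
elim: k al be ga w => [|k IHk] al be ga w le_km rel.
  have triv Q c : pideal 0 Q c by exists c, 0; ring.
  exists 0; split; [exact: triv|move=> j _; exact: triv|move=> i _; exact: triv].
have [q [[b0 [b' alE]] beE gaE]] : exists q, in_rel 1 q al be ga.
  by apply: kernel_mod_p; rewrite rel exprS -scalerA.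
have /choice[be1 be1E] : forall j : 'I_m, exists b : Zx,
    (a j = 0%N -> b = 0) /\ ((0 < a j)%N -> exists c, be j = p' * b - q * p' ^+ j + T (a j).-1 * c).
  move=> j; have [aj|aj] := posnP (a j); first by exists 0.
  have [b [c bE]] := beE j aj; exists b; split=> [aj0|_]; first by rewrite aj0 in aj.
  by exists c; rewrite -[be j](addrK (q * p' ^+ j)) bE expr1; ring.
have /choice[ga1 ga1E] : forall i, exists b : Zx,
    i \in r -> exists c, ga i = p' * b + T (l i) * c.
  move=> i; have [i_r|] := boolP (i \in r); last by exists 0.
  have [b [c bE]] := gaE i i_r; exists b => _.
  by exists c; rewrite bE expr1.
have mE : m = m.-1.+1 by rewrite prednK.
(* Subtracting q times the full relation leaves p times a relation modulo p^k. Dividing it by p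
   costs a multiple of xi. *)
have /(km_torsion kmA)[c cE] : p' *: (b0 *: y + \sum_(j < m) be1 j *: x j
    + \sum_(i <- r) ga1 i *: g i - p' ^+ k *: w + q *: (p' ^+ m.-1 *: x m)) = 0.
  have alE' : al = q * (D - p' * e%:P) + p' * b0 + T n * b'.
    by rewrite -[al](subrK (q * (D - p' * e%:P))) alE expr1; ring.
  have T0 z : T n *: z = 0 :> A by exact: (km_fixed kmA).
  have beS : \sum_(j < m) be j *: x j =
      p' *: (\sum_(j < m) be1 j *: x j) - q *: (\sum_(j < m) p' ^+ j *: x j).
    rewrite !scaler_sumr -sumrB; apply: eq_bigr => j _; have [be10 be1S] := be1E j.
    have xjK := x_fixed sys j.
    have [aj|/be1S[d ->]] := posnP (a j).
      have := sys_fixed sys (ltn_ord j); rewrite aj /= => ->.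
      by rewrite !scaler0 subr0.
    transitivity (p' *: (be1 j *: x j) - q *: (p' ^+ j *: x j) + d *: (T (a j).-1 *: x j)).
      by module.
    by rewrite xjK scaler0 addr0.
  have gaS : \sum_(i <- r) ga i *: g i = p' *: (\sum_(i <- r) ga1 i *: g i).
    rewrite scaler_sumr !big_seq; apply: eq_bigr => i i_r.
    have [d ->] := ga1E i i_r; have giK := gK i_r.
    transitivity (p' *: (ga1 i *: g i) + d *: (T (l i) *: g i)); first by module.
    by rewrite giK scaler0 addr0.
  have := sys_rel_full sys; move: rel; rewrite gaS beS alE'.
  move=> rel /(congr1 (fun z => q *: z)) relf.
  have pm : p' ^+ m = p' * p' ^+ m.-1 by rewrite -exprS -mE.
  transitivity ((q * (D - p' * e%:P) + p' * b0 + T n * b') *: y +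
    (p' *: (\sum_(j < m) be1 j *: x j) - q *: (\sum_(j < m) p' ^+ j *: x j)) +
    p' *: (\sum_(i <- r) ga1 i *: g i) - b' *: (T n *: y) - p' ^+ k.+1 *: w
    + q *: (\sum_(j < m) p' ^+ j *: x j + p' ^+ m *: x m) - q *: ((D - p' * e%:P) *: y)).
    by rewrite pm exprS; module.
  by rewrite rel relf T0 scaler0; module.
have xiE := sys_norm_full kmA sys.
have lt_km : (k < m)%N by [].
(* The multiple of xi is replaced by its expression as the norm of the system, which only changes
   the coefficients of y and of the x_j; the terms in x_m are divisible by p^k as k < m. *)
have [|q2 [[b2 [c2 al2E]] be2E ga2E]] := IHk (b0 - c%:P * (e%:P * N n))
    (fun j => be1 j - c%:P * norm_coef p n j) ga1
    (w - (p' ^+ (m.-1 - k) * q) *: x m + (c%:P * p' ^+ (m.-1 - k) * N n) *: x m) (ltnW lt_km).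
  have -> : \sum_(j < m) (be1 j - c%:P * norm_coef p n j) *: x j =
      \sum_(j < m) be1 j *: x j - c%:P *: (\sum_(j < m) norm_coef p n j *: x j).
    by rewrite scaler_sumr -sumrB; apply: eq_bigr => j _; module.
  have pm : p' ^+ m.-1 = p' ^+ k * p' ^+ (m.-1 - k) by rewrite -exprD subnKC //; lia.
  transitivity (b0 *: y + \sum_(j < m) be1 j *: x j
    + \sum_(i <- r) ga1 i *: g i - p' ^+ k *: w + q *: (p' ^+ m.-1 *: x m)
    - c%:P *: ((e%:P * N n) *: y + \sum_(j < m) norm_coef p n j *: x j
       + (p' ^+ m.-1 * N n) *: x m) + c%:P *: ((p' ^+ m.-1 * N n) *: x m)
       + p' ^+ k *: w - q *: (p' ^+ m.-1 *: x m)); first by module.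
  by rewrite -xiE cE pm; module.
(* p e N_n = T_n - N_n (D - p e): multiplied by p, the norm is -N_n times the coefficient of y in
   the relation, up to T_n. *)
exists (q + p' * q2 - c%:P * N n); split.
- have alE' : al = q * (D - p' * e%:P) + p' * b0 + T n * b'.
    by rewrite -[al](subrK (q * (D - p' * e%:P))) alE expr1; ring.
  have b0E : b0 = p' ^+ k * b2 + T n * c2 + q2 * (D - p' * e%:P) + c%:P * (e%:P * N n).
    by rewrite -al2E; ring.
  exists b2, (b' + p' * c2 + c%:P).
  have TE := subX1E p n; rewrite alE' b0E exprS TE; ring.
- move=> j aj; have [_ /(_ aj)[d bejE]] := be1E j.
  have [b3 [c3 be1jE]] := be2E j aj.
  have {}be1jE : be1 j = p' ^+ k * b3 + T (a j).-1 * c3 - q2 * p' ^+ j + c%:P * norm_coef p n j.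
    by rewrite -be1jE; ring.
  (* For j = 0 this is M_(n-1) = p modulo T_(n-1), which is a multiple of T_(a_0 - 1). *)
  have [d2 NE] : exists d2, p' * norm_coef p n j = p' ^+ j * N n + T (a j).-1 * d2.
    case: (j : nat) aj => [|i] aj; last by exists 0; rewrite /= exprS; ring.
    have [s sE] := Mm_mod p n.-1.
    have [] := @subX_dvd p (a 0%N).-1 n.-1; first by have := adm_0 adm_a; lia.
    move=> h hE; exists (- (h * s * N n.-1)).
    have -> : N n = N n.-1 * M n.-1 by rewrite -NmS prednK.
    by rewrite /= sE hE; ring.
  exists b3, (d + p' * c3 + c%:P * d2).
  rewrite bejE; transitivity (p' * (be1 j - c%:P * norm_coef p n j) + c%:P * (p' * norm_coef p n j)
    + p' * q2 * p' ^+ j - c%:P * N n * p' ^+ j + T (a j).-1 * d); first by ring.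
  by rewrite NE be1jE exprS; ring.
- move=> i i_r; have [b [c3 gaiE]] := ga2E i i_r; have [d ->] := ga1E i i_r.
  by exists b, (d + p' * c3); rewrite gaiE exprS; ring.
Qed.
End Kernel.

(** * Levels *)

Section Levels.
Variables (p n m : nat) (A : lmodType {poly int}) (xi : A).
Local Notation Zx := {poly int}.
Local Notation D := ('X - 1 : Zx).
Local Notation T i := ('X^(p ^ i) - 1 : Zx).
Local Notation N := (Nm p).
Local Notation M := (Mm p).
Local Notation p' := (p%:R : Zx).
Local Notation fixed := (fixed p).
Hypothesis kmA : kummer_module p n m xi.
Let p_pr := km_prime kmA.
Let n_gt0 := km_n_gt0 kmA.
Let m_gt0 := km_m_gt0 kmA.
Local Notation system := (system p n m).

(* The classes of [N_(i+1) K_(i+1)] modulo [p F]; for [i = n] only [p F] is left. *)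
Definition lower_norm i (s : A) := exists z f : A,
  [/\ fixed i.+1 z, (i < n)%N \/ z = 0, fixed 0 f & s = N i *: (M i *: z) + p' *: f].

Lemma lower_normD i s t : lower_norm i s -> lower_norm i t -> lower_norm i (s + t).
Proof.
move=> [z [f [zK hz fF ->]]] [w [g [wK hw gF ->]]]; exists (z + w), (f + g).
split; [exact: fixedD | | exact: fixedD | by module].
case: hz => [|->]; first by left.
by case: hw => [|->]; [left | right; rewrite addr0].
Qed.

Lemma lower_normZ i c s : lower_norm i s -> lower_norm i (c *: s).
Proof.
move=> [z [f [zK hz fF ->]]]; exists (c *: z), (c *: f).
split; [exact: fixedZ | | exact: fixedZ | by module].
by case: hz => [|->]; [left | right; rewrite scaler0].
Qed.

Lemma lower_norm0 i : lower_norm i 0.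
Proof.
by exists 0, 0; split; [apply: fixed00|right|apply: fixed00|rewrite !scaler0 addr0].
Qed.

Lemma lower_norm_sum i (I : Type) (r : seq I) (P : pred I) (F : I -> A) :
  (forall j, P j -> lower_norm i (F j)) -> lower_norm i (\sum_(j <- r | P j) F j).
Proof.
by move=> FP; elim/big_rec: _ => [|j s Pj]; [exact: lower_norm0 | exact/lower_normD/FP].
Qed.

Lemma lower_norm_p i f : fixed 0 f -> lower_norm i (p' *: f).
Proof.
by move=> fF; exists 0, f; split; [apply: fixed00|right| |rewrite !scaler0 add0r].
Qed.

Lemma lower_norm_gt i l g : (i < l <= n)%N -> fixed l g -> lower_norm i (N l *: g).
Proof.
move=> /andP[lt_il le_ln] gK; have [c cE] := subX_dvd p lt_il.
exists (c *: g), 0; split.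
- by rewrite /fixed scalerA -cE.
- by left; apply: leq_trans le_ln.
- exact: fixed00.
rewrite scaler0 addr0 !scalerA -NmS; congr (_ *: g).
by apply: (mulfI D_neq0); rewrite !mulrA -!subX1E.
Qed.

Lemma lower_norm_term i l (u : int) g : (l <= n)%N -> fixed l g ->
    ((l < i)%N -> (p %| u)%Z) ->
  lower_norm i ((if l == i then 0 else u%:P) *: (N l *: g)).
Proof.
move=> le_ln gK dvd_u; case: eqP => [_|/eqP neq_li].
  by rewrite scale0r; apply: lower_norm0.
move: neq_li; rewrite neq_ltn => /orP[/dvd_u/dvdz_polyC[w ->]|lt_il].
  by rewrite -scalerA; apply/lower_norm_p/fixedZ/fixed_Nm.
by apply/lower_normZ/lower_norm_gt; rewrite ?lt_il.
Qed.

Section Family.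
Variables (a : nat -> nat) (e : int) (y : A) (x : nat -> A).
Hypothesis adm_a : admissible p n m a.
Hypothesis sys : system a e y x xi.
Variables (I : eqType) (r : seq I) (l : I -> nat) (g : I -> A).
Hypothesis l_le : {in r, forall t, (l t <= n)%N}.
Hypothesis gK : {in r, forall t, fixed (l t) (g t)}.

(** Independence in the quotient of level i of the norm filtration. The element y counts as one of
    level n. *)
Definition level_indep i := forall (u0 : int) (u : 'I_m -> int) (v : I -> int),
  lower_norm i ((if i == n then u0%:P else 0) *: (N n *: y)
    + \sum_(j < m | a j == i.+1) (u j)%:P *: (N i *: x j)
    + \sum_(t <- r | l t == i) (v t)%:P *: (N i *: g t)) ->
  [/\ i = n -> (p %| u0)%Z, forall j : 'I_m, a j = i.+1 -> (p %| u j)%Z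
    & {in r, forall t, l t = i -> (p %| v t)%Z}].

(** By induction on the level. At level i, the terms of lower levels have coefficients already known
    to be divisible by p, and the norms of higher levels come from K_(i+1), so both vanish in the
    quotient. *)
Lemma lin_indep_levels : (forall i, (i <= n)%N -> level_indep i) ->
  lin_indep p n m a y x r l g.
Proof.
move=> lev u0 u v f fF rel.
have xK (j : 'I_m) : fixed (a j).-1 (x j) := x_fixed sys j.
have a_le (j : 'I_m) : ((a j).-1 <= n)%N by have := adm_bound adm_a (ltn_ord j); lia.
have step i : (i <= n.+1)%N ->
  [/\ (n < i)%N -> (p %| u0)%Z, forall j : 'I_m, (0 < a j <= i)%N -> (p %| u j)%Z
    & {in r, forall t, (l t < i)%N -> (p %| v t)%Z}].
  elim: i => [_|i IHi lt_in]; first by split=> // j; case: (a j).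
  have [u0P uP vP] := IHi (ltnW lt_in).
  have [||u0i ui vi] := lev i _ u0 u v; first by [].
    have -> : (if i == n then u0%:P else 0) *: (N n *: y) =
        u0%:P *: (N n *: y) - (if n == i then 0 else u0%:P) *: (N n *: y).
      by rewrite eq_sym; case: eqP => _; module.
    have -> : \sum_(j < m | a j == i.+1) (u j)%:P *: (N i *: x j) =
        \sum_(j < m) (u j)%:P *: (N (a j).-1 *: x j) -
        \sum_(j < m | (0 < a j)%N) (if (a j).-1 == i then 0 else (u j)%:P) *: (N (a j).-1 *: x j).
      rewrite [X in _ - X]big_mkcond [LHS]big_mkcond -sumrB; apply: eq_bigr => j _.
      have := sys_fixed sys (ltn_ord j).
      case: (a j) => [/= ->|k _ /=]; first by rewrite !scaler0 subr0.
      by rewrite eqSS; case: eqP => [->|_]; rewrite ?scale0r ?subr0 ?subrr.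
    have -> : \sum_(t <- r | l t == i) (v t)%:P *: (N i *: g t) =
        \sum_(t <- r) (v t)%:P *: (N (l t) *: g t) -
        \sum_(t <- r | t \in r) (if l t == i then 0 else (v t)%:P) *: (N (l t) *: g t).
      rewrite -big_seq [LHS]big_mkcond -sumrB; apply: eq_bigr => t _.
      by case: eqP => [->|_]; rewrite ?scale0r ?subr0 ?subrr.
    set s1 := u0%:P *: _ in rel *; set s2 := \sum_(j < m) (u j)%:P *: _ in rel *.
    set s3 := \sum_(t <- r) (v t)%:P *: _ in rel *.
    set t1 := (if n == i then 0 else u0%:P) *: _; set t2 := \sum_(j < m | (0 < a j)%N) _.
    set t3 := \sum_(t <- r | _) _.
    have -> : s1 - t1 + (s2 - t2) + (s3 - t3) = p' *: f + (-1) *: (t1 + t2 + t3).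
      by rewrite -rel; module.
    apply: lower_normD; first exact: lower_norm_p.
    apply/lower_normZ/lower_normD; first apply: lower_normD.
    - by apply: lower_norm_term => //; exact: (km_fixed kmA).
    - apply: lower_norm_sum => j aj; apply: lower_norm_term => // lt_ai.
      by apply: uP; rewrite aj; lia.
    - apply: lower_norm_sum => t t_r; apply: lower_norm_term; [exact: l_le|exact: gK|].
      exact: vP.
  split.
  - rewrite ltnS leq_eqVlt => /orP[/eqP eq_ni|/u0P //]; exact: u0i.
  - move=> j /andP[aj]; rewrite leq_eqVlt ltnS => /orP[/eqP|le_ai]; first exact: ui.
    by apply: uP; rewrite aj.
  - by move=> t t_r; rewrite ltnS leq_eqVlt => /orP[/eqP|]; [apply: vi|apply: vP].
have [u0P uP vP] := step n.+1 (leqnn _); split; first exact: u0P.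
  by move=> j aj; apply: uP; rewrite aj; apply: adm_bound adm_a _ (ltn_ord j).
by move=> t t_r; apply: vP; rewrite // ltnS l_le.
Qed.
End Family.

(** At most one x_j has level i, so a relation involves x_j alone, and y if i = n. Below n it
    contradicts [minimal_norm_neq]; at n, first [minimal_norm_top] for x_j and then [norm_y_neq] for
    y. *)
Lemma minimal_level_indep (I : eqType) (l : I -> nat) (g : I -> A) a e y x i :
    minimal_sys p n m xi a -> system a e y x xi -> (i <= n)%N ->
  level_indep a y x [::] l g i.
Proof.
move=> min_a sys le_in u0 u v.
have inj_a (j k : 'I_m) : a j = i.+1 -> a k = i.+1 -> j = k.
  move=> aj ak; apply: val_inj; apply/eqP; rewrite eqn_leq.
  case: (ltngtP j k) => // [lt_jk|lt_kj].
    by have := @minimal_increasing _ _ _ _ _ kmA a j k min_a; rewrite lt_jk ltn_ord aj ak ltnn => /(_ isT isT).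
  by have := @minimal_increasing _ _ _ _ _ kmA a k j min_a; rewrite lt_kj ltn_ord aj ak ltnn => /(_ isT isT).
have sumE (j : 'I_m) : a j = i.+1 ->
    \sum_(k < m | a k == i.+1) (u k)%:P *: (N i *: x k) = (u j)%:P *: (N i *: x j).
  move=> aj; rewrite (bigD1 j) ?aj //= big1 ?addr0 // => k /andP[/eqP ak].
  by rewrite (inj_a k j ak aj) eqxx.
rewrite big_nil addr0 => -[z [f [zK hz fF rel]]].
have uP (j : 'I_m) : a j = i.+1 -> (p %| u j)%Z.
  move=> aj; apply/negPn/negP => /negP/(inv_modz p_pr)[b [k bE]].
  have xK : fixed i (x j) by have := x_fixed sys j; rewrite aj.
  have NxF := fixed_Nm xK.
  move: rel; rewrite (sumE j) // => rel.
  have NxE : N i *: x j = b%:P *: ((u j)%:P *: (N i *: x j)) - p' *: (k%:P *: (N i *: x j)).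
    rewrite scalerA [b%:P * _]mulrC bE; module.
  case: (eqVneq i n) rel => [i_n|neq_in] rel.
    have z0 : z = 0 by case: hz => //; rewrite i_n ltnn.
    rewrite i_n z0 !scaler0 add0r in rel NxE NxF.
    apply: (@minimal_norm_top _ _ _ _ _ kmA a j e y x (- (b * u0)) (b%:P *: f - k%:P *: (N n *: x j)) min_a sys).
    - exact: ltn_ord.
    - by rewrite aj i_n.
    - by apply: fixedB; apply: fixedZ.
    transitivity (b%:P *: (u0%:P *: (N n *: y) + (u j)%:P *: (N n *: x j))
       - b%:P *: (u0%:P *: (N n *: y)) - p' *: (k%:P *: (N n *: x j))).
      by rewrite {1}NxE; module.
    by rewrite rel polyCN polyCM; module.
  rewrite scale0r add0r in rel.
  apply: (@minimal_norm_neq _ _ _ _ _ kmA a i j e y x (b%:P *: z) (b%:P *: f - k%:P *: (N i *: x j)) min_a sys).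
  - exact: ltn_ord.
  - exact: aj.
  - exact: fixedZ.
  - by left; rewrite ltn_neqAle neq_in.
  - by apply: fixedB; apply: fixedZ.
  by rewrite {1}NxE rel; module.
split=> // i_n; apply/negPn/negP => /negP/(inv_modz p_pr)[b [k bE]].
move: rel; rewrite i_n eqxx => rel.
have z0 : z = 0 by case: hz => //; rewrite i_n ltnn.
have [f' f'F fE] : exists2 f', fixed 0 f' &
   \sum_(j < m | a j == n.+1) (u j)%:P *: (N n *: x j) = p' *: f'.
  apply: (big_ind (fun s => exists2 f', fixed 0 f' & s = p' *: f')).
  - by exists 0; [exact: fixed00 | rewrite scaler0].
  - by move=> s t [f1 f1F ->] [f2 f2F ->]; exists (f1 + f2); [exact: fixedD | module].
  move=> j /eqP aj; have [w wE] : exists w : int, (u j)%:P = p' * w%:P.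
    by apply/dvdz_polyC/uP; rewrite aj i_n.
  exists (w%:P *: (N n *: x j)); last by rewrite wE; module.
  exact/fixedZ/fixed_Nm/(km_fixed kmA).
rewrite fE z0 !scaler0 add0r in rel.
apply: (@norm_y_neq _ _ _ _ _ kmA a e y x (b%:P *: (f - f') - k%:P *: (N n *: y)) (min_adm min_a) sys).
  apply: fixedB; apply: fixedZ; first exact: fixedB.
  exact/fixed_Nm/(km_fixed kmA).
transitivity (b%:P *: (u0%:P *: (N n *: y) + p' *: f') - p' *: (k%:P *: (N n *: y))
    - b%:P *: (p' *: f')).
  rewrite scalerDr scalerA [b%:P * _]mulrC bE; module.
by rewrite rel; module.
Qed.

Lemma minimal_lin_indep (I : eqType) (l : I -> nat) (g : I -> A) a e y x :
    minimal_sys p n m xi a -> system a e y x xi ->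
  lin_indep p n m a y x [::] l g.
Proof.
move=> min_a sys; apply: (lin_indep_levels (min_adm min_a) sys) => // i le_in.
exact: minimal_level_indep min_a sys le_in.
Qed.

Section Generation.
Variable P : A -> Prop.
Hypothesis PD : forall z w, P z -> P w -> P (z + w).
Hypothesis PZ : forall c z, P z -> P (c *: z).

Hypothesis level_span : forall i v, (i <= n)%N -> fixed i v ->
  exists s, [/\ P s, fixed i s & lower_norm i (N i *: v - N i *: s)].

(** Descending induction on i. The error N_i M_i z is the norm of z from K_(i+1); an approximation
    s' of z is brought back to K_i by M_i. *)
Lemma norm_span i v : (i <= n)%N -> fixed i v ->
  exists s f, [/\ P s, fixed i s, fixed 0 f & N i *: v = N i *: s + p' *: f].
Proof.
move=> le_in; have [k ->] : exists k, i = (n - k)%N by exists (n - i)%N; lia.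
elim: k v => [|k IHk] v; [rewrite subn0 | set j := (n - k.+1)%N] => vK.
  have [s [Ps sK [z [f [_ hz fF E]]]]] := level_span (leqnn n) vK.
  exists s, f; split=> //; rewrite -[LHS](subrK (N n *: s)) E.
  by case: hz => [|->]; [rewrite ltnn | module].
have [s [Ps sK [z [f [zK hz fF E]]]]] := level_span (leq_subr _ _) vK.
(* Subtraction is truncated: for k >= n both n - k and n - (k + 1) are 0. *)
have [le_nk|lt_kn] := leqP n k.
  have jE : j = (n - k)%N by rewrite /j; lia.
  by have := IHk v; rewrite -jE; apply.
have jE : (n - k)%N = j.+1 by rewrite /j; lia.
have [|s' [f' [Ps' s'K f'F E']]] := IHk z; first by rewrite jE.
rewrite jE in s'K E'.
exists (s + M j *: s'), (f + f'); split.
- exact/PD/PZ.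
- exact/fixedD/fixed_M.
- exact: fixedD.
rewrite -[LHS](subrK (N j *: s)) E scalerA -NmS E' NmS; module.
Qed.

(** Induction on the field. By [norm_span], an element of K_(i+1) is, up to P and p, of the form D h
    + k with k in K_i. Iterating on h leaves D^(p^(i+1)) h, which is T_(i+1) h = 0 modulo p. *)
Lemma span_mod_p z : exists u w, P u /\ z = u + p' *: w.
Proof.
suff gen i v : (i <= n)%N -> fixed i v -> exists u w, P u /\ v = u + p' *: w.
  exact: gen (leqnn n) (km_fixed kmA z).
elim: i v => [|i IHi] v le_in vK.
  have [s [f [Ps sK fF E]]] := norm_span le_in vK.
  by exists s, f; rewrite Nm0 !scale1r in E.
have step w : fixed i.+1 w -> exists u w' h, [/\ P u, fixed i.+1 h & w = u + p' *: w' + D *: h].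
  move=> wK; have [s [f [Ps sK fF E]]] := norm_span le_in wK.
  have [|h [k [hK kK hE _]]] := norm_p_fixed kmA le_in (fixedB wK sK) fF.
    by rewrite scalerBr E; module.
  have [u [w' [Pu kE]]] := IHi k (ltnW le_in) kK.
  exists (s + u), w', h; split=> //; first exact: PD.
  by rewrite -[w](subrK s) hE kE; module.
have steps t : exists u w h, [/\ P u, fixed i.+1 h & v = u + p' *: w + D ^+ t *: h].
  elim: t => [|t [u [w [h [Pu hK ->]]]]].
    (* P is not assumed to contain 0; it does by scaling any of its elements. *)
    have [u [w [h [Pu hK _]]]] := step v vK.
    exists (0 *: u), 0, v; split=> //; first exact: PZ.
    by rewrite expr0; module.
  have [u' [w' [h' [Pu' h'K ->]]]] := step h hK.
  exists (u + D ^+ t *: u'), (w + D ^+ t *: w'), h'; split=> //; first exact/PD/PZ.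
  by rewrite exprS; module.
have [u [w [h [Pu hK ->]]]] := steps (p ^ i.+1)%N.
have [s sE] := frobX p_pr i.+1.
exists u, (w - s *: h); split=> //.
transitivity (u + p' *: (w - s *: h) + T i.+1 *: h); last by rewrite hK addr0.
by rewrite sE; module.
Qed.

Lemma span_mod_expp k z : exists u w, P u /\ z = u + p' ^+ k *: w.
Proof.
elim: k => [|k [u [w [Pu ->]]]].
  have [u [w [Pu _]]] := span_mod_p z.
  by exists (0 *: u), z; split; [apply: PZ | rewrite expr0; module].
have [u' [w' [Pu' ->]]] := span_mod_p w.
exists (u + p' ^+ k *: u'), w'; split; first exact/PD/PZ.
by rewrite exprSr; module.
Qed.
End Generation.
End Levels.

(** * Indecomposability *)

Section Pigeonhole.
Lemma pigeonhole (T : finType) (c : nat -> T) : exists i j, (i < j)%N /\ c i = c j.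
Proof.
have /injectivePn[i [j neq_ij eq_c]] : ~~ injectiveb (fun k : 'I_#|T|.+1 => c k).
  apply/negP => /injectiveP/leq_card; rewrite card_ord ltnn //.
case: (ltngtP i j) neq_ij => [lt_ij _|lt_ji _|/val_inj ->]; last by rewrite eqxx.
  by exists i, j.
by exists j, i.
Qed.
End Pigeonhole.

Section PolyRemainder.
Variables (p : nat).
Hypothesis p_pr : prime p.
Local Notation Zx := {poly int}.
Local Notation T i := ('X^(p ^ i) - 1 : Zx).
Local Notation p' := (p%:R : Zx).

(** T_i is monic, hence not a zero divisor modulo p^k. *)
Lemma cancelT i k c s : T i * c = p' ^+ k * s -> exists c', c = p' ^+ k * c'.
Proof.
elim: k c s => [|k IHk] c s TE; first by exists c; rewrite mul1r.
have [u uE] := frobX p_pr i.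
have [|c1 cE] := @cancelDn p p_pr (p ^ i) c (p' ^+ k * s - u * c).
  by rewrite -[LHS](addrK (p' * u * c)) -mulrDl -uE TE exprS; ring.
have [|c2 c1E] := IHk c1 s.
  apply: (mulfI (natp_neq0 p_pr)); transitivity (T i * c); first by rewrite cE; ring.
  by rewrite TE exprS mulrA.
by exists c2; rewrite cE c1E exprS mulrA.
Qed.

Lemma cancel_expp k c d : p' ^+ k * c = p' ^+ k * d -> c = d.
Proof. by apply: mulfI; rewrite expf_neq0 ?natp_neq0. Qed.

(** The ring Z[X]/(q, X^k - 1) is finite: the code of c consists of the coefficients modulo q of its
    remainder by the monic X^k - 1. *)
Lemma poly_residues (q k : nat) : (0 < q)%N -> (0 < k)%N ->
  exists f : Zx -> {ffun 'I_k -> 'I_q}, forall c d, f c = f d ->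
    exists b b', c - d = q%:R * b + ('X^k - 1) * b'.
Proof.
move=> q_gt0 k_gt0.
have monP : 'X^k - 1 \is @monic int by rewrite -polyC1 monicXnsubC.
have sizeP : size ('X^k - 1 : Zx) = k.+1 by rewrite -polyC1 size_XnsubC.
have mod_lt (c : int) : (`|(c %% q)%Z| < q)%N.
  by rewrite -ltz_nat gez0_abs ?modz_ge0 ?ltz_pmod // -lt0n.
exists (fun c => [ffun i : 'I_k => Ordinal (mod_lt (Pdiv.Ring.rmodp c ('X^k - 1))`_i)]).
move=> c d /ffunP eq_f.
have eq_mod i : (q %| (Pdiv.Ring.rmodp c ('X^k - 1))`_i - (Pdiv.Ring.rmodp d ('X^k - 1))`_i)%Z.
  have [lt_ik|le_ki] := ltnP i k.
    have := eq_f (Ordinal lt_ik); rewrite !ffunE => /(congr1 val) /= /(congr1 Posz).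
    by rewrite !gez0_abs ?modz_ge0 -?lt0n // => /eqP; rewrite eqz_mod_dvd.
  have lt_rem s : (size (Pdiv.Ring.rmodp s ('X^k - 1) : Zx) <= k)%N.
    by rewrite -ltnS -sizeP Pdiv.Ring.ltn_rmodpN0 // monic_neq0.
  by rewrite !nth_default ?subrr ?dvdz0 // (leq_trans (lt_rem _)).
pose b := \poly_(i < k) (((Pdiv.Ring.rmodp c ('X^k - 1))`_i - (Pdiv.Ring.rmodp d ('X^k - 1))`_i) %/ q)%Z.
exists b, (Pdiv.Ring.rdivp c ('X^k - 1) - Pdiv.Ring.rdivp d ('X^k - 1)).
have bE : Pdiv.Ring.rmodp c ('X^k - 1) - Pdiv.Ring.rmodp d ('X^k - 1) = q%:R * b.
  apply/polyP => i; rewrite -polyC_natr coefCM coefB coef_poly.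
  case: ltnP => [_|le_ki]; first by rewrite mulrC natz divzK.
  have lt_rem s : (size (Pdiv.Ring.rmodp s ('X^k - 1) : Zx) <= k)%N.
    by rewrite -ltnS -sizeP Pdiv.Ring.ltn_rmodpN0 // monic_neq0.
  by rewrite !nth_default ?subrr ?mulr0 // (leq_trans (lt_rem _)).
rewrite -bE {1}(Pdiv.RingMonic.rdivp_eq monP c) {1}(Pdiv.RingMonic.rdivp_eq monP d); ring.
Qed.
End PolyRemainder.

Section Combinations.
Variables (p n m : nat) (A : lmodType {poly int}).
Local Notation Zx := {poly int}.
Local Notation D := ('X - 1 : Zx).
Local Notation T i := ('X^(p ^ i) - 1 : Zx).
Local Notation p' := (p%:R : Zx).
Local Notation fixed' := (fixed' p).
Local Notation pideal := (pideal p).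

Definition combine (y : A) (x : nat -> A) (c : Zx * ('I_m -> Zx)) : A :=
  c.1 *: y + \sum_(j < m) c.2 j *: x j.

Definition dvd_pm (z : A) := exists w, z = p' ^+ m *: w.

Lemma dvd_pmD z w : dvd_pm z -> dvd_pm w -> dvd_pm (z + w).
Proof. by move=> [z' ->] [w' ->]; exists (z' + w'); rewrite scalerDr. Qed.

Lemma dvd_pmZ c z : dvd_pm z -> dvd_pm (c *: z).
Proof. by move=> [z' ->]; exists (c *: z'); module. Qed.

Variables (a : nat -> nat) (e : int).

(** These are the coefficients of the combinations of generators that vanish in X_(a,d,m), for d = 1
    + p e. *)
Definition rel_pm (c : Zx * ('I_m -> Zx)) := exists q,
  pideal m (T n) (c.1 - q * (D - p' * e%:P)) /\
  forall j : 'I_m, (0 < a j)%N -> pideal m (T (a j).-1) (c.2 j + q * p' ^+ j).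

Lemma rel_pm_dvd (y : A) (x : nat -> A) w c :
    T n *: y = 0 -> (forall j : 'I_m, fixed' (a j) (x j)) ->
    (D - p' * e%:P) *: y = \sum_(j < m) p' ^+ j *: x j + p' ^+ m *: w ->
  rel_pm c -> dvd_pm (combine y x c).
Proof.
move=> T0 xK relf [q [[b [b' cE]] cjE]].
have -> : combine y x c = p' ^+ m *: (b *: y + q *: w) + \sum_(j < m) (c.2 j + q * p' ^+ j) *: x j.
  have -> : \sum_(j < m) (c.2 j + q * p' ^+ j) *: x j =
      \sum_(j < m) c.2 j *: x j + q *: \sum_(j < m) p' ^+ j *: x j.
    by rewrite scaler_sumr -big_split; apply: eq_bigr => j _ /=; module.
  rewrite /combine -[c.1](subrK (q * (D - p' * e%:P))) cE.
  transitivity (p' ^+ m *: (b *: y) + b' *: (T n *: y) + q *: ((D - p' * e%:P) *: y)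
    + \sum_(j < m) c.2 j *: x j); first by module.
  by rewrite relf T0; module.
apply: dvd_pmD; first by exists (b *: y + q *: w).
elim/big_rec: _ => [|j s _ IHs]; first by exists 0; rewrite scaler0.
apply: dvd_pmD IHs; have := xK j.
have [aj|aj] := posnP (a j).
  by rewrite aj /= => ->; rewrite scaler0; exists 0; rewrite scaler0.
have [d [d' ->]] := cjE j aj; rewrite -[a j](prednK aj) /= => xjK; exists (d *: x j).
transitivity (p' ^+ m *: (d *: x j) + d' *: (T (a j).-1 *: x j)); first by module.
by rewrite xjK scaler0 addr0.
Qed.
End Combinations.

Section Indecomposable.
Variables (p n m : nat) (A : lmodType {poly int}) (xi : A).
Local Notation Zx := {poly int}.
Local Notation D := ('X - 1 : Zx).
Local Notation T i := ('X^(p ^ i) - 1 : Zx).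
Local Notation N := (Nm p).
Local Notation p' := (p%:R : Zx).
Local Notation fixed := (fixed p).
Hypothesis kmA : kummer_module p n m xi.
Let p_pr := km_prime kmA.
Let n_gt0 := km_n_gt0 kmA.
Let m_gt0 := km_m_gt0 kmA.

Local Notation system := (system p n m).

Local Notation combine := (@combine m A).
Local Notation dvd_pm := (dvd_pm p m).

Section System.
Variables (a : nat -> nat) (e : int) (y : A) (x : nat -> A).
Hypothesis min_a : minimal_sys p n m xi a.
Hypothesis sys : system a e y x xi.
Let adm_a := min_adm min_a.

Local Notation rel_pm := (@rel_pm p n m a e).

(** The right-hand side depends on a and e only. Two systems with the same minimal tuple and the
    same e therefore span isomorphic modules modulo p^m. *)
Lemma combine_rel c : dvd_pm (combine y x c) <-> rel_pm c.
Proof.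
split=> [[w wE]|]; last first.
  apply: (rel_pm_dvd _ _ (sys_rel_full sys)); first exact: (km_fixed kmA y).
  by move=> j; apply: sys_fixed sys _ (ltn_ord j).
have [q [qy qx _]] : exists q, in_rel p n a e [::] (fun=> 0%N) m q c.1 c.2 (fun _ : bool => 0).
  apply: (@kernel_mod_expp p n m A xi kmA a e y x adm_a sys bool [::] (fun=> 0%N) (fun=> 0) _ _ _ m _ _ _ w) => //.
    exact: minimal_lin_indep min_a sys.
  by rewrite big_nil addr0.
by exists q.
Qed.

(** A combination fixed by sigma^(p^i) modulo p^m need not lift to K_i; the obstruction is the
    multiple q of the defining relation, and the coordinate of x_(j0) controls it up to p^(m-j0).
    This loss is harmless because x_(j0) enters the relation with the factor p^j0. *)
Lemma lift_fixed (j0 : 'I_m) i c w : a j0 = i.+1 ->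
    T i *: combine y x c = p' ^+ m *: w ->
  exists c' al w', [/\ fixed i (combine y x c') &
    combine y x c = combine y x c' + p' ^+ (m - j0) *: (al *: y) + p' ^+ m *: w'].
Proof.
move=> aj0 cE; pose cT := (T i * c.1, fun j => T i * c.2 j) : Zx * ('I_m -> Zx).
have combT : combine y x cT = T i *: combine y x c.
  rewrite /combine scalerDr scaler_sumr scalerA; congr (_ + _).
  by apply: eq_bigr => j _; rewrite scalerA.
have [|q [[b [b' q1]] qj]] := (combine_rel cT).1; first by exists w; rewrite combT.
rewrite /= in q1 qj.
have le_in : (i <= n)%N by have := adm_bound adm_a (ltn_ord j0); rewrite aj0.
have mE : p' ^+ m = p' ^+ j0 * p' ^+ (m - j0) by rewrite -exprD subnKC // ltnW.
(* Since x_(j0) lies in K_i, its coordinate gives q p^j0 in the ideal (p^m, T_i), and p^j0 can be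
   cancelled. *)
have [q' [q'' qE]] : exists q' q'', q = p' ^+ (m - j0) * q' + T i * q''.
  have [|d [d' dE]] := qj j0; first by rewrite aj0.
  rewrite aj0 /= in dE.
  have [|s sE] := @cancelT p p_pr i j0 (d' - c.2 j0) (q - p' ^+ (m - j0) * d).
    transitivity ((p' ^+ m * d + T i * d') - T i * c.2 j0 - p' ^+ m * d); first by ring.
    by rewrite -dE mE; ring.
  exists d, s; apply: (@cancel_expp p p_pr j0); rewrite [LHS]mulrC.
  transitivity ((T i * c.2 j0 + q * p' ^+ j0) - T i * c.2 j0); first by ring.
  by rewrite dE mE -[d'](subrK (c.2 j0)) sE; ring.
(* After subtracting q'' times the relation, T_i can be cancelled. What remains has coefficients
   divisible by T_n/T_i, or by the analogous quotient for x_j, which give elements of K_i. *)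
pose al' := c.1 - q'' * (D - p' * e%:P).
pose be' j := c.2 j + q'' * p' ^+ j.
have [cn cnE] := subX_dvd p le_in.
have [al alE] : exists al, al' = cn * b' + p' ^+ (m - j0) * al.
  have [|s sE] := @cancelT p p_pr i (m - j0) (al' - cn * b')
      (q' * (D - p' * e%:P) + p' ^+ j0 * b).
    transitivity ((T i * c.1 - q * (D - p' * e%:P)) + (q - T i * q'') * (D - p' * e%:P) - T i * cn * b').
      by rewrite /al'; ring.
    by rewrite q1 qE mE cnE; ring.
  by exists s; rewrite -sE; ring.
have /choice[be'' beE] : forall j : 'I_m, exists s, fixed i (s *: x j) /\
    exists w', be' j *: x j = s *: x j + p' ^+ m *: w'.
  move=> j; have := sys_fixed sys (ltn_ord j); have [le_aij|lt_iaj] := leqP (a j) i.+1.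
    move=> xK; exists (be' j); split; last by exists 0; rewrite scaler0 addr0.
    by apply: fixedZ; exact: fixed'W le_aij xK.
  have [lt_jj0|le_j0j] := ltnP j j0.
    have := @minimal_increasing p n m A xi kmA a j j0 min_a.
    by rewrite lt_jj0 ltn_ord aj0 /= => /(_ isT isT); lia.
  move=> xK; have {xK} xK : fixed (a j).-1 (x j) := x_fixed sys j.
  have [|d [d' dE]] := qj j; first by lia.
  have [|cl clE] := @subX_dvd p i (a j).-1; first by lia.
  have pj : p' ^+ (m - j0) * p' ^+ j = p' ^+ m * p' ^+ (j - j0).
    by rewrite -!exprD; congr (_ ^+ _); have := ltn_ord j0; lia.
  have [|s sE] := @cancelT p p_pr i m (be' j - cl * d') (d - p' ^+ (j - j0) * q').
    transitivity (T i * c.2 j + q * p' ^+ j - (q - T i * q'') * p' ^+ j - T i * cl * d').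
      by rewrite /be'; ring.
    rewrite dE qE clE; transitivity (p' ^+ m * d - (p' ^+ (m - j0) * p' ^+ j) * q').
      by ring.
    by rewrite pj; ring.
  exists (cl * d'); split.
    rewrite /fixed scalerA mulrA -clE mulrC -scalerA.
    by have -> : T (a j).-1 *: x j = 0 by []; rewrite scaler0.
  by exists (s *: x j); rewrite -[be' j](subrK (cl * d')) sE; module.
exists (cn * b', be''), al.
have [w' wE] : exists w', \sum_(j < m) be' j *: x j = \sum_(j < m) be'' j *: x j + p' ^+ m *: w'.
  apply: (big_ind2 (fun s t => exists w', s = t + p' ^+ m *: w')).
  - by exists 0; rewrite scaler0 addr0.
  - by move=> s1 s2 t1 t2 [w1 ->] [w2 ->]; exists (w1 + w2); module.
  - by move=> j _; case: (beE j).
exists (w' + q'' *: x m); split.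
  apply: fixedD.
    rewrite /fixed /= scalerA mulrA -cnE mulrC -scalerA.
    by have -> : T n *: y = 0 := km_fixed kmA y; rewrite scaler0.
  by apply: fixed_sum => j _; case: (beE j).
have relf := sys_rel_full sys.
have sumE : \sum_(j < m) c.2 j *: x j =
    \sum_(j < m) be' j *: x j - q'' *: (\sum_(j < m) p' ^+ j *: x j).
  by rewrite scaler_sumr -sumrB; apply: eq_bigr => j _; rewrite /be'; module.
rewrite /combine sumE wE /= -[c.1](subrK (q'' * (D - p' * e%:P))) -/al' alE.
transitivity ((cn * b' + p' ^+ (m - j0) * al) *: y + q'' *: ((D - p' * e%:P) *: y)
  + (\sum_(j < m) be'' j *: x j + p' ^+ m *: w' - q'' *: \sum_(j < m) p' ^+ j *: x j)).
  by module.
by rewrite relf; module.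
Qed.
End System.
End Indecomposable.

Section Decomposition.
Variables (p n m : nat) (A : lmodType {poly int}) (xi : A).
Local Notation Zx := {poly int}.
Local Notation D := ('X - 1 : Zx).
Local Notation T i := ('X^(p ^ i) - 1 : Zx).
Local Notation N := (Nm p).
Local Notation p' := (p%:R : Zx).
Local Notation fixed := (fixed p).
Local Notation fixed' := (fixed' p).
Hypothesis kmA : kummer_module p n m xi.
Let p_pr := km_prime kmA.
Let n_gt0 := km_n_gt0 kmA.
Let m_gt0 := km_m_gt0 kmA.
Local Notation wsys := (wsys p m).
Local Notation system := (system p n m).
Local Notation dvd_pm := (dvd_pm p m).
Local Notation coefs := (Zx * ('I_m -> Zx))%type.

Definition coefs_sub (c d : coefs) : coefs := (c.1 - d.1, fun j => c.2 j - d.2 j).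
Definition coefs_add (c d : coefs) : coefs := (c.1 + d.1, fun j => c.2 j + d.2 j).
Definition coefs_scale q (c : coefs) : coefs := (q * c.1, fun j => q * c.2 j).

Lemma combineB (y : A) (x : nat -> A) (c d : coefs) :
  combine y x (coefs_sub c d) = combine y x c - combine y x d.
Proof.
rewrite /combine /=; have -> : \sum_(j < m) (c.2 j - d.2 j) *: x j =
    \sum_(j < m) c.2 j *: x j - \sum_(j < m) d.2 j *: x j.
  by rewrite -sumrB; apply: eq_bigr => j _; rewrite scalerBl.
module.
Qed.

Lemma combineD (y : A) (x : nat -> A) (c d : coefs) :
  combine y x (coefs_add c d) = combine y x c + combine y x d.
Proof.
rewrite /combine /=; have -> : \sum_(j < m) (c.2 j + d.2 j) *: x j =
    \sum_(j < m) c.2 j *: x j + \sum_(j < m) d.2 j *: x j.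
  by rewrite -big_split; apply: eq_bigr => j _; rewrite scalerDl.
module.
Qed.

Lemma combineZ (y : A) (x : nat -> A) q (c : coefs) :
  combine y x (coefs_scale q c) = q *: combine y x c.
Proof.
rewrite /combine scalerDr scaler_sumr scalerA; congr (_ + _).
by apply: eq_bigr => j _; rewrite scalerA.
Qed.

Lemma system_scale a e (y : A) (x : nat -> A) q (c : A) : system a e y x c ->
  system a e (q *: y) (fun j => q *: x j) (q *: c).
Proof.
move=> [xK rel nrm].
have wE : wsys e (q *: y) (fun j => q *: x j) = q *: wsys e y x.
  by rewrite /wsys wsumZ; module.
split.
- by move=> j lt_jm; apply/fixed'Z/xK.
- rewrite wE; transitivity (q *: (D *: y)); [module|rewrite rel; module].
- by rewrite -nrm /norm_sys wE; module.
Qed.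

Section System.
Variables (a : nat -> nat) (e : int) (y : A) (x : nat -> A).
Hypothesis min_a : minimal_sys p n m xi a.
Hypothesis sys : system a e y x xi.
Let adm_a := min_adm min_a.

Definition spanned (z : A) := exists c : coefs, dvd_pm (z - combine y x c).

Lemma spannedD z w : spanned z -> spanned w -> spanned (z + w).
Proof.
move=> [c cz] [d dw]; exists (coefs_add c d); rewrite combineD.
have -> : z + w - (combine y x c + combine y x d) = (z - combine y x c) + (w - combine y x d) by module.
exact: dvd_pmD.
Qed.

Lemma spannedZ q z : spanned z -> spanned (q *: z).
Proof.
move=> [c cz]; exists (coefs_scale q c); rewrite combineZ.
by rewrite -scalerBr; apply: dvd_pmZ.
Qed.

Lemma spanned_pm z : dvd_pm z -> spanned z.
Proof.
move=> zd; exists (0, fun=> 0); rewrite /combine scale0r big1 ?addr0 ?subr0 //.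
by move=> j _; rewrite scale0r.
Qed.

Lemma spanned_combine (c : coefs) : spanned (combine y x c).
Proof. by exists c; rewrite subrr; exists 0; rewrite scaler0. Qed.

Lemma spanned_sum (F : 'I_m -> A) : (forall j, spanned (F j)) -> spanned (\sum_(j < m) F j).
Proof.
move=> FS; elim/big_rec: _ => [|j s _]; last exact/spannedD.
by apply: spanned_pm; exists 0; rewrite scaler0.
Qed.

(** Modulo p^m the span is finite, which replaces cardinality arguments on a quotient. *)
Lemma ex_code : exists (F : finType) (code : coefs -> F),
  forall c d, code c = code d -> dvd_pm (combine y x c - combine y x d).
Proof.
have [||f fP] := @poly_residues (p ^ m) (p ^ n); try by rewrite expn_gt0 prime_gt0.
have dvdP (z : A) b1 b2 : f b1 = f b2 -> dvd_pm (b1 *: z - b2 *: z).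
  move=> /fP[b [b' E]]; exists (b *: z).
  have T0 : T n *: z = 0 := km_fixed kmA z.
  rewrite -scalerBl E natrX; transitivity (p' ^+ m *: (b *: z) + b' *: (T n *: z)).
    by module.
  by rewrite T0 scaler0 addr0.
exists _, (fun c => (f c.1, [ffun j : 'I_m => f (c.2 j)])) => c d [c1 /ffunP c2].
rewrite /combine; have -> : c.1 *: y + \sum_(j < m) c.2 j *: x j -
    (d.1 *: y + \sum_(j < m) d.2 j *: x j) =
    (c.1 *: y - d.1 *: y) + \sum_(j < m) (c.2 j *: x j - d.2 j *: x j).
  by rewrite sumrB; module.
apply: dvd_pmD; first exact: dvdP.
elim/big_rec: _ => [|j s _]; first by exists 0; rewrite scaler0.
by apply/dvd_pmD/dvdP; have := c2 j; rewrite !ffunE.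
Qed.

Section Submodule.
Variable S : A -> Prop.
Hypothesis SD : forall z w, S z -> S w -> S (z + w).
Hypothesis SZ : forall q z, S z -> S (q *: z).
Hypothesis S_pm : forall z, dvd_pm z -> S z.
Hypothesis S_spanned : forall z, S z -> spanned z.

(** After rescaling, the new system has norm xi and the same relations as the old one, so exchanging
    generators is an injective self-map of the finite span, hence onto. Thus the span equals S up to
    p times itself, and m iterations give S, which contains all multiples of p^m. *)
Lemma submodule_full y1 x1 (c : int) : ~ (p %| c)%Z ->
    system a e y1 x1 (c%:P *: xi) -> S y1 ->
    (forall j : 'I_m, exists s t, [/\ S s, spanned t & x1 j = s + p' *: t]) ->
  forall z, spanned z -> S z.
Proof.
move=> /(inv_modz p_pr)[u [k uE]] sys1 Sy1 Sx1.
have sys2 : system a e (u%:P *: y1) (fun j => u%:P *: x1 j) xi.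
  have := system_scale u%:P sys1; rewrite scalerA [u%:P * _]mulrC uE.
  suff -> : (1 + p' * k%:P) *: xi = xi by [].
  transitivity (xi + k%:P *: (p' *: xi)); first by module.
  by rewrite (km_xi_p kmA) scaler0 addr0.
set y2 := u%:P *: y1 in sys2; set x2 := fun j => _ in sys2.
have dvdE (b d : coefs) : dvd_pm (combine y x b - combine y x d) <-> dvd_pm (combine y2 x2 b - combine y2 x2 d).
  rewrite -!combineB; split=> /combine_rel rel.
    by apply/(combine_rel kmA min_a sys2)/rel/sys.
  by apply/(combine_rel kmA min_a sys)/rel/sys2.
have x1_sp (j : 'I_m) : spanned (x1 j).
  have [s [t [Ss St ->]]] := Sx1 j.
  by apply: spannedD; [apply: S_spanned | apply: spannedZ].
have /choice[g gE] : forall b : coefs, exists d : coefs, dvd_pm (combine y2 x2 b - combine y x d).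
  move=> b; suff [d dE] : spanned (combine y2 x2 b) by exists d.
  apply: spannedD; first by apply/spannedZ/spannedZ/S_spanned.
  by apply: spanned_sum => j; apply/spannedZ/spannedZ/x1_sp.
have trans (z1 z2 z3 : A) : dvd_pm (z1 - z2) -> dvd_pm (z2 - z3) -> dvd_pm (z1 - z3).
  move=> d1 d2; have -> : z1 - z3 = (z1 - z2) + (z2 - z3) by module.
  exact: dvd_pmD.
have symm (z1 z2 : A) : dvd_pm (z1 - z2) -> dvd_pm (z2 - z1).
  move=> d1; have -> : z2 - z1 = (-1) *: (z1 - z2) by module.
  exact: dvd_pmZ.
(* The orbit of b under [g] repeats modulo p^m, and injectivity lets one cancel iterates until b
   itself is in the image. *)
have onto (b : coefs) : exists d : coefs, dvd_pm (combine y x b - combine y2 x2 d).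
  have [F [code codeP]] := ex_code.
  have [i [j [lt_ij /codeP]]] := pigeonhole (fun k => code (iter k g b)).
  elim: i j lt_ij => [|i IHi] [|j] //= lt_ij.
    move=> bE; exists (iter j g b); apply: (trans _ _ _ bE).
    exact/symm/gE.
  move=> E; apply: (IHi j) => //; apply/dvdE.
  apply: (trans _ _ _ (gE _)); apply: (trans _ _ _ E); exact/symm/gE.
have step z : spanned z -> exists s t, [/\ S s, spanned t & z = s + p' *: t].
  move=> [b bE]; have [d dE] := onto b.
  have dz := trans _ _ _ bE dE.
  rewrite -[z](subrK (combine y2 x2 d)).
  have comb (s0 : A) : S s0 -> exists s t, [/\ S s, spanned t & s0 = s + p' *: t].
    move=> Ss0; exists s0, 0; split=> //; last by module.
    by apply: spanned_pm; exists 0; rewrite scaler0.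
  have addc (s1 s2 : A) : (exists s t, [/\ S s, spanned t & s1 = s + p' *: t]) ->
     (exists s t, [/\ S s, spanned t & s2 = s + p' *: t]) ->
     (exists s t, [/\ S s, spanned t & s1 + s2 = s + p' *: t]).
    move=> [s3 [t3 [Ss3 St3 ->]]] [s4 [t4 [Ss4 St4 ->]]]; exists (s3 + s4), (t3 + t4).
    by split; [apply: SD | apply: spannedD | module].
  apply: (addc); first exact/comb/S_pm.
  apply: (addc); first exact/comb/SZ/SZ.
  elim/big_rec: _ => [|j s _]; first by apply/comb/S_pm; exists 0; rewrite scaler0.
  apply: addc; have [s1 [t1 [Ss1 St1 x1E]]] := Sx1 j.
  exists ((d.2 j * u%:P) *: s1), ((d.2 j * u%:P) *: t1); split; [exact: SZ|exact: spannedZ|].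
  by rewrite /x2 x1E; module.
have steps k0 z : spanned z -> exists s t, [/\ S s, spanned t & z = s + p' ^+ k0 *: t].
  elim: k0 z => [|k0 IHk] z Sz.
    exists 0, z; split=> //; last by module.
    by apply: S_pm; exists 0; rewrite scaler0.
  have [s [t [Ss St ->]]] := IHk z Sz; have [s' [t' [Ss' St' ->]]] := step t St.
  exists (s + p' ^+ k0 *: s'), t'; split=> //; first exact/SD/SZ.
  by rewrite exprSr; module.
move=> z /(steps m)[s [t [Ss _ ->]]]; apply: SD => //.
by apply: S_pm; exists t.
Qed.
End Submodule.

(** As x_0 lies in K_(n-1), p times the norm is N_n D y1 = T_n y1 = 0. *)
Lemma norm_sys_torsion b e1 y1 x1 : (b 0 <= n)%N ->
    (forall j, (j < m)%N -> fixed' (b j) (x1 j)) ->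
    D *: y1 = x1 0%N + p' *: wsys e1 y1 x1 ->
  exists c : int, system b e1 y1 x1 (c%:P *: xi).
Proof.
move=> b0 xK rel; suff /(km_torsion kmA)[c cE] : p' *: norm_sys p n m e1 y1 x1 = 0.
  by exists c; split.
have x0K : fixed n.-1 (x1 0%N).
  have /fixed'W/(_ (xK 0%N m_gt0)) : (b 0 <= n.-1.+1)%N by rewrite prednK.
  by [].
have NE : N n *: x1 0%N = p' *: (N n.-1 *: x1 0%N).
  by rewrite -(Nm_fixedS x0K) prednK.
rewrite /norm_sys scalerDr -NE.
transitivity (N n *: (x1 0%N + p' *: wsys e1 y1 x1)); first by module.
rewrite -rel; transitivity (T n *: y1); first by rewrite subX1E; module.
exact: (km_fixed kmA).
Qed.

(** The components of y and x in S1 satisfy the relation only modulo p^m. Once corrected to a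
    genuine system of norm c1 xi, they leave a complementary one of norm (1 - c1) xi. As p cannot
    divide both c1 and 1 - c1, one of S1 and S2 is everything. *)
Lemma spanned_indecomposable (S1 S2 : A -> Prop) :
    (forall z w, S1 z -> S1 w -> S1 (z + w)) -> (forall q z, S1 z -> S1 (q *: z)) ->
    (forall z w, S2 z -> S2 w -> S2 (z + w)) -> (forall q z, S2 z -> S2 (q *: z)) ->
    (forall z, dvd_pm z -> S1 z) -> (forall z, dvd_pm z -> S2 z) ->
    (forall z, S1 z -> spanned z) -> (forall z, S2 z -> spanned z) ->
    (forall z, S1 z -> S2 z -> dvd_pm z) ->
    (forall z, spanned z -> exists z1 z2, [/\ S1 z1, S2 z2 & z = z1 + z2]) ->
  (forall z, spanned z -> S1 z) \/ (forall z, spanned z -> S2 z).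
Proof.
move=> S1D S1Z S2D S2Z S1_pm S2_pm S1_sp S2_sp S12 Ssum.
have [y1 [y2 [S1y1 S2y2 yE]]] : exists z1 z2, [/\ S1 z1, S2 z2 & y = z1 + z2].
  apply: Ssum; exists (1, fun=> 0); rewrite /combine scale1r big1 ?addr0 ?subrr.
    by exists 0; rewrite scaler0.
  by move=> j _; rewrite scale0r.
have /choice[z1 z1E] : forall j : 'I_m, exists z1, S1 z1 /\ S2 (x j - z1).
  move=> j; have [|s1 [s2 [Ss1 Ss2 E]]] := Ssum (x j).
    exists (0, fun k => (k == j)%:R); rewrite /combine scale0r add0r (bigD1 j) //=.
    rewrite eqxx scale1r big1 ?addr0 ?subrr; first by exists 0; rewrite scaler0.
    by move=> k /negPf ->; rewrite scale0r.
  by exists s1; rewrite E addrC addKr.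
have S1_sum (F : 'I_m -> A) : (forall j, S1 (F j)) -> S1 (\sum_(j < m) F j).
  move=> FS; elim/big_rec: _ => [|j s _]; last exact/S1D.
  by apply: S1_pm; exists 0; rewrite scaler0.
have S2_sum (F : 'I_m -> A) : (forall j, S2 (F j)) -> S2 (\sum_(j < m) F j).
  move=> FS; elim/big_rec: _ => [|j s _]; last exact/S2D.
  by apply: S2_pm; exists 0; rewrite scaler0.
have S1N z w : S1 z -> S1 w -> S1 (z - w).
  by move=> Sz Sw; apply: S1D => //; rewrite -scaleN1r; apply: S1Z.
have S2N z w : S2 z -> S2 w -> S2 (z - w).
  by move=> Sz Sw; apply: S2D => //; rewrite -scaleN1r; apply: S2Z.
have y2E : y2 = y - y1 by rewrite yE addrC addKr.
have rel12 : dvd_pm ((D - p' * e%:P) *: y1 - \sum_(j < m) p' ^+ j *: z1 j).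
  apply: S12; first by apply/S1N; [exact: S1Z | apply: S1_sum => j; apply: S1Z; case: (z1E j)].
  have -> : (D - p' * e%:P) *: y1 - \sum_(j < m) p' ^+ j *: z1 j =
     \sum_(j < m) p' ^+ j *: (x j - z1 j) - (D - p' * e%:P) *: y2 + p' ^+ m *: x m.
    have -> : \sum_(j < m) p' ^+ j *: (x j - z1 j) =
        \sum_(j < m) p' ^+ j *: x j - \sum_(j < m) p' ^+ j *: z1 j.
      by rewrite -sumrB; apply: eq_bigr => j _; rewrite scalerBr.
    rewrite y2E scalerBr (sys_rel_full sys); module.
  apply: S2D; last by apply: S2_pm; exists (x m).
  by apply/S2N; [apply: S2_sum => j; apply: S2Z; case: (z1E j) | exact: S2Z].
(* The component of x_j is moved into its field at the cost of a multiple of p^(m-j), which becomes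
   a multiple of p^m in the relation and is absorbed by the last term [vm]. *)
have /choice[v vE] : forall j : 'I_m, exists v, [/\ fixed' (a j) v, spanned v &
    exists s w, z1 j = v + p' ^+ (m - j) *: s + p' ^+ m *: w /\ spanned s].
  move=> j; have [S1z S2z] := z1E j; case aj: (a j) => [|i].
    have x0 : x j = 0 by have := sys_fixed sys (ltn_ord j); rewrite aj.
    rewrite x0 sub0r in S2z; exists 0; split=> //.
      by apply: spanned_pm; exists 0; rewrite scaler0.
    have [||w wE] := S12 (z1 j) => //.
      by rewrite -[z1 j]opprK -scaleN1r; apply: S2Z.
    exists 0, w; rewrite wE; split; first by module.
    by apply: spanned_pm; exists 0; rewrite scaler0.
  have [c cE] := S1_sp _ S1z; have [w0 w0E] := cE.
  have [w1 w1E] : dvd_pm (T i *: z1 j).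
    apply: S12; first exact: S1Z.
    have -> : T i *: z1 j = - (T i *: (x j - z1 j)).
      have : fixed' (a j) (x j) := sys_fixed sys (ltn_ord j).
      by rewrite aj /= /fixed => xK; rewrite scalerBr xK; module.
    by rewrite -scaleN1r; apply/S2Z/S2Z.
  have [|c' [al [w' [cK cE']]]] := @lift_fixed p n m A xi kmA a e y x min_a sys j i c (w1 - T i *: w0) aj.
    rewrite -[combine y x c](subKr (z1 j)) w0E scalerBr w1E; module.
  exists (combine y x c'); split=> //; first exact: spanned_combine.
  exists (al *: y), (w' + w0); split; last first.
    apply: spannedZ; exists (1, fun=> 0); rewrite /combine scale1r big1 ?addr0 ?subrr.
      by exists 0; rewrite scaler0.
    by move=> k _; rewrite scale0r.
  by rewrite -[LHS](subrK (combine y x c)) w0E cE'; module.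
have [vm vmE] : exists vm, (D - p' * e%:P) *: y1 = \sum_(j < m) p' ^+ j *: v j + p' ^+ m *: vm.
  have [w wE] := rel12.
  have [s sE] : exists s, \sum_(j < m) p' ^+ j *: z1 j = \sum_(j < m) p' ^+ j *: v j + p' ^+ m *: s.
    apply: (big_ind2 (fun s t => exists w', s = t + p' ^+ m *: w')).
    - by exists 0; rewrite scaler0 addr0.
    - by move=> s1 s2 t1 t2 [w1 ->] [w2 ->]; exists (w1 + w2); module.
    move=> j _; have [_ _ [s [w' [-> _]]]] := vE j.
    have pE : p' ^+ m = p' ^+ j * p' ^+ (m - j) by rewrite -exprD subnKC // ltnW.
    exists (s + p' ^+ j *: w'); rewrite pE; module.
  by exists (w + s); rewrite -[LHS](subrK (\sum_(j < m) p' ^+ j *: z1 j)) wE sE; module.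
pose x1 j := if insub j is Some k then v k else vm.
have x1E (j : 'I_m) : x1 j = v j by rewrite /x1 valK.
have x1m : x1 m = vm by rewrite /x1 insubF ?ltnn.
have rel1 : D *: y1 = x1 0%N + p' *: wsys e y1 x1.
  have sumE : \sum_(j < m.+1) p' ^+ j *: x1 j = \sum_(j < m) p' ^+ j *: v j + p' ^+ m *: vm.
    by rewrite big_ord_recr /= x1m; congr (_ + _); apply: eq_bigr => j _; rewrite x1E.
  rewrite -sumE big_ord_recl expr0 scale1r in vmE.
  have sE : \sum_(j < m) p' ^+ lift ord0 j *: x1 (lift ord0 j) = p' *: wsum p m x1.
    by rewrite /wsum scaler_sumr; apply: eq_bigr => j _; rewrite scalerA -exprS.
  rewrite sE in vmE; rewrite /wsys.
  transitivity ((D - p' * e%:P) *: y1 + (p' * e%:P) *: y1); first by module.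
  by rewrite vmE; module.
have x1K j : (j < m)%N -> fixed' (a j) (x1 j).
  by move=> lt_jm; rewrite (x1E (Ordinal lt_jm)); case: (vE (Ordinal lt_jm)).
have [c1 sys1] := norm_sys_torsion (adm_0 adm_a) x1K rel1.
have sys2 : system a e y2 (fun j => x j - x1 j) ((1 - c1)%:P *: xi).
  have wE : wsys e y2 (fun j => x j - x1 j) = wsys e y x - wsys e y1 x1.
    rewrite /wsys; have -> : wsum p m (fun j => x j - x1 j) = wsum p m x - wsum p m x1.
      by rewrite -wsumN -wsumD.
    by rewrite y2E; module.
  split.
  - move=> j lt_jm; apply: fixed'D; first exact: sys_fixed sys j lt_jm.
    by rewrite -scaleN1r; apply/fixed'Z/x1K.
  - rewrite wE y2E scalerBr rel1 (sys_rel sys); module.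
  - rewrite polyCB polyC1 scalerBl scale1r.
    by rewrite -(sys_norm sys1) -(sys_norm sys) /norm_sys wE; module.
have pE (j : 'I_m) : p' ^+ (m - j) = p' * p' ^+ (m - j).-1.
  by rewrite -exprS prednK // subn_gt0.
have [dvd_c1|ndvd_c1] := boolP (p %| c1)%Z; [right|left].
  have nd : ~ (p %| 1 - c1)%Z.
    move=> d1; have : (p %| (1 - c1) + c1)%Z by rewrite rpredD.
    rewrite subrK dvdz1 absz_nat => /eqP p1; by have := prime_gt1 p_pr; rewrite p1.
  apply: (submodule_full S2D S2Z S2_pm S2_sp nd sys2) => // j.
  have [_ _ [s [w [zE s_sp]]]] := vE j; have [_ S2z] := z1E j.
  exists (x j - z1 j + p' ^+ m *: w), (p' ^+ (m - j).-1 *: s); split.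
  - by apply: S2D => //; apply: S2_pm; exists w.
  - exact: spannedZ.
  - by rewrite x1E zE pE; module.
apply: (submodule_full S1D S1Z S1_pm S1_sp (negP ndvd_c1) sys1) => // j.
have [_ _ [s [w [zE s_sp]]]] := vE j; have [S1z _] := z1E j.
exists (z1 j - p' ^+ m *: w), (- p' ^+ (m - j).-1 *: s); split.
- by apply: S1N => //; apply: S1_pm; exists w.
- exact: spannedZ.
- by rewrite x1E zE pE; module.
Qed.
End System.
End Decomposition.

(** * Bases of quotients of abelian groups over F_p, extending a given family *)

Lemma sum_mulrz (V : zmodType) (I : Type) (r : seq I) (F : I -> V) c :
  \sum_(i <- r) F i *~ c = (\sum_(i <- r) F i) *~ c.
Proof.
apply/esym/(big_morph (fun v => v *~ c)) => [u v|]; [exact: mulrzDl|exact: mul0rz].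
Qed.

Section AdaptedBasis.
Variables (p : nat) (V : zmodType) (A B : zmodClosed V) (J : choiceType) (w : J -> V).
Hypothesis p_pr : prime p.
Hypothesis pA : forall v, v \in A -> v *+ p \in B.

Definition vec_of (i : V + J) : V := match i with inl v => v | inr j => w j end.

(** Independence over F_p, modulo B, of the elements of S together with the family w. The indices
    lie in a disjoint sum because w need not be injective nor disjoint from S; the empty S expresses
    independence of w alone. *)
Definition indep_with (S : V -> Prop) := forall (r : seq (V + J)) (c : V + J -> int),
  uniq r -> {in r, forall i, if i is inl v then S v else True} ->
  \sum_(i <- r) vec_of i *~ c i \in B -> {in r, forall i, (p %| c i)%Z}.

Lemma mulrz_dvd v (c : int) : v \in A -> (p %| c)%Z -> v *~ c \in B.
Proof. by move=> vA /dvdzP[d ->]; rewrite mulrC mulrzA rpredMz // pA. Qed.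

(** A maximal S exists by Zorn's lemma, the dimensions being possibly infinite. It spans: in a
    dependence involving a new v, the coefficient of v is prime to p and can be inverted. *)
Lemma max_indep : indep_with (fun=> False) ->
  exists S : V -> Prop, [/\ forall v, S v -> v \in A, indep_with S &
    forall v, v \in A -> exists (r : seq (V + J)) (c : V + J -> int),
      {in r, forall i, if i is inl v then S v else True} /\
      v - \sum_(i <- r) vec_of i *~ c i \in B].
Proof.
move=> indep0.
pose P (S : V -> Prop) := (forall v, S v -> v \in A) /\ indep_with S.
have [F FP totF|S [[SA indepS] maxS]] := @classical_sets.Zorn_bigcup V P.
  split=> [v [X FX Xv]|r c uniq_r rF]; first exact: (FP X FX).1 v Xv.
  (* A finite list lies in one member of the chain, unless it involves only w. The second case
     covers the empty chain too. *)
  have [r0|[X FX rX]] : {in r, forall i, if i is inl v then False else True} \/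
      exists2 X, F X & {in r, forall i, if i is inl v then X v else True}.
  - elim: r rF {uniq_r} => [|i r IHr] rF; first by left.
    have [|r0|[X FX rX]] := IHr; first by move=> j j_r; apply: rF; rewrite inE j_r orbT.
      case: i rF => [v|j] rF; last by left=> k; rewrite inE => /orP[/eqP ->|/r0].
      have [|X FX Xv] := rF (inl v); first by rewrite inE eqxx.
      by right; exists X => // k; rewrite inE => /orP[/eqP ->|/r0] //; case: k.
    case: i rF => [v|j] rF; last first.
      by right; exists X => // k; rewrite inE => /orP[/eqP ->|/rX].
    have [|Y FY Yv] := rF (inl v); first by rewrite inE eqxx.
    have [XY|YX] := totF X Y FX FY.
      right; exists Y => // k; rewrite inE => /orP[/eqP -> //|/rX].
      by case: k => // u /XY.
    right; exists X => // k; rewrite inE => /orP[/eqP -> //|/rX //].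
    exact: YX.
  - exact: indep0 uniq_r r0.
  - exact: (FP X FX).2 uniq_r rX.
exists S; split=> // v vA.
have [Sv|nSv] := pselect (S v).
  exists [:: inl v], (fun=> 1); split; first by move=> i; rewrite inE => /eqP ->.
  by rewrite big_seq1 mulr1z subrr rpred0.
have /existsNP[r /existsNP[c]] : ~ indep_with (fun u => S u \/ u = v).
  move=> indepSv; apply: (maxS (fun u => S u \/ u = v)); last first.
    by split=> // u [/SA|->].
  by split=> [u Su|]; [left | move=> /(_ v (or_intror erefl))].
move=> /not_implyP[uniq_r /not_implyP[rS /not_implyP[sumB ndvd]]].
have r_in k : k \in r -> k != inl v -> if k is inl u then S u else True.
  by move=> /rS; case: k => // u [//|->]; rewrite eqxx.
have ndvd_v : ~ (inl v \in r -> (p %| c (inl v))%Z).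
  move=> dvd_v; apply: ndvd => i i_r.
  have [v_r|v_r] := boolP (inl v \in r); last first.
    apply: (indepS r c uniq_r _ sumB i i_r) => k k_r; apply: (r_in k k_r).
    by apply: contraNneq v_r => <-.
  have [->|neq_iv] := eqVneq i (inl v); first exact: dvd_v.
  apply: (indepS (rem (inl v) r) c (rem_uniq _ uniq_r)); last first.
  - by rewrite (mem_rem_uniq _ uniq_r) inE neq_iv.
  - move: sumB; rewrite (big_rem _ v_r) /= rpredDl //.
    exact/mulrz_dvd/dvd_v.
  by move=> k; rewrite (mem_rem_uniq _ uniq_r) inE => /andP[neq_kv k_r]; apply: r_in.
have v_r : inl v \in r by apply/negPn/negP => v_r; apply: ndvd_v => /negPn; rewrite v_r.
have /(inv_modz p_pr)[u [k uE]] : ~ (p %| c (inl v))%Z by move=> d; apply: ndvd_v.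
have {}uE : c (inl v) * u = 1 + p%:Z * k.
  apply: (@polyC_inj int); rewrite polyCM uE polyCD polyCM.
  by rewrite -[in RHS]natz polyC_natr.
exists (rem (inl v) r), (fun i => - (c i * u)); split.
  by move=> i; rewrite (mem_rem_uniq _ uniq_r) inE => /andP[neq_kv k_r]; apply: r_in.
have -> : \sum_(i <- rem (inl v) r) vec_of i *~ - (c i * u) =
    - (\sum_(i <- rem (inl v) r) vec_of i *~ c i) *~ u.
  rewrite mulNrz -sum_mulrz -sumrN; apply: eq_bigr => i _.
  by rewrite mulrNz mulrzA.
rewrite ?mulNrz opprK.
have sumE := big_rem (inl v) v_r (F := fun i => vec_of i *~ c i) (op := +%R) (idx := 0).
have -> : \sum_(i <- rem (inl v) r) vec_of i *~ c i = \sum_(i <- r) vec_of i *~ c i - v *~ c (inl v).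
  by rewrite sumE /= [RHS]addrC addKr.
rewrite mulrzBl -mulrzA uE mulrzDr mulr1z opprD addrCA (addrA v) subrr add0r.
apply: rpredB; first exact: rpredMz.
by rewrite mulrzA rpredMz // -pmulrn pA.
Qed.

Definition basis_vec (E : choiceType) (b : E -> V) (i : E + J) : V :=
  match i with inl t => b t | inr j => w j end.

Lemma adapted_basis : indep_with (fun=> False) ->
  exists (E : choiceType) (b : E -> V),
  [/\ forall t, b t \in A,
      forall v, v \in A -> exists (r : seq (E + J)) (c : E + J -> int),
        v - \sum_(i <- r) basis_vec b i *~ c i \in B
    & forall (r : seq (E + J)) (c : E + J -> int), uniq r ->
        \sum_(i <- r) basis_vec b i *~ c i \in B -> {in r, forall i, (p %| c i)%Z}].
Proof.
case/max_indep => S [SA indepS spanS].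
pose E := {v : V | `[< S v >]}.
pose h (i : E + J) : V + J := match i with inl t => inl (val t) | inr j => inr j end.
have h_inj : injective h by move=> [t|j] [t'|j'] //= [] => [/val_inj|] ->.
have hE i : basis_vec (fun t : E => val t) i = vec_of (h i) by case: i.
have hS i : if h i is inl v then S v else True by case: i => //= t; apply/asboolP/(valP t).
exists E, (fun t => val t); split=> [t|v /spanS[r [c [rS vE]]]|r c uniq_r sumB].
- exact/SA/asboolP/(valP t).
- suff [r' rE] : exists r', r = map h r'.
    exists r', (fun i => c (h i)); move: vE; rewrite rE big_map.
    by under eq_bigr do rewrite -hE.
  elim: r rS {vE} => [|i r IHr] rS; first by exists [::].
  have [|r' ->] := IHr; first by move=> j j_r; apply: rS; rewrite inE j_r orbT.
  suff [j ->] : exists j, i = h j by exists (j :: r').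
  case: i rS => [u|j] rS; last by exists (inr j).
  have /asboolP Su := rS (inl u) (mem_head _ _).
  by exists (inl (exist _ u Su)).
pose c' (k : V + J) : int := match k with
  | inl v => if insub v is Some t then c (inl (t : E)) else 0
  | inr j => c (inr j) end.
have c'E i : c' (h i) = c i by case: i => //= t; rewrite valK.
move=> i i_r; rewrite -c'E; apply: (indepS (map h r) c').
- by rewrite map_inj_uniq.
- by move=> _ /mapP[k _ ->]; move: (hS k); case: (h k).
- rewrite big_map; under eq_bigr do rewrite c'E -hE.
  exact: sumB.
- by rewrite map_f.
Qed.

Lemma dvdz_Fp (c : int) : (p %| c)%Z = (c%:~R == 0 :> 'F_p).
Proof. exact/dvdz_pcharf/pchar_Fp. Qed.

Lemma Fp_natr (d : 'F_p) : (d : nat)%:~R = d.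
Proof. by rewrite -pmulrn natr_Zp. Qed.

Lemma Fp_dim_subquotient (I : choiceType) (b : I -> V) (bA : forall i, b i \in A) :
    (forall v, v \in A -> exists (r : seq I) (c : I -> int),
        v - \sum_(i <- r) b i *~ c i \in B) ->
    (forall (r : seq I) (c : I -> int), uniq r ->
        \sum_(i <- r) b i *~ c i \in B -> {in r, forall i, (p %| c i)%Z}) ->
  Fp_dim p (subquotient A B) I.
Proof.
move=> span indep.
pose b' i : subgroup A := exist _ (b i) (bA i).
have valE (r : seq I) (F : I -> nat) : val (\sum_(i <- r) b' i *+ F i) = \sum_(i <- r) b i *+ F i.
  by rewrite raddf_sum; apply: eq_bigr => i _; rewrite raddfMn.
have piE (u v : subgroup A) : (\pi_(subquotient A B)%qT u = \pi_(subquotient A B)%qT v) <-> (val u - val v \in B).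
  split=> [/eqP|uvB].
    by rewrite -Quotient.idealrBE unfold_in raddfB.
  by apply/eqP; rewrite -Quotient.idealrBE unfold_in raddfB.
exists (fun i => \pi_(subquotient A B)%qT (b' i)).
have sumE (r : seq I) (F : I -> nat) :
   \sum_(i <- r) \pi_(subquotient A B)%qT (b' i) *+ F i = \pi_(subquotient A B)%qT (\sum_(i <- r) b' i *+ F i).
  by rewrite raddf_sum; apply: eq_bigr => i _; rewrite raddfMn.
split.
  elim/quotW => v; have [r [c vE]] := span (val v) (valP v).
  exists r, (fun i => (c i)%:~R); rewrite sumE; apply/piE; rewrite valE.
  have -> : val v - \sum_(i <- r) b i *+ ((c i)%:~R : 'F_p) =
     (val v - \sum_(i <- r) b i *~ c i) +
     \sum_(i <- r) b i *~ (c i - Posz ((c i)%:~R : 'F_p)).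
    have -> : \sum_(i <- r) b i *~ (c i - Posz ((c i)%:~R : 'F_p)) =
        \sum_(i <- r) b i *~ c i - \sum_(i <- r) b i *+ ((c i)%:~R : 'F_p).
      by rewrite -sumrB; apply: eq_bigr => i _; rewrite mulrzBr -pmulrn.
    by rewrite addrA subrK.
  apply: rpredD => //; apply: rpred_sum => i _; apply: mulrz_dvd (bA i) _.
  by rewrite dvdz_Fp rmorphB /= Fp_natr subrr.
move=> r c uniq_r; rewrite sumE => sum0.
have /piE : \pi_(subquotient A B)%qT (\sum_(i <- r) b' i *+ c i) = \pi_(subquotient A B)%qT 0.
  by rewrite sum0 raddf0.
rewrite valE [X in _ - X](_ : _ = 0) ?subr0 => [sumB|]; last exact: raddf0.
move=> i i_r; have := indep r (fun i => Posz (c i)) uniq_r _ i i_r.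
rewrite dvdz_Fp Fp_natr => ci0; apply/eqP/ci0.
by under eq_bigr do rewrite -pmulrn.
Qed.
End AdaptedBasis.

(* The module over [Z[X]] in which the variable acts as [f]. *)
Definition polymod (V : zmodType) (f : {additive V -> V}) : Type := V.

Section PolyModule.
Variables (V : zmodType) (f : {additive V -> V}).
HB.instance Definition _ := GRing.Zmodule.on (polymod f).
Implicit Types (q : {poly int}) (z : polymod f).

Definition polymod_scale q z : polymod f := \sum_(k < size q) iter k f z *~ q`_k.

Lemma polymod_scaleE N q z : (size q <= N)%N ->
  polymod_scale q z = \sum_(k < N) iter k f z *~ q`_k.
Proof.
move=> le_qN; rewrite /polymod_scale -!(big_mkord xpredT (fun k => iter k f z *~ q`_k)).
rewrite [RHS](big_cat_nat (leq0n (size q)) le_qN) /= [X in _ = _ + X]big1_seq ?addr0 // => k.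
by rewrite /= mem_index_iota => /andP[le_qk _]; rewrite nth_default ?mulr0z.
Qed.

Lemma iter_additiveD k : {morph iter k f : u v / u + v}.
Proof. by elim: k => // k IHk u v /=; rewrite IHk raddfD. Qed.

Lemma polymod_scaleDr : right_distributive polymod_scale +%R.
Proof.
move=> q u v; rewrite /polymod_scale -big_split; apply: eq_bigr => k _ /=.
by rewrite iter_additiveD mulrzDl.
Qed.

Lemma polymod_scaleDl z : {morph polymod_scale^~ z : a b / a + b}.
Proof.
move=> a b; pose N := maxn (size a) (size b).
rewrite !(@polymod_scaleE N) ?leq_maxl ?leq_maxr ?size_polyD // -big_split.
by apply: eq_bigr => k _; rewrite coefD mulrzDr.
Qed.

Lemma polymod_scale_polyC c z : polymod_scale c%:P z = z *~ c.
Proof. by rewrite (@polymod_scaleE 1) ?size_polyC_leq1 // big_ord1 coefC. Qed.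

Lemma polymod_scale_mulX q z : polymod_scale (q * 'X) z = polymod_scale q (f z).
Proof.
rewrite (@polymod_scaleE (size q).+1); last first.
  by rewrite (leq_trans (size_polyMleq _ _)) // size_polyX addn2.
rewrite big_ord_recl coefMX mulr0z add0r; apply: eq_bigr => k _.
by rewrite coefMX /= -iterSr.
Qed.

Lemma polymod_scale_polyCM c q z : polymod_scale (c%:P * q) z = polymod_scale q z *~ c.
Proof.
rewrite (@polymod_scaleE (size q)); last by rewrite mul_polyC size_scale_leq.
rewrite /polymod_scale; elim/big_rec2: _ => [|k u v _ ->]; first by rewrite mul0rz.
by rewrite coefCM mulrzDl mulrC mulrzA.
Qed.

Lemma polymod_scale_f q z : f (polymod_scale q z) = polymod_scale q (f z).
Proof.
rewrite raddf_sum; apply: eq_bigr => k _; rewrite raddfMz.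
by rewrite -iterSr.
Qed.

Fact polymod_scaleA a b z :
  polymod_scale a (polymod_scale b z) = polymod_scale (a * b) z.
Proof.
elim/poly_ind: a b z => [|a c IHa] b z.
  by rewrite mul0r /polymod_scale size_poly0 !big_ord0.
rewrite polymod_scaleDl polymod_scale_mulX polymod_scale_polyC polymod_scale_f IHa.
by rewrite mulrDl polymod_scaleDl polymod_scale_polyCM mulrAC polymod_scale_mulX.
Qed.

Fact polymod_scale1 : left_id 1 polymod_scale.
Proof. by move=> z; rewrite -polyC1 polymod_scale_polyC mulr1z. Qed.

HB.instance Definition _ := GRing.Zmodule_isLmodule.Build {poly int} (polymod f)
  polymod_scaleA polymod_scale1 polymod_scaleDr polymod_scaleDl.

Lemma polymodC c z : c%:P *: z = z *~ c.
Proof. exact: polymod_scale_polyC. Qed.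

Lemma polymod_natr k z : k%:R *: z = z *+ k.
Proof. by rewrite scaler_nat. Qed.

Lemma polymodX z : 'X *: z = f z.
Proof.
rewrite -['X]mul1r; transitivity (polymod_scale 1 (f z)); last exact: polymod_scale1.
exact: polymod_scale_mulX.
Qed.

Lemma polymodXn k z : 'X^k *: z = iter k f z.
Proof. by elim: k => [|k IHk]; [rewrite scale1r | rewrite exprS -scalerA IHk polymodX]. Qed.
End PolyModule.

Lemma big_cycle (R : Type) (idx : R) (op : Monoid.com_law idx) (gT : finGroupType)
    (s : gT) (f : gT -> R) :
  \big[op/idx]_(g in <[s]>%g) f g = \big[op/idx]_(k < #[s]%g) f (s ^+ k)%g.
Proof.
have -> : <[s]>%g = [set (s ^+ k)%g | k : 'I_#[s]%g].
  apply/setP => g; apply/idP/imsetP => [/cyclePmin[k lt_k ->]|[k _ ->]].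
    by exists (Ordinal lt_k).
  exact: mem_cycle.
rewrite big_imset //= => k l _ _ /eqP; rewrite eq_expg_mod_order.
by rewrite !modn_small // => /eqP/val_inj.
Qed.

(** * The multiplicative group of K *)

Section GaloisModule.
Variables (p n m : nat) (p_pr : prime p) (n_gt0 : (0 < n)%N)
    (m_gt0 : (0 < m)%N) (F : fieldType) (K : splittingFieldType F)
    (galK : galois 1 {:K}) (dimK : \dim {:K} = (p ^ n)%N)
    (sigma : gal_of {:K}) (gal_sigma : 'Gal({:K} / 1)%g = <[sigma]>%g)
    (Ki : nat -> {subfield K})
    (dimKi : forall i : nat, (i <= n)%N -> \dim (Ki i) = (p ^ i)%N)
    (xi : F) (xi_prim : p.-primitive_root xi)
    (norm_m1 : p = 2%N -> n = 1%N ->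
       exists2 b : K, b != 0 & galNorm 1 {:K} b = -1).

Local Notation act := (@gmod_act (gal_of {:K}) (units K) sigma : {additive units K -> units K}).
Local Notation A := (polymod act).
Local Notation Zx := {poly int}.
Local Notation fixed := (fixed p).
Local Notation N := (Nm p).
Local Notation M := (Mm p).
Lemma val_units_sum (L : fieldType) (I : Type) (r : seq I) (P : pred I) (f : I -> units L) :
  val (\sum_(i <- r | P i) f i) = \prod_(i <- r | P i) val (f i).
Proof. exact: (big_morph (fun z : units L => val z) (fun _ _ => erefl) erefl). Qed.

Lemma val_units_muln (L : fieldType) (z : units L) k : val (z *+ k) = val z ^+ k.
Proof. by elim: k => // k IHk; rewrite mulrS exprS -IHk. Qed.

Lemma val_iter_act k (z : units K) : val (iter k act z) = (sigma ^+ k)%g (val z).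
Proof.
elim: k => [|k IHk]; first by rewrite gal_id.
by rewrite expgSr galM ?memvf //= IHk.
Qed.

Lemma val_Xn k (z : A) : val ('X^k *: z) = (sigma ^+ k)%g (val z).
Proof. by rewrite polymodXn val_iter_act. Qed.

Lemma mem_gal1 (g : gal_of {:K}) : g \in 'Gal({:K} / 1)%g.
Proof.
rewrite gal_kHom ?sub1v //; apply/kAHomP => _ /vlineP[k ->].
by rewrite linearZ rmorph1.
Qed.

Lemma order_sigma : #[sigma]%g = (p ^ n)%N.
Proof.
transitivity #|'Gal({:K} / 1)%g|; first by rewrite gal_sigma.
by rewrite -galois_dim // dimv1 divn1 dimK.
Qed.

(** A cyclic group has only one subgroup of each order. *)
Lemma gal_Ki i : (i <= n)%N -> 'Gal({:K} / Ki i)%g = <[sigma ^+ (p ^ i)]>%g.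
Proof.
move=> le_in; have sub1 : (1 <= Ki i <= {:K})%VS by rewrite sub1v subvf.
have galKi := galoisS sub1 galK.
apply/eqP; rewrite (eq_subG_cyclic (cycle_cyclic sigma)) ?cycleX //; last first.
  by have := galS {:K} (sub1v (Ki i)); rewrite gal_sigma.
rewrite -galois_dim // -orderE orderXdiv order_sigma ?dvdn_exp2l //.
by rewrite dimK dimKi.
Qed.

Lemma mem_Ki i a : (i <= n)%N -> (a \in Ki i) = ((sigma ^+ (p ^ i))%g a == a).
Proof.
move=> le_in; have sub1 : (1 <= Ki i <= {:K})%VS by rewrite sub1v subvf.
have galKi := galoisS sub1 galK.
rewrite -{1}(galois_fixedField galKi) gal_Ki //.
apply/(fixedFieldP (memvf a))/eqP => [|fix_a _ /cycleP[k ->]].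
  by apply; apply: cycle_id.
elim: k => [|k IHk]; first exact: gal_id.
by rewrite expgSr galM ?memvf // IHk.
Qed.

Lemma fixedE i (z : A) : (i <= n)%N -> fixed i z <-> val z \in Ki i.
Proof.
move=> le_in; rewrite mem_Ki // -val_Xn /fixed scalerBl scale1r.
by split=> [/eqP|/eqP/val_inj ->]; [rewrite subr_eq0 => /eqP ->|rewrite subrr].
Qed.

Lemma K0E : (Ki 0 = 1%VS :> {vspace K}).
Proof. by apply/eqP; rewrite eq_sym eqEdim sub1v dimKi // dimv1. Qed.

Definition base_unit (c : units F) : A :=
  exist _ (val c)%:A (etrans (congr1 negb (fmorph_eq0 (in_alg K) (val c))) (valP c)).

Lemma base_unit_additive : zmod_morphism base_unit.
Proof.
move=> u v; apply: val_inj => /=; rewrite -[LHS]/(in_alg K (val u / val v)).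
by rewrite fmorph_div.
Qed.
HB.instance Definition _ := GRing.isZmodMorphism.Build (units F) A base_unit base_unit_additive.

Lemma base_unit_inj : injective base_unit.
Proof.
move=> u v /(congr1 val) /= uv; apply: val_inj.
by apply: (fmorph_inj (in_alg K)); rewrite /= uv.
Qed.

Lemma fixed0E (z : A) : fixed 0 z <-> exists c, z = base_unit c.
Proof.
rewrite fixedE // K0E; split=> [/vlineP[c zE]|[c ->]]; last exact: rpredZ (mem1v _).
have c_neq0 : c != 0.
  by have := valP z; apply: contraNneq => c0; rewrite zE c0 scale0r.
by exists (exist _ c c_neq0); apply: val_inj.
Qed.

Lemma val_Nm i (z : A) : val (N i *: z) = \prod_(k < p ^ i) (sigma ^+ k)%g (val z).
Proof.
rewrite /Nm scaler_suml val_units_sum; apply: eq_bigr => k _; exact: val_Xn.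
Qed.

Lemma val_Mm i (z : A) : val (M i *: z) = \prod_(k < p) (sigma ^+ (p ^ i) ^+ k)%g (val z).
Proof.
rewrite /Mm scaler_suml val_units_sum; apply: eq_bigr => k _.
by rewrite -exprM val_Xn expgM.
Qed.

Lemma sub_Ki i j : (i <= j <= n)%N -> (Ki i <= Ki j)%VS.
Proof.
move=> /andP[le_ij le_jn]; apply/subvP => a; rewrite !mem_Ki ?(leq_trans le_ij) //.
move=> /eqP fix_a; apply/eqP; rewrite -(subnK le_ij) expnD mulnC expgM.
elim: (p ^ (j - i))%N => [|k IHk]; first exact: gal_id.
by rewrite expgSr galM ?memvf // IHk.
Qed.

Lemma galois_Ki i j : (i <= j <= n)%N -> galois (Ki i) (Ki j).
Proof.
move=> /andP[le_ij le_jn]; have le_in := leq_trans le_ij le_jn.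
have sub1 k : (1 <= Ki k <= {:K})%VS by rewrite sub1v subvf.
have galKi := galoisS (sub1 i) galK; have galKj := galoisS (sub1 j) galK.
rewrite -[X in galois _ X](galois_fixedField galKj).
apply: normal_fixedField_galois => //; rewrite -sub_abelian_normal.
  by apply: galS; rewrite sub_Ki ?le_ij.
by rewrite gal_Ki // cycle_abelian.
Qed.

(** The restriction of sigma^(p^i) to K_j, which generates Gal(K_j/K_i). *)
Definition sigma_ i j : gal_of (Ki j) := normalField_cast (Ki j) (sigma ^+ (p ^ i))%g.

Section Intermediate.
Variables i j : nat.
Hypothesis le_ijn : (i <= j <= n)%N.
Let le_in : (i <= n)%N. Proof. by case/andP: le_ijn => /leq_trans; apply. Qed.
Let subKi : (Ki i <= Ki j <= {:K})%VS. Proof. by rewrite sub_Ki // subvf. Qed.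
Let normKi : normalField (Ki i) (Ki j). Proof. by case/and3P: (galois_Ki le_ijn). Qed.
Let galKi : galois (Ki i) {:K}.
Proof. by apply: galoisS galK; rewrite sub1v subvf. Qed.

Lemma sigma_cast k a : a \in Ki j -> (sigma_ i j ^+ k)%g a = (sigma ^+ (p ^ i) ^+ k)%g a.
Proof.
move=> aK; elim: k => [|k IHk]; first by rewrite !gal_id.
rewrite !expgSr !galM ?memvf // -IHk.
apply: (normalField_cast_eq subKi normKi); last exact: memv_gal.
by rewrite gal_Ki // cycle_id.
Qed.

Lemma gal_sigma_ : 'Gal(Ki j / Ki i)%g = <[sigma_ i j]>%g.
Proof.
have sigma_gal : (sigma ^+ (p ^ i))%g \in 'Gal({:K} / Ki i)%g by rewrite gal_Ki // cycle_id.
have <- := @morphim_cycle _ _ _ (normalField_cast_morphism subKi normKi) _ sigma_gal.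
by rewrite -(normalField_img galKi subKi normKi) -(gal_Ki le_in).
Qed.

Lemma order_sigma_ : #[sigma_ i j]%g = (p ^ (j - i))%N.
Proof.
transitivity #|'Gal(Ki j / Ki i)%g|; first by rewrite gal_sigma_.
rewrite -galois_dim ?galois_Ki // !dimKi //; last by case/andP: le_ijn.
by rewrite -expnB ?prime_gt0 //; case/andP: le_ijn.
Qed.

Lemma galNormE a : a \in Ki j ->
  galNorm (Ki i) (Ki j) a = \prod_(k < p ^ (j - i)) (sigma ^+ (p ^ i) ^+ k)%g a.
Proof.
move=> aK; rewrite /galNorm gal_sigma_ big_cycle order_sigma_.
by apply: eq_bigr => k _; apply: sigma_cast.
Qed.
End Intermediate.

Lemma units_hilbert90 i (z : A) : (i < n)%N -> fixed i.+1 z -> M i *: z = 0 ->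
  exists2 h, fixed i.+1 h & z = ('X^(p ^ i) - 1 : Zx) *: h.
Proof.
move=> lt_in /fixedE-/(_ lt_in) zK Mz.
have le_iSn : (i <= i.+1 <= n)%N by rewrite leqnSn.
have gen : generator 'Gal(Ki i.+1 / Ki i)%g (sigma_ i i.+1).
  by rewrite /generator gal_sigma_.
have /(Hilbert's_theorem_90 gen zK)[b [bK b0] zE] : galNorm (Ki i) (Ki i.+1) (val z) == 1.
  by rewrite galNormE // subSnn expn1 -val_Mm Mz.
have b0' : b^-1 != 0 by rewrite invr_eq0.
(* Hilbert 90 is available in the form z = b / sigma(b), so h is the inverse of b. *)
exists (exist _ b^-1 b0' : A); first by apply/fixedE => //=; rewrite rpredV.
apply: val_inj; rewrite scalerBl scale1r zE.
have -> : val ('X^(p ^ i) *: (exist _ b^-1 b0' : A) - (exist _ b^-1 b0' : A)) =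
   val ('X^(p ^ i) *: (exist _ b^-1 b0' : A)) / b^-1 by [].
rewrite val_Xn /= fmorphV invrK [RHS]mulrC; congr (_ / _).
by rewrite -[sigma_ _ _]expg1 sigma_cast ?expg1.
Qed.

Lemma galNorm1E i (z : A) : (i <= n)%N -> fixed i z ->
  galNorm 1 (Ki i) (val z) = val (N i *: z).
Proof.
move=> le_in /fixedE-/(_ le_in) zK; rewrite val_Nm -K0E galNormE //.
by rewrite subn0 expn0 expg1.
Qed.

Lemma xi_neq0 : xi != 0.
Proof.
apply/eqP => xi0; have /eqP := prim_expr_order xi_prim.
by rewrite xi0 expr0n gtn_eqF ?prime_gt0 // eq_sym oner_eq0.
Qed.

Definition xi_unit : A := base_unit (exist _ xi xi_neq0).

Lemma val_scale_natr k (z : A) : val ((k%:R : Zx) *: z) = val z ^+ k.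
Proof. by rewrite polymod_natr val_units_muln. Qed.

Lemma KnE : Ki n = {:K}%AS.
Proof. by apply/val_inj/eqP; rewrite eqEdim subvf dimKi // dimK leqnn. Qed.

Lemma xi_neq1 : xi != 1.
Proof.
rewrite -[xi]expr1 -[1 in X in _ != X](expr0 xi) (eq_prim_root_expr xi_prim).
by rewrite modn_small ?prime_gt1 // mod0n.
Qed.

Lemma units_kummer_module : @kummer_module p n m A xi_unit.
Proof.
have xi_val : val xi_unit = in_alg K xi by [].
split=> //.
- by move=> z; apply/fixedE; rewrite // KnE memvf.
- exact: units_hilbert90.
- move=> z /(congr1 val); rewrite val_scale_natr => zp.
  have xiK : p.-primitive_root (in_alg K xi) by rewrite fmorph_primitive_root.
  have [k zE] := prim_rootP xiK zp.
  exists (k : nat)%:Z; rewrite polymodC -pmulrn; apply: val_inj.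
  by rewrite val_units_muln zE.
- apply/eqP => /(congr1 val); rewrite xi_val => xi1.
  by case/eqP: xi_neq1; apply: (fmorph_inj (in_alg K)); rewrite rmorph1; exact: xi1.
- apply: val_inj; rewrite val_scale_natr xi_val -rmorphXn /= prim_expr_order //.
  exact: scale1r.
- by apply/fixed0E; exists (exist _ xi xi_neq0).
- move=> p2 n1; have [b b0 bN] := norm_m1 p2 n1.
  exists (exist _ b b0); apply: val_inj; rewrite -galNorm1E //; last first.
    by apply/fixedE => //; rewrite KnE memvf.
  rewrite KnE bN xi_val; have := xi_neq1; have : xi ^+ 2 == 1.
    by rewrite -{1}p2 (prim_expr_order xi_prim).
  by rewrite sqrf_eq1 => /orP[->//|/eqP ->] _; rewrite rmorphN1.
Qed.

Lemma norm_groupE i c : (i <= n)%N -> c \in norm_group p (Ki i) <->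
  exists (z f : A), [/\ fixed i z, fixed 0 f & base_unit c = N i *: z + (p%:R : Zx) *: f].
Proof.
move=> le_in.
have valE (z : A) (u : units F) : fixed i z ->
    val (N i *: z + (p%:R : Zx) *: base_unit u) = galNorm 1 (Ki i) (val z) * (val u ^+ p)%:A.
  move=> zK; rewrite (galNorm1E le_in zK); congr (_ * _).
  by rewrite val_scale_natr /= -[LHS]/(in_alg K (val u) ^+ p) -rmorphXn.
split=> [/asboolP[b bK [u cE]]|[z [f [zK /fixed0E[u ->] cE]]]].
  have bK' : fixed i (b : A) by apply/fixedE.
  exists b, (base_unit u); split=> //; first by apply/fixed0E; exists u.
  by apply: val_inj; rewrite valE.
apply/asboolP; exists z; first by apply/fixedE.
by exists u; rewrite -valE // -cE.
Qed.

Lemma multiplesE q (V : zmodType) (v : V) : v \in multiples q V <-> exists u, v = u *+ q.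
Proof. by split=> /asboolP. Qed.
End GaloisModule.

(** * Bases of the quotients of the norm filtration of F^x *)

Lemma Fp_dim_bij p (V : zmodType) (I J : choiceType) (h : I -> J) : bijective h ->
  Fp_dim p V I -> Fp_dim p V J.
Proof.
move=> [h' hK h'K] [b [span indep]]; exists (b \o h'); split=> [v|r c uniq_r sum0].
  have [r [c ->]] := span v; exists (map h r), (c \o h').
  by rewrite big_map; apply: eq_bigr => i _ /=; rewrite hK.
move=> j j_r; have := indep (map h' r) (c \o h).
rewrite map_inj_uniq; last exact: can_inj h'K.
rewrite big_map => /(_ uniq_r); under eq_bigr do rewrite /= h'K.
by move=> /(_ sum0) /(_ (h' j)); rewrite map_f // /= h'K => /(_ isT).
Qed.

Lemma telescope_sub (V : zmodType) (a b c d : V) : a - (b + c) = (a - (d + c)) + (d - b).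
Proof. by rewrite [d + c]addrC [b + c]addrC !opprD !addrA subrK. Qed.

Lemma telescope_add (V : zmodType) (b c d : V) : d + c = (b + c) + (d - b).
Proof. by rewrite [b + c]addrC [d - b]addrC addrA addrK addrC. Qed.

Section LevelBasis.
Variables (p n m : nat) (p_pr : prime p) (n_gt0 : (0 < n)%N)
    (m_gt0 : (0 < m)%N) (F : fieldType) (K : splittingFieldType F)
    (galK : galois 1 {:K}) (dimK : \dim {:K} = (p ^ n)%N)
    (sigma : gal_of {:K}) (gal_sigma : 'Gal({:K} / 1)%g = <[sigma]>%g)
    (Ki : nat -> {subfield K})
    (dimKi : forall i : nat, (i <= n)%N -> \dim (Ki i) = (p ^ i)%N)
    (xi : F) (xi_prim : p.-primitive_root xi)
    (norm_m1 : p = 2%N -> n = 1%N ->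
       exists2 b : K, b != 0 & galNorm 1 {:K} b = -1).

Local Notation act := (@gmod_act (gal_of {:K}) (units K) sigma : {additive units K -> units K}).
Local Notation A := (polymod act).
Local Notation Zx := {poly int}.
Local Notation fixed := (fixed p).
Local Notation N := (Nm p).
Local Notation base_unit := (base_unit sigma).
Local Notation lower_norm := (@lower_norm p n A).
Local Notation norm_group i := (norm_group p (Ki i)).

Section OneLevel.
Variables (i : nat) (le_in : (i <= n)%N) (B : zmodClosed (units F)).
Hypothesis BE : forall v, lower_norm i (base_unit v) <-> v \in B.
Variables (J : finType) (w : J -> A).
Hypothesis wK : forall j, fixed i (w j).
Hypothesis w_indep : forall c : J -> int,
  lower_norm i (\sum_j (c j)%:P *: (N i *: w j)) -> forall j, (p %| c j)%Z.

(** The norms of the w_j are completed to a basis of the quotient. An element of the norm group is a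
    norm only up to F^xp, but B contains F^xp, so each new basis vector can be replaced by a norm
    N_i g. *)
Lemma level_basis : exists (E : choiceType) (g : E -> A),
  [/\ forall t, fixed i (g t),
      Fp_dim p (subquotient (norm_group i) B) (E + J)%type,
      forall v, fixed i v -> exists (r : seq E) (c : E -> int) (c' : J -> int),
        lower_norm i (N i *: v - (\sum_(t <- r) (c t)%:P *: (N i *: g t) + \sum_j (c' j)%:P *: (N i *: w j)))
    & forall (r : seq E) (c : E -> int) (c' : J -> int), uniq r ->
        lower_norm i (\sum_(t <- r) (c t)%:P *: (N i *: g t) + \sum_j (c' j)%:P *: (N i *: w j)) ->
        {in r, forall t, (p %| c t)%Z} /\ forall j, (p %| c' j)%Z].
Proof.
have normE c : c \in norm_group i <-> exists (z f : A), [/\ fixed i z, fixed 0 f &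
    base_unit c = N i *: z + (p%:R : Zx) *: f].
  exact: (norm_groupE p_pr galK dimK gal_sigma dimKi).
have fix0E (z : A) : fixed 0 z <-> exists c, z = base_unit c.
  exact: (fixed0E galK dimK gal_sigma dimKi).
have base_mulrz v (c : int) : base_unit (v *~ c) = c%:P *: base_unit v.
  by rewrite polymodC raddfMz.
have base_sum (I : Type) (r : seq I) (G : I -> units F) (c : I -> int) :
    base_unit (\sum_(k <- r) G k *~ c k) = \sum_(k <- r) (c k)%:P *: base_unit (G k).
  by rewrite raddf_sum; apply: eq_bigr => k _; exact: base_mulrz.
have /choice[w' w'E] : forall j, exists c, N i *: w j = base_unit c.
  by move=> j; apply/fix0E/fixed_Nm.
have w'A j : w' j \in norm_group i.
  by apply/normE; exists (w j), 0; rewrite scaler0 addr0 w'E; split=> //; apply: fixed00.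
have pA v : v \in norm_group i -> v *+ p \in B.
  move=> _; apply/BE; rewrite pmulrn base_mulrz -[p%:Z]natz polyC_natr.
  by apply: lower_norm_p; apply/fix0E; exists v.
have [|E [b [bA span indep]]] := @adapted_basis p _ (norm_group i) B J w' p_pr pA.
  move=> r c uniq_r rJ sumB.
  pose c' j := if inr j \in r then c (inr j) else 0.
  have sumE : \sum_(k <- r) vec_of w' k *~ c k = \sum_j w' j *~ c' j.
    have r_perm : perm_eq r [seq inr j | j <- index_enum J & inr j \in r].
      apply: uniq_perm => //; first by rewrite map_inj_uniq => [|? ? []//]; exact/filter_uniq/index_enum_uniq.
      move=> k; apply/idP/mapP => [k_r|[j]].
        case: k k_r (rJ k k_r) => // j j_r _.
        by exists j; rewrite // mem_filter j_r mem_index_enum.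
      by rewrite mem_filter => /andP[j_r _] ->.
    rewrite (perm_big _ r_perm) big_map big_filter big_mkcond.
    by apply: eq_bigr => j _; rewrite /c'; case: ifP => //; rewrite mulr0z.
  move=> k k_r; case: k k_r (rJ k k_r) => // j j_r _.
  have := w_indep (c := c') _ j; rewrite /c' j_r; apply.
  move: sumB; rewrite sumE => /BE; rewrite base_sum.
  by under eq_bigr do rewrite -w'E.
have /choice[g gE] : forall t, exists g, fixed i g /\ exists f, fixed 0 f /\
    base_unit (b t) = N i *: g + (p%:R : Zx) *: f.
  by move=> t; have /normE[z [f [zK fF bE]]] := bA t; exists z; split=> //; exists f.
have bE t : lower_norm i (base_unit (b t) - N i *: g t).
  have [_ [f [fF ->]]] := gE t; rewrite addrC addKr.
  exact: lower_norm_p.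
have lowN s t : lower_norm i s -> lower_norm i t -> lower_norm i (s - t).
  move=> ls lt; apply: lower_normD => //; rewrite -scaleN1r; exact: lower_normZ.
have sumbE (r : seq E) (c : E -> int) :
    lower_norm i (base_unit (\sum_(t <- r) b t *~ c t) - \sum_(t <- r) (c t)%:P *: (N i *: g t)).
  rewrite base_sum -sumrB; apply: lower_norm_sum => t _.
  by rewrite -scalerBr; apply: lower_normZ.
exists E, g; split.
- by move=> t; case: (gE t).
- apply: (@Fp_dim_subquotient p _ (norm_group i) B p_pr pA _ (basis_vec w' b)) => //.
  by case.
- move=> v vK; have /fix0E[v' v'E] := fixed_Nm vK.
  have /span[r [c]] : v' \in norm_group i.
    by apply/normE; exists v, 0; rewrite scaler0 addr0 v'E; split=> //; apply: fixed00.
  have [r1 [c' ->]] : exists (r1 : seq E) (c' : J -> int), \sum_(k <- r) basis_vec w' b k *~ c k =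
      \sum_(t <- r1) b t *~ c (inl t) + \sum_j w' j *~ c' j.
    elim: r => [|k r [r1 [c' IHr]]].
      exists [::], (fun=> 0); rewrite !big_nil big1 ?addr0 // => j _; exact: mulr0z.
    rewrite big_cons IHr; case: k => [t|j] /=.
      by exists (t :: r1), c'; rewrite big_cons addrA.
    exists r1, (fun j' => c' j' + (if j' == j then c (inr j) else 0)).
    rewrite addrCA; congr (_ + _); under [RHS]eq_bigr do rewrite mulrzDr.
    rewrite big_split addrC /=; congr (_ + _); rewrite (bigD1 j) //= eqxx big1 ?addr0 //.
    by move=> j' /negPf ->; rewrite mulr0z.
  move=> /BE sumB; exists r1, (fun t => c (inl t)), c'.
  have -> : N i *: v - (\sum_(t <- r1) (c (inl t))%:P *: (N i *: g t) + \sum_j (c' j)%:P *: (N i *: w j)) =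
    base_unit (v' - (\sum_(t <- r1) b t *~ c (inl t) + \sum_j w' j *~ c' j)) +
    (base_unit (\sum_(t <- r1) b t *~ c (inl t)) - \sum_(t <- r1) (c (inl t))%:P *: (N i *: g t)).
    rewrite raddfB raddfD /= -v'E (base_sum J).
    under [X in _ = N i *: v - (_ + X) + _]eq_bigr do rewrite -w'E.
    exact: telescope_sub.
  exact: lower_normD.
move=> r c c' uniq_r low.
pose c2 (k : E + J) := match k with inl t => c t | inr j => c' j end.
have sumE : \sum_(k <- [seq inl t | t <- r] ++ [seq inr j | j <- index_enum J]) basis_vec w' b k *~ c2 k =
   \sum_(t <- r) b t *~ c t + \sum_j w' j *~ c' j.
  by rewrite big_cat !big_map.
have uniq2 : uniq ([seq (inl t : E + J) | t <- r] ++ [seq inr j | j <- index_enum J]).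
  rewrite cat_uniq !map_inj_uniq ?index_enum_uniq ?uniq_r /= ?andbT; try by move=> ? ? [].
  by apply/hasPn => _ /mapP[j _ ->]; apply/negP => /mapP[t _].
have {}indep := indep _ c2 uniq2; rewrite sumE in indep.
have {}low : lower_norm i (base_unit (\sum_(t <- r) b t *~ c t + \sum_j w' j *~ c' j)).
  have -> : base_unit (\sum_(t <- r) b t *~ c t + \sum_j w' j *~ c' j) =
    (\sum_(t <- r) (c t)%:P *: (N i *: g t) + \sum_j (c' j)%:P *: (N i *: w j)) +
    (base_unit (\sum_(t <- r) b t *~ c t) - \sum_(t <- r) (c t)%:P *: (N i *: g t)).
    rewrite raddfD /= (base_sum J).
    under [X in _ = _ + X + _]eq_bigr do rewrite w'E.
    exact: telescope_add.
  exact: lower_normD.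
have dvd := indep (iffLR (BE _) low); split=> [t t_r|j].
  by have := dvd (inl t); rewrite mem_cat map_f // => /(_ isT).
by have := dvd (inr j); rewrite mem_cat map_f ?mem_index_enum ?orbT // => /(_ isT).
Qed.
End OneLevel.
End LevelBasis.

Lemma sum_sig (V : zmodType) (I : finType) (P : pred I) (f : I -> V) :
  \sum_(i | P i) f i = \sum_(k : {i | P i}) f (val k).
Proof.
rewrite (reindex_omap (val : {i | P i} -> I) insub) => [|i Pi]; last by rewrite insubT.
by apply: eq_bigl => k; rewrite valK eqxx (valP k).
Qed.

Section LevelComb.
Variables (p n m : nat) (A : lmodType {poly int}) (a : nat -> nat) (y : A) (x : nat -> A).
Local Notation N := (Nm p).

Definition level_comb (i : nat) (E : choiceType) (g : E -> A) (r : seq E) (c : E -> int)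
    (u0 : int) (u : 'I_m -> int) : A :=
  (if i == n then u0%:P else 0) *: (N n *: y)
    + \sum_(j < m | a j == i.+1) (u j)%:P *: (N i *: x j)
    + \sum_(t <- r) (c t)%:P *: (N i *: g t).
End LevelComb.

Section LevelData.
Variables (p n m : nat) (p_pr : prime p) (n_gt0 : (0 < n)%N)
    (m_gt0 : (0 < m)%N) (F : fieldType) (K : splittingFieldType F)
    (galK : galois 1 {:K}) (dimK : \dim {:K} = (p ^ n)%N)
    (sigma : gal_of {:K}) (gal_sigma : 'Gal({:K} / 1)%g = <[sigma]>%g)
    (Ki : nat -> {subfield K})
    (dimKi : forall i : nat, (i <= n)%N -> \dim (Ki i) = (p ^ i)%N)
    (xi : F) (xi_prim : p.-primitive_root xi)
    (norm_m1 : p = 2%N -> n = 1%N ->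
       exists2 b : K, b != 0 & galNorm 1 {:K} b = -1).

Local Notation act := (@gmod_act (gal_of {:K}) (units K) sigma : {additive units K -> units K}).
Local Notation A := (polymod act).
Local Notation fixed := (fixed p).
Local Notation N := (Nm p).
Let kmA := units_kummer_module p_pr n_gt0 m_gt0 galK dimK gal_sigma dimKi xi_prim norm_m1.
Local Notation base_unit := (base_unit sigma).
Local Notation lower_norm := (@lower_norm p n A).
Local Notation norm_group i := (norm_group p (Ki i)).
Local Notation xiA := (xi_unit p_pr sigma xi_prim).
Variables (a : nat -> nat) (e : int) (y : A) (x : nat -> A).
Hypothesis min_a : minimal_sys p n m xiA a.
Hypothesis sys : system p n m a e y x xiA.

(** Undoes the shift of indices, to match the encoding of the presentation. *)
Definition level_of (j : 'I_m) : option 'I_n.+1 :=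
  if a j is i.+1 then Some (inord i) else None.

Lemma level_ofE (j : 'I_m) (i : 'I_n.+1) : (level_of j == Some i) = (a j == i.+1).
Proof.
rewrite /level_of; have := adm_bound (min_adm min_a) (ltn_ord j).
case: (a j) => [|k] // le_kn; rewrite eqSS; apply/eqP/eqP => [[<-]|->].
  by rewrite inordK.
by congr Some; apply: inord_val.
Qed.

Local Notation level_sum := (@level_comb p n m A a y x).

(** The g are the generators of Y_i. At level n the summand [unit] stands for y, whence the 1 in the
    formula for e(n,m). *)
Definition level_data (i : 'I_n.+1) (E : choiceType) (g : E -> A) :=
  [/\ forall t, fixed i (g t),
      ((i < n)%N -> Fp_dim p (subquotient (norm_group i) (norm_group i.+1))
         (E + {j : 'I_m | level_of j == Some i})%type) /\
      ((i : nat) = n -> Fp_dim p (subquotient (norm_group n) (multiples p (units F)))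
         (E + unit + {j : 'I_m | level_of j == Some i})%type),
      forall v, fixed i v -> exists r c u0 u, lower_norm i (N i *: v - level_sum i g r c u0 u)
    & forall r c u0 u, uniq r -> lower_norm i (level_sum i g r c u0 u) ->
        [/\ (i : nat) = n -> (p %| u0)%Z, forall j : 'I_m, a j = i.+1 -> (p %| u j)%Z
          & {in r, forall t, (p %| c t)%Z}]].

Lemma ex_level_data (i : 'I_n.+1) : exists (E : choiceType) (g : E -> A), level_data i g.
Proof.
have le_in : (i <= n)%N by rewrite -ltnS.
have min_indep u0 u : lower_norm i (level_sum i (fun t : void => 0) [::] (fun=> 0) u0 u) ->
    ((i : nat) = n -> (p %| u0)%Z) /\ forall j : 'I_m, a j = i.+1 -> (p %| u j)%Z.
  move=> low; have [|u0P uP _] // := @minimal_level_indep p n m A xiA kmA void (fun=> 0%N) (fun=> 0)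
    a e y x i min_a sys le_in u0 u (fun=> 0).
  by move: low; rewrite /level_comb !big_nil.
have xK (j : 'I_m) : a j = i.+1 -> fixed i (x j).
  by move=> aj; have := x_fixed sys j; rewrite aj.
have normE := norm_groupE p_pr galK dimK gal_sigma dimKi.
have fix0E := fixed0E galK dimK gal_sigma dimKi.
pose ext (c : {j : 'I_m | level_of j == Some i} -> int) (j : 'I_m) :=
  if insub j is Some k then c k else 0.
have sumE c : \sum_(j < m | a j == i.+1) (ext c j)%:P *: (N i *: x j) =
    \sum_k (c k)%:P *: (N i *: x (val k)).
  under eq_bigl do rewrite -level_ofE.
  by rewrite sum_sig; apply: eq_bigr => k _; rewrite /ext valK.
have sumE' (u : 'I_m -> int) : \sum_(j < m | a j == i.+1) (u j)%:P *: (N i *: x j) =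
    \sum_(k : {j : 'I_m | level_of j == Some i}) (u (val k))%:P *: (N i *: x (val k)).
  under eq_bigl do rewrite -level_ofE.
  by rewrite sum_sig.
have [lt_in|] := ltnP i n.
  have neq_in : (i == n :> nat) = false by apply: ltn_eqF.
  have BE v : lower_norm i (base_unit v) <-> v \in norm_group i.+1.
    rewrite normE //; split=> [[z [f [zK _ fF E]]]|[z [f [zK fF E]]]]; exists z, f.
      by rewrite NmS -scalerA; split.
    by rewrite scalerA -NmS; split=> //; left.
  have [||E [g [gK dimE span indep]]] := @level_basis p n p_pr F K galK dimK sigma gal_sigma Ki dimKi i le_in
      (norm_group i.+1) BE _ (fun k : {j : 'I_m | level_of j == Some i} => x (val k)).
  - by move=> [j /= aj]; apply: xK; apply/eqP; rewrite -level_ofE.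
  - move=> c low k; have [|_ uP] := min_indep 0 (ext c).
      by rewrite /level_comb neq_in scale0r add0r big_nil addr0 sumE.
    have := uP (val k); rewrite /ext valK; apply; apply/eqP; rewrite -level_ofE.
    exact: (valP k).
  exists E, g; split=> //.
  - by split=> // i_n; rewrite i_n ltnn in lt_in.
  - move=> v /span[r [c [c' low]]]; exists r, c, 0, (ext c').
    by rewrite /level_comb neq_in scale0r add0r sumE [_ + \sum_(t <- r) _]addrC.
  - move=> r c u0 u uniq_r; rewrite /level_comb neq_in scale0r add0r sumE' addrC.
    move=> /(indep r c (fun k => u (val k)) uniq_r)[cP uP]; split=> //.
      by move=> i_n; rewrite i_n ltnn in lt_in.
    move=> j /eqP; rewrite -level_ofE => aj; exact: (uP (exist _ j aj)).
move=> le_ni; have i_n : (i : nat) = n by apply/eqP; rewrite eqn_leq le_in.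
have eq_in : (i == n :> nat) by rewrite i_n.
have BE v : lower_norm i (base_unit v) <-> v \in multiples p (units F).
  rewrite multiplesE; split=> [[z [f [zK hz /fix0E[u ->] E]]]|[u ->]].
    exists u; apply: (base_unit_inj (sigma := sigma)); rewrite raddfMn /= E.
    by case: hz => [|->]; rewrite ?i_n ?ltnn // !scaler0 add0r scaler_nat.
  rewrite raddfMn -scaler_nat; apply: lower_norm_p; apply/fix0E; by exists u.
have [||E [g [gK dimE span indep]]] := @level_basis p n p_pr F K galK dimK sigma gal_sigma Ki dimKi i le_in
    (multiples p (units F)) BE _ (fun k : unit + {j : 'I_m | level_of j == Some i} =>
      match k with inl _ => y | inr k => x (val k) end).
- case=> [_|[j /= aj]]; first by rewrite i_n; apply: (km_fixed kmA).
  by apply: xK; apply/eqP; rewrite -level_ofE.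
- move=> c low k; have [|u0P uP] := min_indep (c (inl tt)) (ext (fun k => c (inr k))).
    rewrite /level_comb eq_in big_nil addr0 sumE; move: low; rewrite big_sumType /=.
    by rewrite (big_pred1 tt) /= ?i_n // => -[].
  case: k => [[]|k]; first exact: u0P.
  have := uP (val k); rewrite /ext valK; apply; apply/eqP; rewrite -level_ofE.
  exact: (valP k).
have sumJ (c : unit + {j : 'I_m | level_of j == Some i} -> int) :
    \sum_k (c k)%:P *: (N i *: (match k with inl _ => y | inr k => x (val k) end)) =
    (c (inl tt))%:P *: (N n *: y) + \sum_k (c (inr k))%:P *: (N i *: x (val k)).
  by rewrite big_sumType /= (big_pred1 tt) ?i_n // => -[].
exists E, g; split=> //.
- split=> [|_]; first by rewrite i_n ltnn.
  rewrite i_n in dimE.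
  apply: (@Fp_dim_bij _ _ (E + (unit + {j : 'I_m | level_of j == Some i}))%type _ (fun k => match k with
     | inl t => inl (inl t) | inr (inl u) => inl (inr u) | inr (inr k) => inr k end)) dimE.
  exists (fun k => match k with
     | inl (inl t) => inl t | inl (inr u) => inr (inl u) | inr k => inr (inr k) end).
    by case=> [t|[u|k]].
  by case=> [[t|u]|k].
- move=> v /span[r [c [c' low]]]; exists r, c, (c' (inl tt)), (ext (fun k => c' (inr k))).
  by rewrite /level_comb eq_in sumE -sumJ [_ + \sum_(t <- r) _]addrC.
- move=> r c u0 u uniq_r; rewrite /level_comb eq_in sumE'.
  pose c' k := match k : unit + {j : 'I_m | level_of j == Some i} with
    | inl _ => u0 | inr k => u (val k) end.
  have := sumJ c'; rewrite /= => <-; rewrite addrC => /(indep r c c' uniq_r)[cP uP]; split=> //.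
    by move=> _; exact: (uP (inl tt)).
  by move=> j /eqP; rewrite -level_ofE => aj; exact: (uP (inr (exist _ j aj))).
Qed.
End LevelData.

(** * Modules over group rings *)

Section SpanModule.
Variables (R : pzRingType) (V : lmodType R) (E : choiceType) (g : E -> V).

Lemma sum_extend (U : zmodType) (r s : seq E) (f : E -> U) : uniq r -> uniq s -> {subset r <= s} ->
  \sum_(t <- r) f t = \sum_(t <- s) (if t \in r then f t else 0).
Proof.
move=> uniq_r uniq_s sub_rs; rewrite -big_mkcond -[RHS]big_filter.
apply: perm_big; apply: uniq_perm; rewrite ?filter_uniq // => t.
by rewrite mem_filter; case: (boolP (t \in r)) => // /sub_rs ->.
Qed.

Definition span_pred : {pred V} := fun v =>
  `[< exists (r : seq E) (c : E -> R), uniq r /\ v = \sum_(t <- r) c t *: g t >].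

Fact span_pred_closed : submod_closed span_pred.
Proof.
split=> [|k u v /asboolP[r [c [uniq_r ->]]] /asboolP[s [d [uniq_s ->]]]]; apply/asboolP.
  by exists [::], (fun=> 0); rewrite big_nil.
exists (undup (r ++ s)), (fun t => k * (if t \in r then c t else 0) + (if t \in s then d t else 0)).
split; first exact: undup_uniq.
rewrite (sum_extend (s := undup (r ++ s)) _ uniq_r) ?undup_uniq //; last first.
  by move=> t t_r; rewrite mem_undup mem_cat t_r.
rewrite (sum_extend (s := undup (r ++ s)) _ uniq_s) ?undup_uniq //; last first.
  by move=> t t_s; rewrite mem_undup mem_cat t_s orbT.
rewrite scaler_sumr -big_split; apply: eq_bigr => t _ /=.
by rewrite scalerDl -scalerA; do 2!case: ifP; rewrite ?scale0r.
Qed.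
HB.instance Definition _ := GRing.isZmodClosed.Build V span_pred
  (GRing.submod_closedB span_pred_closed).
HB.instance Definition _ := GRing.isSubmodClosed.Build R V span_pred span_pred_closed.

Definition span_module := {v | v \in span_pred}.
HB.instance Definition _ := SubChoice.on span_module.
HB.instance Definition _ := [SubChoice_isSubZmodule of span_module by <:].
HB.instance Definition _ := [SubZmodule_isSubLmodule of span_module by <:].

Lemma span_gen t : g t \in span_pred.
Proof. by apply/asboolP; exists [:: t], (fun=> 1); rewrite big_seq1 scale1r. Qed.

Lemma span_moduleP (v : span_module) : exists (r : seq E) (c : E -> R),
  uniq r /\ val v = \sum_(t <- r) c t *: g t.
Proof. exact/asboolP/(valP v). Qed.
End SpanModule.

(* A module over [R] on which the action factors through a surjective ring
   morphism [phi : R -> S], seen as a module over [S]; [lift] is a section of [phi]. *)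
Record descent_data (R S : pzRingType) (V : lmodType R) (phi : R -> S) (lift : S -> R) : Prop :=
  DescentData {
    descent_D : {morph phi : u v / u + v};
    descent_M : {morph phi : u v / u * v};
    descent_1 : phi 1 = 1;
    descent_K : cancel lift phi;
    descent_eq : forall u u' (v : V), phi u = phi u' -> u *: v = u' *: v
  }.

Definition descent (R S : pzRingType) (V : lmodType R) (phi : R -> S) (lift : S -> R)
  of descent_data V phi lift : Type := V.

Section Descent.
Variables (R S : pzRingType) (V : lmodType R) (phi : R -> S) (lift : S -> R).
Hypothesis dd : descent_data V phi lift.
HB.instance Definition _ := GRing.Zmodule.on (descent dd).

Definition descent_scale (s : S) (v : descent dd) : descent dd := lift s *: (v : V).

Fact descent_scaleA a b v : descent_scale a (descent_scale b v) = descent_scale (a * b) v.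
Proof.
rewrite /descent_scale scalerA; apply: (descent_eq dd).
by rewrite (descent_M dd) !(descent_K dd).
Qed.
Fact descent_scale1 : left_id 1 descent_scale.
Proof.
move=> v; rewrite /descent_scale -[RHS](scale1r (v : V)); apply: (descent_eq dd).
by rewrite (descent_K dd) (descent_1 dd).
Qed.
Fact descent_scaleDr : right_distributive descent_scale +%R.
Proof. by move=> s u v; apply: scalerDr. Qed.
Fact descent_scaleDl v : {morph descent_scale^~ v : a b / a + b}.
Proof.
move=> a b; rewrite /descent_scale -scalerDl; apply: (descent_eq dd).
by rewrite (descent_D dd) !(descent_K dd).
Qed.
HB.instance Definition _ := GRing.Zmodule_isLmodule.Build S (descent dd)
  descent_scaleA descent_scale1 descent_scaleDr descent_scaleDl.

Definition to_descent (v : V) : descent dd := v.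
Fact to_descent_additive : zmod_morphism to_descent. Proof. by []. Qed.
HB.instance Definition _ := GRing.isZmodMorphism.Build V (descent dd) to_descent
  to_descent_additive.

Lemma lmod_iso_via_descent : lmod_iso_via phi V (descent dd).
Proof.
exists to_descent; split; first by exists id.
by move=> r v; apply: (descent_eq dd); rewrite (descent_K dd).
Qed.
End Descent.

Lemma lmod_iso_bij (R : pzRingType) (V W : lmodType R) (f : {linear V -> W}) :
  (forall v, f v = 0 -> v = 0) -> (forall w, exists v, f v = w) -> lmod_iso W V.
Proof.
move=> ker0 /choice[g fg].
have f_inj : injective f.
  by move=> u v /eqP; rewrite -subr_eq0 -raddfB => /eqP/ker0/eqP; rewrite subr_eq0 => /eqP.
have lin : linear g.
  by move=> a u v; apply: f_inj; rewrite linearP !fg.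
pose gL : {linear W -> V} := HB.pack g (GRing.isLinear.Build R W V _ g lin).
by exists gL, f => v; [exact: fg | apply: f_inj; exact: fg].
Qed.

Section GroupRingPoly.
Variables (q N0 : nat) (q_gt1 : (1 < q)%N) (G : finGroupType) (s : G).
Hypothesis sG : forall g : G, g \in <[s]>%g.
Variable V : gmodType G.
Local Notation R := (group_ring 'Z_q G).
Local Notation Vq := (mod_multiples q_gt1 V).
Local Notation pi := (\pi_(Quotient.quot (multiples q V)))%qT.
Local Notation PV := (polymod (@gmod_act G V s : {additive V -> V})).

(** An integral lift of u: when X acts as s, it acts on V as u does on V/qV. Relations over the
    group ring are thus transferred to Z[X]. *)
Definition gr_poly (u : R) : {poly int} := \sum_(k < #[s]%g) ((u (s ^+ k)%g : nat)%:R) *: 'X^k.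

Lemma gmod_actX k (z : V) : gmod_act (s ^+ k)%g z = iter k (gmod_act s) z.
Proof. by elim: k => [|k IHk]; rewrite ?gmod_act1 // expgSr gmod_actM IHk. Qed.

Lemma gr_poly_scale (u : R) (z : PV) : gr_poly u *: z = \sum_g gmod_act g (z : V) *+ u g.
Proof.
rewrite (eq_bigl (fun g => g \in <[s]>%g)) => [|g]; last by rewrite sG.
rewrite big_cycle scaler_suml; apply: eq_bigr => k _.
rewrite -mul_polyC -scalerA polymodXn polymodC gmod_actX.
by rewrite natz -pmulrn.
Qed.

Lemma pi_gr_poly (u : R) (z : PV) : pi (gr_poly u *: z) = u *: (pi z : Vq).
Proof. by rewrite gr_poly_scale; apply/esym/mod_multiples_pi. Qed.

Lemma gr_elt_scale g (z : V) : gr_elt 'Z_q g *: (pi z : Vq) = pi (gmod_act g z).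
Proof.
apply: etrans (mod_multiples_pi _ _ _) _; congr (pi _).
rewrite (bigD1 g) //= ffunE eqxx big1 ?addr0 => [|h /negPf neq_hg].
  by rewrite /= Zp_cast // modn_small.
by rewrite ffunE neq_hg.
Qed.

Lemma pi_poly (c : {poly int}) : exists u : R, forall z : PV, pi (c *: z) = u *: (pi z : Vq).
Proof.
elim/poly_ind: c => [|c d [u uE]]; first by exists 0 => z; rewrite !scale0r raddf0.
exists (u * gr_elt 'Z_q s + d%:~R) => z.
rewrite scalerDl -scalerA polymodX polymodC raddfD /= uE.
by rewrite scalerDl -scalerA gr_elt_scale scaler_int raddfMz.
Qed.

Lemma pi_eq0 (z : V) : pi z = 0 :> Vq <-> exists w, z = w *+ q.
Proof.
split=> [z0|[w ->]]; last first.
  apply/eqP; rewrite -[0](raddf0 pi) -Quotient.idealrBE subr0; apply/asboolP; by exists w.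
have /asboolP // : z \in multiples q V.
by rewrite -[z]subr0 Quotient.idealrBE; apply/eqP; rewrite raddf0; exact: z0.
Qed.
End GroupRingPoly.

(** * The presented module *)

Section PadicReduction.
Variable p : nat.
Hypothesis p_pr : prime p.

Let q_gt1 k : (1 < p ^ k.+1)%N. Proof. exact: prime_expn_gt1. Qed.

Lemma Zp_natr_le k l N : (k <= l)%N -> ((N%:R : 'Z_(p ^ l.+1)) : nat)%:R = N%:R :> 'Z_(p ^ k.+1).
Proof.
move=> le_kl; rewrite val_Zp_nat // -Zp_nat_mod // modn_dvdm ?dvdn_exp2l //.
by rewrite Zp_nat_mod.
Qed.

Lemma padic_le (c : padic p) k l : (k <= l)%N -> val c k = (val c l : nat)%:R :> 'Z_(p ^ k.+1).
Proof.
have /asboolP cK := valP c.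
elim: l => [|l IHl]; first by rewrite leqn0 => /eqP ->; rewrite natr_Zp.
rewrite leq_eqVlt => /orP[/eqP ->|]; first by rewrite natr_Zp.
by rewrite ltnS => le_kl; rewrite (IHl le_kl) {1}cK Zp_natr_le.
Qed.

Lemma val_padicMn (c : padic p) N k : val (c *+ N) k = val c k *+ N.
Proof. by elim: N => // N IHN; rewrite !mulrS -IHN. Qed.

Lemma padic_div (c : padic p) m : val c m = 0 -> exists c', c = c' *+ p ^ m.+1.
Proof.
move=> cm; set q := (p ^ m.+1)%N; have q_gt0 : (0 < q)%N by rewrite expn_gt0 prime_gt0.
(* Component k is a class modulo p^(k+1), so dividing by p^(m+1) requires a representative modulo
   p^(k+m+2). *)
pose X k : nat := val c (k + m.+1)%N.
have dvd_X k : (q %| X k)%N.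
  have := padic_le c (leq_trans (leqnSn m) (leq_addl k m.+1)).
  rewrite cm => /esym/(congr1 val); rewrite /= val_Zp_nat //= => X0.
  by apply/eqP; rewrite X0.
pose y : famprod (fun k => 'Z_(p ^ k.+1)) := fun k => (X k %/ q)%:R.
have yC : y \in @padic_compat p.
  apply/asboolP => k; rewrite /y Zp_natr_le //.
  have XE : X k = (X k.+1 %% p ^ (k + m.+1).+1)%N.
    by rewrite /X {1}(padic_le c (leqnSn (k + m.+1))) val_Zp_nat.
  have pE : (p ^ (k + m.+1).+1 = p ^ k.+1 * q)%N by rewrite -expnD addSn.
  rewrite [X k.+1](divn_eq _ (p ^ (k + m.+1).+1)) -XE pE mulnA divnMDl //.
  have p0 : (p ^ k.+1)%:R = 0 :> 'Z_(p ^ k.+1) by rewrite -(Zp_nat_mod (q_gt1 k)) modnn.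
  by rewrite natrD natrM p0 mulr0 add0r.
exists (exist _ y yC); apply: val_inj; apply: functional_extensionality_dep => k.
rewrite val_padicMn /= /y -mulrnA divnK // (padic_le c (leq_addr m.+1 k)) //.
Qed.
End PadicReduction.

Section Presentation.
Variables (p n m' : nat).
Hypothesis p_pr : prime p.
Local Notation m := m'.+1.
Local Notation q := (p ^ m)%N.
Variables (G : finGroupType) (sigma : G).
Variables (lv : 'I_m -> option 'I_n.+1) (d : int).
Hypothesis q_gt1 : (1 < q)%N.
Local Notation ZpG := (group_ring (padic p) G).
Local Notation R := (group_ring 'Z_q G).
Local Notation X := (X_module p sigma lv d).
Local Notation XX := (mod_multiples q_gt1 X).
Local Notation piX := (\pi_(Quotient.quot (submod_gen (X_relations p sigma lv d))))%qT.

(** Component m' of a p-adic integer is its class modulo p^(m'+1); writing m as m' + 1 makes this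
    ring Z/p^m. *)
Definition gr_red (u : ZpG) : R := [ffun g => (val (u g) m' : 'Z_q)].

Lemma gr_red_additive : zmod_morphism gr_red.
Proof. by move=> u v; apply/ffunP => g; rewrite !ffunE. Qed.
HB.instance Definition _ := GRing.isZmodMorphism.Build ZpG R gr_red gr_red_additive.

Lemma val_padic_sum (I : Type) (r : seq I) (f : I -> padic p) k :
  val (\sum_(i <- r) f i) k = \sum_(i <- r) (val (f i) k : 'Z_(p ^ k.+1)).
Proof. exact: (big_morph (fun c : padic p => val c k) (fun _ _ => erefl) erefl). Qed.

Lemma gr_redM u v : gr_red (u * v) = gr_red u * gr_red v.
Proof.
apply/ffunP => g; rewrite !ffunE val_padic_sum; apply: eq_bigr => h _.
by rewrite !ffunE.
Qed.

Lemma gr_red_elt g : gr_red (gr_elt _ g) = gr_elt _ g.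
Proof. by apply/ffunP => h; rewrite !ffunE; case: eqP. Qed.

Lemma gr_red1 : gr_red 1 = 1.
Proof. exact: gr_red_elt. Qed.

Lemma gr_eltX (A : comPzRingType) (g : G) k : gr_elt A g ^+ k = gr_elt A (g ^+ k)%g.
Proof.
elim: k => [|k IHk]; first by [].
by rewrite exprS IHk expgSr gr_eltM.
Qed.

Lemma gr_sumE (A : comPzRingType) (u : group_ring A G) (f : G -> nat) :
  (forall g, u g = (f g)%:R) -> u = \sum_g gr_elt A g *+ f g.
Proof.
move=> uE; apply/ffunP => h; rewrite uE sum_ffunE (bigD1 h) //= big1 => [|g /negPf neq_gh].
  by rewrite ffunMnE ffunE eqxx addr0.
by rewrite ffunMnE ffunE eq_sym neq_gh mul0rn.
Qed.

Section Universal.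
Variables (V : gmodType G) (h : 'I_m.+1 -> mod_multiples q_gt1 V).
Local Notation J := (mod_multiples q_gt1 V).
Hypothesis h_rel : gr_elt _ sigma *: h ord0 - h ord0 *~ d = \sum_(j < m) h (lift ord0 j) *+ p ^ j.
Hypothesis h_fix : forall j : 'I_m, match lv j with
  | Some k => gr_elt _ (sigma ^+ (p ^ k))%g *: h (lift ord0 j) = h (lift ord0 j)
  | None => h (lift ord0 j) = 0 end.

Definition row_map (v : 'rV[ZpG]_m.+1) : J := \sum_i gr_red (v 0 i) *: h i.

Lemma row_map_additive : zmod_morphism row_map.
Proof.
move=> u v; rewrite /row_map -sumrB; apply: eq_bigr => i _.
by rewrite !mxE raddfB scalerBl.
Qed.
HB.instance Definition _ := GRing.isZmodMorphism.Build 'rV[ZpG]_m.+1 J row_map row_map_additive.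

Lemma row_mapZ c v : row_map (c *: v) = gr_red c *: row_map v.
Proof.
rewrite /row_map scaler_sumr; apply: eq_bigr => i _.
by rewrite mxE gr_redM scalerA.
Qed.

Lemma row_map_delta i : row_map (delta_mx 0 i) = h i.
Proof.
rewrite /row_map (bigD1 i) //= mxE !eqxx gr_red1 scale1r big1 ?addr0 // => k /negPf neq_ki.
by rewrite mxE neq_ki andbF raddf0 scale0r.
Qed.

Lemma row_map_relations v : v \in submod_gen (X_relations p sigma lv d) -> row_map v = 0.
Proof.
move=> /asboolP gen_v; suff : v \in [pred v | row_map v == 0] by move/eqP.
apply: gen_v.
  split=> [|c u w]; rewrite ?inE ?raddf0 // => /eqP u0 /eqP w0.
  by rewrite raddfD /= row_mapZ u0 w0 scaler0 addr0.
move=> u; rewrite inE => /orP[/eqP ->|/mapP[j _ ->]]; rewrite inE raddfB /= row_mapZ row_map_delta subr_eq0.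
  apply/eqP; rewrite raddfB /= gr_red_elt scalerBl raddfMz /= gr_red1 scaler_int h_rel raddf_sum.
  by apply: eq_bigr => j _; rewrite raddfMn /= row_map_delta.
rewrite /X_sigma_pow; have := h_fix j; case: (lv j) => [k|] hj.
  by rewrite gr_eltX gr_red_elt hj.
by rewrite raddf0 scale0r hj.
Qed.

(** The map on the free module factors through the relations ([f1]), then through the multiples of
    p^m ([f2]), which the target kills. *)
Lemma ex_universal_map : exists f : {linear XX -> J},
  forall i, f (\pi_(Quotient.quot (multiples q X))%qT (piX (delta_mx 0 i))) = h i.
Proof.
pose f1 (x : X) : J := row_map (generic_quotient.repr x).
have f1_pi v : f1 (piX v) = row_map v.
  apply/eqP; rewrite -subr_eq0 -raddfB; apply/eqP/row_map_relations.
  by rewrite Quotient.idealrBE generic_quotient.reprK.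
have f1B : {morph f1 : x y / x - y}.
  move=> x y; rewrite -[x]generic_quotient.reprK -[y]generic_quotient.reprK.
  by rewrite -[in LHS]raddfB !f1_pi raddfB.
pose f1L : {additive X -> J} := HB.pack f1 (GRing.isZmodMorphism.Build X J f1 f1B).
have f1Z g x : f1 (gmod_act g x) = gr_elt _ g *: f1 x.
  rewrite -[x]generic_quotient.reprK; move: (generic_quotient.repr x) => v.
  have -> : gmod_act g (piX v : X) = piX (gr_elt _ g *: v) by exact: lmod_quot_pi.
  by rewrite !f1_pi row_mapZ gr_red_elt.
have Jq (z : J) : z *+ q = 0.
  rewrite -[z]generic_quotient.reprK -raddfMn; apply/(pi_eq0 q_gt1).
  by exists (generic_quotient.repr z).
pose f2 (x : XX) : J := f1L (generic_quotient.repr x).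
have f2_pi x : f2 (\pi_(Quotient.quot (multiples q X))%qT x) = f1L x.
  apply/eqP; rewrite -subr_eq0 -raddfB.
  have /asboolP[u ->] : generic_quotient.repr (\pi_(Quotient.quot (multiples q X))%qT x) - x \in multiples q X.
    by rewrite Quotient.idealrBE generic_quotient.reprK.
  by rewrite raddfMn Jq.
have f2_lin : linear f2.
  move=> u x y; rewrite -[x]generic_quotient.reprK -[y]generic_quotient.reprK.
  have -> : u *: (\pi_(Quotient.quot (multiples q X))%qT (generic_quotient.repr x) : XX) =
      \pi_(Quotient.quot (multiples q X))%qT (\sum_g gmod_act g (generic_quotient.repr x) *+ u g).
    exact: mod_multiples_pi.
  rewrite -raddfD !f2_pi raddfD raddf_sum; congr (_ + _).
  have uE : u = \sum_g gr_elt _ g *+ u g by apply: gr_sumE => g; rewrite natr_Zp.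
  rewrite {2}uE scaler_suml; apply: eq_bigr => g _.
  by rewrite raddfMn /= f1Z scalerMnl.
pose f2L : {linear XX -> J} := HB.pack f2 (GRing.isLinear.Build R XX J _ f2 f2_lin).
by exists f2L => i; rewrite /= f2_pi /= f1_pi row_map_delta.
Qed.
End Universal.

Definition X_gen (i : 'I_m.+1) : X := piX (delta_mx 0 i).
Local Notation piXX := (\pi_(Quotient.quot (multiples q X)))%qT.

Lemma pi_gr_red (u : ZpG) (z : X) : piXX (u *: z) = gr_red u *: (piXX z : XX).
Proof.
apply/esym; apply: etrans (mod_multiples_pi _ _ _) _.
have sumE : \sum_g gmod_act g z *+ gr_red u g = (\sum_g gr_elt _ g *+ (val (u g) m' : nat)) *: z.
  rewrite scaler_suml; apply: eq_bigr => g _; by rewrite ffunE -scalerMnl.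
rewrite sumE; apply/eqP; rewrite eq_sym -Quotient.idealrBE -scalerBl; apply/asboolP.
set u1 := \sum_g _.
have /choice[w wE] : forall g, exists c', u g - (val (u g) m' : nat)%:R = c' *+ q.
  move=> g; apply: padic_div => //.
  have -> : val (u g - ((val (u g) m' : nat)%:R : padic p)) m' =
      (val (u g) m' : 'Z_q) - val ((val (u g) m' : nat)%:R : padic p) m' by [].
  by rewrite val_padicMn natr_Zp subrr.
exists (([ffun g => w g] : ZpG) *: z); rewrite scalerMnl; congr (_ *: _).
have u1E : u1 = ([ffun g => (val (u g) m' : nat)%:R] : ZpG) by apply/esym/gr_sumE => g; rewrite ffunE.
by apply/ffunP => g; rewrite u1E ffunMnE !ffunE -wE.
Qed.

Lemma XX_gen (v : XX) : exists c : 'I_m.+1 -> R, v = \sum_i c i *: (piXX (X_gen i) : XX).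
Proof.
rewrite -[v]generic_quotient.reprK; move: (generic_quotient.repr v) => z.
rewrite -[z]generic_quotient.reprK; move: (generic_quotient.repr z) => w.
exists (fun i => gr_red (w 0 i)).
rewrite {1}(row_sum_delta w) raddf_sum raddf_sum; apply: eq_bigr => i _.
rewrite -pi_gr_red; congr (piXX _); exact/esym/lmod_quot_pi.
Qed.

Lemma piX_scale c v : piX (c *: v) = c *: (piX v : X).
Proof. exact/esym/lmod_quot_pi. Qed.

Lemma piX_rel v : v \in X_relations p sigma lv d -> piX v = 0 :> X.
Proof.
move=> v_rel; apply/eqP; rewrite -[0](raddf0 piX) -Quotient.idealrBE subr0.
by apply/asboolP => W _; apply.
Qed.

Lemma X_rel : gr_elt _ sigma *: X_gen ord0 - X_gen ord0 *~ d = \sum_(j < m) X_gen (lift ord0 j) *+ p ^ j.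
Proof.
have := piX_rel (mem_head _ _); rewrite raddfB /= piX_scale scalerBl scaler_int => /subr0_eq ->.
by rewrite raddf_sum; apply: eq_bigr => j _; exact: raddfMn.
Qed.

Lemma X_fix (j : 'I_m) : match lv j with
  | Some k => gmod_act (sigma ^+ (p ^ k))%g (X_gen (lift ord0 j)) = X_gen (lift ord0 j)
  | None => X_gen (lift ord0 j) = 0 end.
Proof.
have : X_sigma_pow p sigma lv j *: X_gen_x p G j - X_gen_x p G j \in X_relations p sigma lv d.
  by rewrite in_cons; apply/orP; right; apply/imageP; exists j.
move=> /piX_rel; rewrite raddfB /= piX_scale /X_sigma_pow; case: (lv j) => [k|].
  by rewrite gr_eltX => /subr0_eq.
by rewrite scale0r => /subr0_eq.
Qed.
End Presentation.

(** * The copy of the presented module spanned by a minimal system *)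

Lemma scale_sum_recl (R : pzRingType) (U : lmodType R) k (c : 'I_k.+1 -> R) (g : 'I_k.+1 -> U) :
  \sum_i c i *: g i = c ord0 *: g ord0 + \sum_(j < k) c (lift ord0 j) *: g (lift ord0 j).
Proof. exact: big_ord_recl. Qed.

Section SystemModule.
Variables (p n m' : nat).
Hypothesis p_pr : prime p.
Local Notation m := m'.+1.
Local Notation q := (p ^ m)%N.
Hypothesis q_gt1 : (1 < q)%N.
Variables (G : finGroupType) (sigma : G).
Hypothesis sG : forall g : G, g \in <[sigma]>%g.
Local Notation R := (group_ring 'Z_q G).
Local Notation polymod_of V := (polymod (@gmod_act G V sigma : {additive V -> V})).
Local Notation pi V := (\pi_(Quotient.quot (multiples q V)))%qT.

Definition gr_coefs (c : 'I_m.+1 -> R) : {poly int} * ('I_m -> {poly int}) :=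
  (gr_poly sigma (c ord0), fun j => gr_poly sigma (c (lift ord0 j))).

Lemma pi_combine (V : gmodType G) (y : polymod_of V) (x : nat -> polymod_of V) c :
  pi V (combine y x (gr_coefs c)) =
    c ord0 *: (pi V y : mod_multiples q_gt1 V)
      + \sum_(j < m) c (lift ord0 j) *: (pi V (x j) : mod_multiples q_gt1 V).
Proof.
rewrite /combine raddfD /=; congr (_ + _); first exact: (pi_gr_poly q_gt1 sG).
by rewrite raddf_sum; apply: eq_bigr => j _; exact: (pi_gr_poly q_gt1 sG).
Qed.

Lemma pi_eq0_dvd_pm (V : gmodType G) (z : polymod_of V) :
  pi V z = 0 :> mod_multiples q_gt1 V <-> dvd_pm p m z.
Proof.
split=> [/pi_eq0[w ->]|[w ->]].
  by exists w; rewrite -natrX polymod_natr.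
by apply/pi_eq0; exists w; rewrite -natrX polymod_natr.
Qed.

Section System.
Variables (V : gmodType G).
Local Notation A := (polymod_of V).
Local Notation J := (mod_multiples q_gt1 V).
Local Notation piV := (pi V).
Variables (xi : A) (kmA : kummer_module p n m xi) (a : nat -> nat) (e : int) (y : A) (x : nat -> A).
Hypothesis sigma_n : (sigma ^+ (p ^ n) = 1)%g.
Hypothesis min_a : minimal_sys p n m xi a.
Hypothesis sys : system p n m a e y x xi.
Variable lv : 'I_m -> option 'I_n.+1.
Hypothesis lvE : forall (j : 'I_m), a j = if lv j is Some i then i.+1 else 0%N.
Local Notation d := (1 + p%:Z * e).
Local Notation X := (X_module p sigma lv d).
Local Notation XX := (mod_multiples q_gt1 X).
Local Notation X_gen := (X_gen p sigma lv d).
Local Notation piX := (pi X).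

Lemma rel_scaleE (W : gmodType G) (z : polymod_of W) :
  ('X - 1 - p%:R * e%:P) *: z = gmod_act sigma (z : W) - z *~ d.
Proof.
rewrite -polyC_natr -polyCM !scalerBl scale1r polymodX polymodC natz.
by rewrite mulrzDr mulr1z opprD addrA.
Qed.

Lemma fixed'_scaleE (W : gmodType G) (j : 'I_m) (z : polymod_of W) :
  fixed' p (a j) z <-> match lv j with
  | Some k => gmod_act (sigma ^+ (p ^ k))%g (z : W) = z | None => z = 0 end.
Proof.
rewrite lvE; case: (lv j) => [k|] //=.
rewrite /fixed scalerBl scale1r polymodXn -gmod_actX.
by split=> [/subr0_eq|->]; rewrite ?subrr.
Qed.

(** For W the presented module itself, this says that coefficients in [rel_pm] give zero modulo p^m,
    whence the injectivity in [ex_system_map]. *)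
Lemma pi_rel_pm (W : gmodType G) (y0 : W) (x0 : 'I_m -> W) (c : 'I_m.+1 -> R) :
    gmod_act sigma y0 - y0 *~ d = \sum_(j < m) x0 j *+ p ^ j ->
    (forall j, match lv j with
      | Some k => gmod_act (sigma ^+ (p ^ k))%g (x0 j) = x0 j | None => x0 j = 0 end) ->
    rel_pm p n a e (gr_coefs c) ->
  c ord0 *: (pi W y0 : mod_multiples q_gt1 W)
    + \sum_(j < m) c (lift ord0 j) *: (pi W (x0 j) : mod_multiples q_gt1 W) = 0.
Proof.
move=> rel fix_x rel_c.
pose x1 k : polymod_of W := if insub k is Some j then x0 j else 0.
have x1E (j : 'I_m) : x1 j = x0 j by rewrite /x1 valK.
have : dvd_pm p m (combine (y0 : polymod_of W) x1 (gr_coefs c)).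
  apply: (@rel_pm_dvd p n m (polymod_of W) a e _ _ 0 _ _ _ _ rel_c).
  - rewrite scalerBl scale1r polymodXn -gmod_actX sigma_n gmod_act1; exact: subrr.
  - move=> j; apply/fixed'_scaleE; rewrite x1E; exact: fix_x.
  rewrite scaler0 addr0 rel_scaleE rel.
  by apply: eq_bigr => j _; rewrite x1E -natrX polymod_natr.
move=> /pi_eq0_dvd_pm; rewrite pi_combine.
by under eq_bigr do rewrite x1E.
Qed.

Lemma XX_gen_recl (v : XX) : exists c : 'I_m.+1 -> R,
  v = c ord0 *: (piX (X_gen ord0) : XX) + \sum_(j < m) c (lift ord0 j) *: (piX (X_gen (lift ord0 j)) : XX).
Proof. by have [c ->] := XX_gen p_pr v; exists c; apply: scale_sum_recl. Qed.

(** The map exists because the system satisfies the defining relations modulo p^m. It is injective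
    because, by [combine_rel], the only relations of the system modulo p^m are those of the
    presentation. *)
Lemma ex_system_map : exists f : {linear XX -> J},
  [/\ forall v, f v = 0 -> v = 0,
      (forall v, exists2 z, spanned p m y x z & f v = piV z)
    & forall z, spanned p m y x z -> exists v, f v = piV z].
Proof.
pose h (i : 'I_m.+1) : J := if unlift ord0 i is Some j then piV (x j) else piV y.
have h0 : h ord0 = piV y by rewrite /h unlift_none.
have hS j : h (lift ord0 j) = piV (x j) by rewrite /h liftK.
have [||f fE] := @ex_universal_map p n m' G sigma lv d q_gt1 V h.
- rewrite h0 gr_elt_scale // -raddfMz -raddfB -rel_scaleE.
  rewrite (sys_rel_full sys) raddfD /=.
  have -> : piV ((p%:R : {poly int}) ^+ m *: x m) = 0 :> J.
    by apply/pi_eq0_dvd_pm; exists (x m).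
  rewrite addr0 raddf_sum; apply: eq_bigr => j _; rewrite hS -natrX polymod_natr; exact: raddfMn.
- move=> j; rewrite hS; have := sys_fixed sys (ltn_ord j).
  move/fixed'_scaleE; case: (lv j) => [k|] xj; last by rewrite xj raddf0.
  by rewrite gr_elt_scale // xj.
have fcE c : f (c ord0 *: (piX (X_gen ord0) : XX)
    + \sum_(j < m) c (lift ord0 j) *: (piX (X_gen (lift ord0 j)) : XX)) =
    piV (combine y x (gr_coefs c)).
  rewrite pi_combine (linearD f) (linear_sum f); congr (_ + _).
    by rewrite (linearZ_LR f) -h0; congr (_ *: _); exact: fE.
  apply: eq_bigr => j _.
  by rewrite (linearZ_LR f) -hS; congr (_ *: _); exact: fE.
exists f; split.
- move=> v; have [c ->] := XX_gen_recl v; rewrite fcE => /pi_eq0_dvd_pm.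
  move=> /(combine_rel kmA min_a sys).
  apply: (pi_rel_pm (X_rel p sigma lv d)); exact: X_fix.
- move=> v; have [c ->] := XX_gen_recl v; exists (combine y x (gr_coefs c)) => //.
  exact: spanned_combine.
move=> z [c dvd_z].
have [u0 u0E] := pi_poly q_gt1 sigma V c.1.
have /choice[u uE] := fun j => pi_poly q_gt1 sigma V (c.2 j).
pose w (i : 'I_m.+1) := if unlift ord0 i is Some j then u j else u0.
eexists; apply: etrans (fcE w) _; rewrite pi_combine /w unlift_none -u0E.
under eq_bigr do rewrite liftK -uE.
have -> : piV z = piV (combine y x c) :> J.
  by apply/subr0_eq; rewrite -raddfB; apply/pi_eq0_dvd_pm.
by rewrite /combine raddfD /=; congr (_ + _); rewrite raddf_sum.
Qed.
End System.
End SystemModule.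

Section SystemModuleIndecomposable.
Variables (p n m' : nat).
Hypothesis p_pr : prime p.
Local Notation m := m'.+1.
Local Notation q := (p ^ m)%N.
Hypothesis q_gt1 : (1 < q)%N.
Variables (G : finGroupType) (sigma : G) (V : gmodType G).
Local Notation R := (group_ring 'Z_q G).
Local Notation A := (polymod (@gmod_act G V sigma : {additive V -> V})).
Local Notation piV := (\pi_(Quotient.quot (multiples q V)))%qT.
Local Notation J := (mod_multiples q_gt1 V).
Variables (xi : A) (kmA : kummer_module p n m xi) (a : nat -> nat) (e : int) (y : A) (x : nat -> A).
Hypothesis min_a : minimal_sys p n m xi a.
Hypothesis sys : system p n m a e y x xi.

(** Otherwise N_n y = p N_n w with N_n w in F, against independence. So the span of a system is not
    zero modulo p^m. *)
Lemma y_not_dvd_p w : y <> p%:R *: w.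
Proof.
move=> yE.
have [] := @minimal_lin_indep p n m A xi kmA void (fun=> 0%N) (fun=> 0) a e y x min_a sys
  1 (fun=> 0) (fun=> 0) (Nm p n *: w).
- exact/fixed_Nm/(km_fixed kmA).
- rewrite big_nil addr0 big1 ?addr0 => [|j _]; last by rewrite scale0r.
  by rewrite scale1r yE !scalerA mulrC.
rewrite dvdz1 => p1 _ _; have := prime_gt1 p_pr.
by move: p1; rewrite absz_nat => /eqP ->.
Qed.

(** Submodules of W correspond to submodules of K^x over Z[X] between the multiples of p^m and the
    span, to which [spanned_indecomposable] applies. *)
Lemma system_module_indecomposable (W : lmodType R) (f : {linear W -> J}) :
    (forall v, f v = 0 -> v = 0) ->
    (forall v, exists2 z, spanned p m y x z & f v = piV z) ->
    (forall z, spanned p m y x z -> exists v, f v = piV z) ->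
  indecomposable W.
Proof.
move=> f_ker f_im f_surj.
have f_inj : injective f.
  by move=> u v fE; apply/subr0_eq/f_ker; rewrite linearB fE; exact: subrr.
have spanned_y : spanned p m y x y.
  exists (1, fun=> 0); rewrite /combine scale1r big1 => [|j _]; last exact: scale0r.
  by rewrite addr0 subrr; exists 0; rewrite scaler0.
split.
  have [v fv] := f_surj y spanned_y; exists v; apply/eqP => v0.
  have /pi_eq0_dvd_pm[w yE] : piV y = 0 :> J by rewrite -fv v0 linear0.
  by apply: (@y_not_dvd_p (p%:R ^+ m' *: w)); rewrite scalerA -exprS.
move=> S1 S2 clS1 clS2 cap0 sumT.
pose S (B : {pred W}) (z : A) := exists2 v, v \in B & f v = piV z.
have SD B : submod_closed B -> forall z w, S B z -> S B w -> S B (z + w).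
  move=> [_ clB] z w [u Bu fu] [v Bv fv]; exists (1 *: u + v); first exact: clB.
  by rewrite scale1r linearD fu fv raddfD.
have SZ B : submod_closed B -> forall c z, S B z -> S B (c *: z).
  move=> [B0 clB] c z [u Bu fu]; have [d dE] := pi_poly q_gt1 sigma V c.
  exists (d *: u + 0); first exact: clB.
  by rewrite addr0 linearZ_LR fu -dE.
have Spm B : submod_closed B -> forall z, dvd_pm p m z -> S B z.
  move=> [B0 _] z /(pi_eq0_dvd_pm q_gt1) z0; exists 0 => //.
  by rewrite linear0 z0.
have Sspan B z : S B z -> spanned p m y x z.
  move=> [v _ fv]; have [w span_w fw] := f_im v.
  rewrite -[z](subrK w); apply: spannedD span_w; apply: spanned_pm.
  by apply/(pi_eq0_dvd_pm q_gt1); rewrite raddfB /= -fv -fw; exact: subrr.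
have [||S1T|S2T] := @spanned_indecomposable p n m A xi kmA a e y x min_a sys (S S1) (S S2)
  (SD _ clS1) (SZ _ clS1) (SD _ clS2) (SZ _ clS2) (Spm _ clS1) (Spm _ clS2) (Sspan _) (Sspan _).
- move=> z [u S1u fu] [v S2v fv]; apply/(pi_eq0_dvd_pm q_gt1).
  have uv : u = v by apply: f_inj; rewrite fu fv.
  by rewrite -fu (cap0 u) ?linear0 // uv.
- move=> z /f_surj[v fv]; have [u S1u [w S2w vE]] := sumT v.
  have [z1 _ fu] := f_im u; exists z1, (z - z1); split; last by rewrite addrC subrK.
    by exists u.
  by exists w => //; rewrite raddfB /= -fu -fv vE linearD addrAC subrr add0r.
- right=> v S2v; have [z span_z fv] := f_im v; have [u S1u fu] := S1T z span_z.
  by apply: cap0 => //; rewrite (_ : v = u) //; apply: f_inj; rewrite fu fv.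
left=> v S1v; have [z span_z fv] := f_im v; have [u S2u fu] := S2T z span_z.
by apply: cap0 => //; rewrite (_ : v = u) //; apply: f_inj; rewrite fu fv.
Qed.
End SystemModuleIndecomposable.

Lemma ex_fibre (I : choiceType) (E : I -> choiceType) (r : seq {i & E i}) (i : I) : uniq r ->
  exists s : seq (E i), [/\ uniq s, forall t, (t \in s) = (Tagged E t \in r)
    & forall (U : zmodType) (F : {i & E i} -> U),
        \sum_(t <- r | tag t == i) F t = \sum_(t <- s) F (Tagged E t)].
Proof.
elim: r => [|[j u] r IHr] /=; first by exists [::]; split=> // U F; rewrite !big_nil.
move=> /andP[u_r /IHr[s [uniq_s memE sumE]]].
have [eq_ji|neq_ji] := eqVneq j i; last first.
  exists s; split=> // [t|U F]; last by rewrite big_cons /= (negPf neq_ji) sumE.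
  rewrite in_cons memE; apply/esym/orb_idl => /eqP/(congr1 tag)/= ij.
  by rewrite ij eqxx in neq_ji.
subst j; exists (u :: s); split=> [|t|U F] /=.
- by rewrite uniq_s memE u_r.
- by rewrite !in_cons memE eq_Tagged.
by rewrite !big_cons /= eqxx sumE.
Qed.

(** * Decomposition of K^x modulo p^m *)

Section LevelVector.
Variables (p n m : nat) (A : lmodType {poly int}) (xi : A).
Local Notation fixed := (fixed p).
Hypothesis kmA : kummer_module p n m xi.
Variables (a : nat -> nat) (e : int) (y : A) (x : nat -> A).
Hypothesis sys : system p n m a e y x xi.

(** A preimage in K_i of [level_comb] under the norm, made of y, the x_j and the g. *)
Definition level_vec (i : nat) (E : choiceType) (g : E -> A) (r : seq E) (c : E -> int)
    (u0 : int) (u : 'I_m -> int) : A :=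
  (if i == n then u0%:P else 0) *: y + \sum_(j < m | a j == i.+1) (u j)%:P *: x j
    + \sum_(t <- r) (c t)%:P *: g t.

Lemma Nm_level_vec i (E : choiceType) (g : E -> A) r c u0 u :
  Nm p i *: level_vec i g r c u0 u = level_comb p n a y x i g r c u0 u.
Proof.
rewrite /level_vec /level_comb !scalerDr !scaler_sumr; congr (_ + _ + _).
- case: eqP => [->|_]; last by rewrite !scale0r scaler0.
  by rewrite !scalerA mulrC.
- by apply: eq_bigr => j _; rewrite !scalerA mulrC.
by apply: eq_bigr => t _; rewrite !scalerA mulrC.
Qed.

Lemma fixed_level_vec i (E : choiceType) (g : E -> A) r c u0 u : (forall t, fixed i (g t)) ->
  fixed i (level_vec i g r c u0 u).
Proof.
move=> gK; apply: fixedD; first apply: fixedD.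
- case: eqP => [->|_]; last by rewrite scale0r; apply: fixed00.
  exact/fixedZ/(km_fixed kmA).
- apply: fixed_sum => j /eqP aj; apply: fixedZ.
  by have := x_fixed sys j; rewrite aj.
by apply: fixed_sum => t _; apply: fixedZ.
Qed.
End LevelVector.

Section LevelFamily.
Variables (p n m : nat) (A : lmodType {poly int}) (xi : A).
Local Notation Zx := {poly int}.
Local Notation T i := ('X^(p ^ i) - 1 : Zx).
Local Notation N := (Nm p).
Local Notation p' := (p%:R : Zx).
Local Notation fixed := (fixed p).
Hypothesis kmA : kummer_module p n m xi.
Local Notation pideal := (pideal p).
Local Notation lower_norm := (lower_norm p n).
Variables (a : nat -> nat) (e : int) (y : A) (x : nat -> A).
Hypothesis min_a : minimal_sys p n m xi a.
Hypothesis sys : system p n m a e y x xi.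
Local Notation level_comb := (@level_comb p n m A a y x).

Variables (E : 'I_n.+1 -> choiceType) (g : forall i, E i -> A).
Hypothesis gK : forall (i : 'I_n.+1) (t : E i), fixed i (g t).
Hypothesis level_indep : forall (i : 'I_n.+1) r c u0 u, uniq r ->
    lower_norm i (level_comb i (g (i := i)) r c u0 u) ->
  [/\ (i : nat) = n -> (p %| u0)%Z, forall j : 'I_m, a j = i.+1 -> (p %| u j)%Z
    & {in r, forall t, (p %| c t)%Z}].

Local Notation I := {i & E i}.
Let g_ (t : I) := g (tagged t).

Lemma lin_indep_family (r : seq I) : uniq r ->
  lin_indep p n m a y x r (fun t => tag t) g_.
Proof.
move=> uniq_r.
apply: (lin_indep_levels (e := e) kmA (min_adm min_a) sys) => [t _|t _|i le_in u0 u v].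
- by rewrite -ltnS.
- exact: gK.
pose i' := inord i : 'I_n.+1; have i'E : (i' : nat) = i by rewrite inordK.
have [s [uniq_s memE sumE]] := ex_fibre i' uniq_r.
have -> : \sum_(t <- r | (tag t : nat) == i) (v t)%:P *: (N i *: g_ t) =
    \sum_(t <- s) (v (Tagged E t))%:P *: (N i *: g t).
  by rewrite -(sumE _ (fun t => (v t)%:P *: (N i *: g_ t))); apply: eq_bigl => t; rewrite -i'E.
move=> low; have := @level_indep i' s (fun t => v (Tagged E t)) u0 u uniq_s.
rewrite /level_comb i'E => /(_ low)[u0P uP vP]; split=> // t t_r ti.
have {ti} : tag t = i' by apply: ord_inj; rewrite i'E.
case: t t_r => j t t_r /= ji; subst j.
by apply: (vP t); rewrite memE.
Qed.

(** The generators of all levels are gathered into one list over the dependent sum of the index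
    types, to which the result on relations modulo p^m applies. *)
Lemma family_kernel (c : Zx * ('I_m -> Zx)) (r : forall i, seq (E i)) (ga : forall i, E i -> Zx) w :
    (forall i, uniq (r i)) ->
    combine y x c + \sum_i \sum_(t <- r i) ga i t *: g t = p' ^+ m *: w ->
  rel_pm p n a e c /\ forall i, {in r i, forall t, pideal m (T i) (ga i t)}.
Proof.
move=> uniq_r relE.
pose rr := [seq Tagged E t | i <- index_enum 'I_n.+1, t <- r i].
have uniq_rr : uniq rr.
  apply: allpairs_uniq_dep => [||[i t] [j u] _ _ //]; first exact: index_enum_uniq.
  by move=> i _; apply: uniq_r.
have mem_rr i t : t \in r i -> Tagged E t \in rr.
  by move=> t_r; apply/allpairsPdep; exists i, t; rewrite mem_index_enum.
have [q [qy qx qg]] : exists q, in_rel p n a e rr (fun t => tag t) m q c.1 c.2 (fun t => ga (tag t) (tagged t)).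
  apply: (@kernel_mod_expp p n m A xi kmA a e y x (min_adm min_a) sys I rr _ g_ _ _ _ m _ _ _ w) => //.
  - by move=> t _; rewrite -ltnS.
  - by move=> t _; apply: gK.
  - exact: lin_indep_family.
  by rewrite big_allpairs_dep.
split; first by exists q.
by move=> i t /mem_rr/qg.
Qed.

Lemma level_kernel (i : 'I_n.+1) (r : seq (E i)) (ga : E i -> Zx) w : uniq r ->
    \sum_(t <- r) ga t *: g t = p' ^+ m *: w ->
  {in r, forall t, pideal m (T i) (ga t)}.
Proof.
move=> uniq_r relE.
pose r' := dfwith (fun k : 'I_n.+1 => [::] : seq (E k)) r.
pose ga' := dfwith (fun (k : 'I_n.+1) (_ : E k) => 0 : Zx) ga.
have uniq_r' k : uniq (r' k) by rewrite /r'; case: dfwithP.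
have [|_ kerP] := @family_kernel (0, fun=> 0) r' ga' w uniq_r'.
  rewrite /combine scale0r add0r big1 ?add0r => [|j _]; last exact: scale0r.
  rewrite (bigD1 i) //= [X in _ + X]big1 => [|k neq_ki]; last first.
    by rewrite /r' dfwith_out ?big_nil // eq_sym.
  by rewrite addr0 /r' /ga' !dfwith_in.
by have := kerP i; rewrite /r' /ga' !dfwith_in.
Qed.
End LevelFamily.

Lemma telescope_cancel (U : zmodType) (b s t : U) : b + s = b + t + s - t.
Proof. by rewrite addrAC addrK. Qed.

Section LevelDecomposition.
Variables (p n m' : nat).
Hypothesis p_pr : prime p.
Local Notation m := m'.+1.
Local Notation q := (p ^ m)%N.
Hypothesis q_gt1 : (1 < q)%N.
Variables (G : finGroupType) (sigma : G).
Hypothesis sG : forall g : G, g \in <[sigma]>%g.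
Variable V : gmodType G.
Local Notation R := (group_ring 'Z_q G).
Local Notation A := (polymod (@gmod_act G V sigma : {additive V -> V})).
Local Notation piV := (\pi_(Quotient.quot (multiples q V)))%qT.
Local Notation J := (mod_multiples q_gt1 V).
Local Notation fixed := (fixed p).
Local Notation N := (Nm p).
Local Notation T i := ('X^(p ^ i) - 1 : {poly int}).
Variables (xi : A) (kmA : kummer_module p n m xi) (a : nat -> nat) (e : int) (y : A) (x : nat -> A).
Hypothesis min_a : minimal_sys p n m xi a.
Hypothesis sys : system p n m a e y x xi.
Local Notation level_comb := (@level_comb p n m A a y x).
Local Notation lower_norm := (lower_norm p n).

Variables (E : 'I_n.+1 -> choiceType) (g : forall i, E i -> A).
Hypothesis gK : forall (i : 'I_n.+1) (t : E i), fixed i (g t).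
Hypothesis level_span : forall (i : 'I_n.+1) v, fixed i v -> exists r c u0 u,
  lower_norm i (N i *: v - level_comb i (g (i := i)) r c u0 u).
Hypothesis level_indep : forall (i : 'I_n.+1) r c u0 u, uniq r ->
    lower_norm i (level_comb i (g (i := i)) r c u0 u) ->
  [/\ (i : nat) = n -> (p %| u0)%Z, forall j : 'I_m, a j = i.+1 -> (p %| u j)%Z
    & {in r, forall t, (p %| c t)%Z}].

Definition level_module (i : 'I_n.+1) : lmodType R :=
  span_module (fun t : E i => piV (g t) : J).

Lemma fixed_pideal (i k : nat) (z : A) c : fixed i z -> pideal p k (T i) c ->
  exists w, c *: z = (p%:R : {poly int}) ^+ k *: w.
Proof.
move=> zK [b [b' ->]]; exists (b *: z).
by rewrite scalerDl (mulrC (T i)) -!scalerA (zK : T i *: z = 0) scaler0 addr0.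
Qed.

Variables (W : lmodType R) (f : {linear W -> J}).
Hypothesis f_ker : forall v, f v = 0 -> v = 0.
Hypothesis f_im : forall v, exists2 z, spanned p m y x z & f v = piV z.
Hypothesis f_surj : forall z, spanned p m y x z -> exists v, f v = piV z.

Definition sum_map (v : W * famprod level_module) : J := f v.1 + \sum_i val (v.2 i).

Lemma sum_map_linear : linear sum_map.
Proof.
move=> c u v; rewrite /sum_map linearP scalerDr addrACA; congr (_ + _).
by rewrite scaler_sumr -big_split.
Qed.
HB.instance Definition _ := GRing.isLinear.Build R (W * famprod level_module)%type J _ sum_map sum_map_linear.

(** A relation in J lifts to one in K^x modulo p^m; by [family_kernel] its part in y and the x_j,
    and each term in a g, vanish separately. *)
Lemma sum_map_ker v : sum_map v = 0 -> v = 0.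
Proof.
case: v => v h; rewrite /sum_map /=.
have [z [c [w0 zE]] fv] := f_im v.
have hP i : {rd : seq (E i) * (E i -> R) | uniq rd.1 /\ val (h i) = \sum_(t <- rd.1) rd.2 t *: (piV (g t) : J)}.
  by apply: cid; have [r [d rdP]] := span_moduleP (h i); exists (r, d).
pose r i := (projT1 (hP i)).1; pose ga i t := gr_poly sigma ((projT1 (hP i)).2 t).
have uniq_r i : uniq (r i) by case: (projT2 (hP i)).
have hE i : val (h i) = piV (\sum_(t <- r i) ga i t *: g t).
  have [_ ->] := projT2 (hP i); rewrite raddf_sum; apply: eq_bigr => t _.
  exact/esym/(pi_gr_poly q_gt1 sG).
have {}zE : z = combine y x c + p%:R ^+ m *: w0 by rewrite -zE addrC subrK.
have -> : \sum_i val (h i) = \sum_i piV (\sum_(t <- r i) ga i t *: g t) :> J.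
  by apply: eq_bigr => i _; exact: hE.
rewrite fv -raddf_sum -raddfD => sum0.
have [w sumE] := (pi_eq0_dvd_pm q_gt1 (sigma := sigma) (V := V) _).1 sum0.
have relE : combine y x c + \sum_i \sum_(t <- r i) ga i t *: g t = p%:R ^+ m *: (w - w0).
  rewrite scalerBr -sumE zE; exact: telescope_cancel.
have [rel_c rel_g] := family_kernel kmA min_a sys gK level_indep uniq_r relE.
have v0 : v = 0.
  apply: f_ker; rewrite fv; apply/(pi_eq0_dvd_pm q_gt1); rewrite zE; apply: dvd_pmD; last by exists w0.
  exact/(combine_rel kmA min_a sys).
have h0 : h = 0.
  apply: functional_extensionality_dep => i; apply: val_inj; rewrite hE.
  apply/(pi_eq0_dvd_pm q_gt1); rewrite big_seq.
  elim/big_rec: _ => [|t s t_r IHs]; first by exists 0; rewrite scaler0.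
  by apply: dvd_pmD IHs; apply: (fixed_pideal (gK t)); apply: rel_g.
by rewrite v0 h0.
Qed.

Definition reached (z : A) := exists v, sum_map v = piV z.

Lemma reachedD z w : reached z -> reached w -> reached (z + w).
Proof. by move=> [u uE] [v vE]; exists (u + v); rewrite linearD /= uE vE raddfD. Qed.

Lemma reachedZ c z : reached z -> reached (c *: z).
Proof.
move=> [u uE]; have [d dE] := pi_poly q_gt1 sigma V c.
by exists (d *: u); rewrite linearZ_LR /= uE dE.
Qed.

Lemma reached_sum (K : Type) (s : seq K) (P : pred K) (F : K -> A) :
  (forall t, P t -> reached (F t)) -> reached (\sum_(t <- s | P t) F t).
Proof.
move=> FP; elim/big_rec: _ => [|t w Pt]; first by exists 0; rewrite linear0 raddf0.
by apply: reachedD; apply: FP.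
Qed.

Lemma reached_spanned z : spanned p m y x z -> reached z.
Proof.
move=> /f_surj[v vE]; exists (v, 0); rewrite /sum_map /= big1 ?addr0 //.
Qed.

Lemma reached_g i (t : E i) : reached (g t).
Proof.
pose w : level_module i := exist _ (piV (g t) : J) (span_gen _ t).
exists (0, dfwith (0 : famprod level_module) w).
rewrite /sum_map /= linear0 add0r (bigD1 i) //= dfwith_in big1 ?addr0 // => j neq_ji.
by rewrite dfwith_out // eq_sym.
Qed.

Lemma sum_map_surj z : exists v, sum_map v = z.
Proof.
have yx_spanned (c : {poly int} * ('I_m -> {poly int})) : reached (combine y x c).
  exact/reached_spanned/spanned_combine.
have yP : reached y.
  have := yx_spanned (1, fun=> 0); rewrite /combine scale1r big1 ?addr0 // => j _.
  exact: scale0r.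
have xP (j : 'I_m) : reached (x j).
  have := yx_spanned (0, fun k => (k == j)%:R).
  rewrite /combine scale0r add0r (bigD1 j) //= eqxx scale1r big1 ?addr0 // => k /negPf ->.
  by rewrite mulr0n scale0r.
have [|w [w' [[v vE] zE]]] := @span_mod_expp p n m A xi kmA reached reachedD reachedZ _ m
    (generic_quotient.repr z); last first.
  exists v; rewrite vE -[z]generic_quotient.reprK zE raddfD /=.
  have -> : piV ((p%:R : {poly int}) ^+ m *: w') = 0 :> J.
    by apply/(pi_eq0_dvd_pm q_gt1); exists w'.
  by rewrite addr0.
move=> i v le_in vK; pose i' := inord i : 'I_n.+1.
have i'E : (i' : nat) = i by rewrite inordK.
have [|r [c [u0 [u]]]] := @level_span i' v; first by rewrite i'E.
rewrite i'E -Nm_level_vec => low; exists (level_vec n a y x i (g (i := i')) r c u0 u); split=> //.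
  apply: reachedD; first apply: reachedD.
  - exact: reachedZ.
  - by apply: reached_sum => j _; apply: reachedZ.
  - by apply: reached_sum => t _; apply: reachedZ; apply: reached_g.
by apply: (fixed_level_vec kmA sys) => t; rewrite -i'E.
Qed.

Lemma level_decomposition : lmod_iso J (W * famprod level_module)%type.
Proof. exact: (lmod_iso_bij (f := sum_map) sum_map_ker sum_map_surj). Qed.
End LevelDecomposition.

(** * Freeness over the group rings of the quotients G_i *)

Section GroupRingMap.
Variables (A : comPzRingType) (G H : finGroupType) (phi : G -> H).
Hypothesis phiM : {morph phi : g h / (g * h)%g}.

Lemma gr_mapD : {morph @gr_map A G H phi : u v / u + v}.
Proof.
move=> u v; apply/ffunP => h; rewrite !ffunE -big_split.
by apply: eq_bigr => g _; rewrite ffunE.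
Qed.

Lemma gr_mapMn (u : group_ring A G) k : gr_map phi (u *+ k) = gr_map phi u *+ k.
Proof.
elim: k => [|k IHk]; last by rewrite !mulrS gr_mapD IHk.
by apply/ffunP => h; rewrite !ffunE big1 // => g _; rewrite ffunE.
Qed.

Lemma gr_map_elt g : gr_map phi (gr_elt A g) = gr_elt A (phi g).
Proof.
apply/ffunP => h; rewrite !ffunE; under eq_bigr do rewrite ffunE.
have [<-|neq_gh] := eqVneq (phi g) h.
  by rewrite (bigD1 g) //= !eqxx big1 ?addr0 // => k /andP[_ /negPf ->].
rewrite big1 // => k /eqP kh.
rewrite (_ : (k == g) = false) //; apply: contraNF neq_gh => /eqP <-; exact/eqP.
Qed.

Lemma map1g : phi 1%g = 1%g.
Proof. by apply: (mulgI (phi 1%g)); rewrite -phiM !mulg1. Qed.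

Lemma map_expg g k : phi (g ^+ k)%g = (phi g ^+ k)%g.
Proof. by elim: k => [|k IHk]; rewrite ?map1g // !expgS phiM IHk. Qed.

Lemma gr_map1 : gr_map phi (1 : group_ring A G) = 1.
Proof.
by rewrite -[LHS]/(gr_map phi (gr_elt A 1%g)) gr_map_elt map1g.
Qed.

Lemma gr_mapM : {morph @gr_map A G H phi : u v / u * v}.
Proof.
move=> u v; apply/ffunP => h; rewrite !ffunE.
under eq_bigr do rewrite ffunE.
under [RHS]eq_bigr do rewrite !ffunE mulr_sumr.
rewrite exchange_big /= [RHS](exchange_big_dep predT) //=; apply: eq_bigr => l _.
rewrite (big_pred1 (phi l)) => [|k]; last by rewrite eq_sym.
rewrite mulr_suml (reindex_inj (mulgI l)) /=.
apply: eq_big => [k|k _]; last by rewrite mulKg.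
by rewrite phiM -(inj_eq (mulgI (phi l)^-1)%g) mulKg.
Qed.

Variable t : H -> G.
Hypothesis tK : cancel t phi.

Definition gr_lift (s : group_ring A H) : group_ring A G :=
  [ffun g => if g == t (phi g) then s (phi g) else 0].

Lemma gr_liftK : cancel gr_lift (gr_map phi).
Proof.
move=> s; apply/ffunP => h; rewrite ffunE (bigD1 (t h)) ?tK //= ffunE tK eqxx big1 ?addr0 // => g.
by move=> /andP[/eqP gh /negPf neq_gt]; rewrite ffunE gh neq_gt.
Qed.
End GroupRingMap.

Section FreeDescent.
Variables (p n m' : nat).
Hypothesis p_pr : prime p.
Local Notation m := m'.+1.
Local Notation q := (p ^ m)%N.
Hypothesis q_gt1 : (1 < q)%N.
Variables (G : finGroupType) (sigma : G).
Hypothesis sG : forall g : G, g \in <[sigma]>%g.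
Variable V : gmodType G.
Local Notation R := (group_ring 'Z_q G).
Local Notation A := (polymod (@gmod_act G V sigma : {additive V -> V})).
Local Notation piV := (\pi_(Quotient.quot (multiples q V)))%qT.
Local Notation J := (mod_multiples q_gt1 V).
Local Notation fixed := (fixed p).
Local Notation T i := ('X^(p ^ i) - 1 : {poly int}).
Variables (H : finGroupType) (phi : G -> H) (t : H -> G) (i : nat).
Hypothesis phiM : {morph phi : g h / (g * h)%g}.
Hypothesis tK : cancel t phi.
Hypothesis phi_order : #[phi sigma]%g = (p ^ i)%N.
Local Notation S := (group_ring 'Z_q H).

(** Evaluating the lift of u at phi(sigma) gives the image of u; both p^m and T_i vanish there,
    phi(sigma) having order p^i. *)
Lemma pideal_gr_poly (u : R) : pideal p m (T i) (gr_poly sigma u) -> gr_map phi u = 0.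
Proof.
pose F (s : S) : S := gr_elt ('Z_q) (phi sigma) * s.
have F_add : zmod_morphism F by move=> s s'; apply: mulrBr.
pose f : {additive S -> S} := HB.pack F (GRing.isZmodMorphism.Build S S F F_add).
have fX k (s : S) : iter k f s = gr_elt ('Z_q) (phi sigma ^+ k)%g * s.
  elim: k => [|k IHk] /=; first by rewrite expg0 [gr_elt _ _](erefl (1 : S)) mul1r.
  by rewrite IHk /F mulrA expgSr gr_eltM.
have polyE : gr_poly sigma u *: (1 : polymod f) = gr_map phi u.
  have uE : u = \sum_g gr_elt _ g *+ u g by apply: gr_sumE => g; rewrite natr_Zp.
  transitivity (\sum_g gr_elt ('Z_q) (phi g) *+ u g); last first.
    rewrite [in RHS]uE (big_morph _ (gr_mapD phi) (_ : gr_map phi 0 = 0)).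
      by apply: eq_bigr => g _; rewrite gr_mapMn gr_map_elt.
    exact: (gr_mapMn phi 0 0).
  rewrite (eq_bigl (fun g => g \in <[sigma]>%g)) => [|g]; last by rewrite sG.
  rewrite big_cycle scaler_suml; apply: eq_bigr => k _.
  rewrite -mul_polyC -scalerA polymodXn polymodC fX mulr1 (map_expg phiM).
  by rewrite natz -pmulrn.
have T0 : T i *: (1 : polymod f) = 0.
  rewrite scalerBl scale1r polymodXn fX -phi_order expg_order mulr1; exact: subrr.
move=> [b [b' E]]; rewrite -polyE E scalerDl (mulrC (T i)) -!scalerA T0 scaler0 addr0.
rewrite -natrX polymod_natr; apply/ffunP => h; rewrite ffunMnE ffunE.
by rewrite -mulr_natr -(Zp_nat_mod q_gt1) modnn mulr0.
Qed.

Lemma act_fixed g h (z : A) : fixed i z -> phi g = phi h ->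
  gmod_act g (z : V) = gmod_act h (z : V).
Proof.
move=> zK; have /cycleP[k ->] := sG g; have /cycleP[l ->] := sG h.
have zX j : gmod_act (sigma ^+ (j * p ^ i))%g (z : V) = z.
  elim: j => [|j IHj]; first by rewrite gmod_act1.
  rewrite mulSn expgD gmod_actM (_ : gmod_act (sigma ^+ (p ^ i))%g (z : V) = z) //.
  move: (zK); rewrite /fixed scalerBl scale1r polymodXn -gmod_actX; exact: subr0_eq.
have zmod j : gmod_act (sigma ^+ j)%g (z : V) = gmod_act (sigma ^+ (j %% p ^ i))%g (z : V).
  by rewrite {1}(divn_eq j (p ^ i)) expgD gmod_actM zX.
rewrite !(map_expg phiM) => /eqP; rewrite eq_expg_mod_order phi_order => /eqP kl.
by rewrite zmod kl -zmod.
Qed.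

(** The kernel of phi fixes z, so the action on z depends only on the sums of coefficients over the
    fibres of phi. *)
Lemma scale_fixed (u u' : R) (z : A) : fixed i z -> gr_map phi u = gr_map phi u' ->
  u *: (piV z : J) = u' *: (piV z : J).
Proof.
move=> zK.
have JD (w : J) (a b : 'Z_q) : w *+ (a + b : 'Z_q)%R = w *+ a + w *+ b.
  rewrite -[w]generic_quotient.reprK -!raddfMn -raddfD; exact: mod_multiples_ZpD.
have Jsum (w : J) (P : pred G) (F : G -> 'Z_q) :
    w *+ (\sum_(g | P g) F g : 'Z_q)%R = \sum_(g | P g) w *+ F g.
  by apply: (big_morph (fun a : 'Z_q => w *+ a)) => [a b|]; [exact: JD | exact: mulr0n].
suff E u0 : u0 *: (piV z : J) = \sum_(h : H) (piV (gmod_act (t h) (z : V)) : J) *+ gr_map phi u0 h.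
  by move=> uu'; rewrite !E uu'.
rewrite -(pi_gr_poly q_gt1 sG) gr_poly_scale // raddf_sum (partition_big phi predT) //=.
apply: eq_bigr => h _; rewrite ffunE.
rewrite Jsum.
by apply: eq_bigr => g /eqP gh; rewrite raddfMn /= (@act_fixed g (t h)) // tK.
Qed.

Variables (E : choiceType) (g : E -> A).
Hypothesis gK : forall s, fixed i (g s).
Hypothesis indep : forall r ga w, uniq r ->
  \sum_(s <- r) ga s *: g s = (p%:R : {poly int}) ^+ m *: w ->
  {in r, forall s, pideal p m (T i) (ga s)}.
Local Notation Y := (span_module (fun s : E => piV (g s) : J)).

Lemma span_descent_data : descent_data Y (gr_map phi) (gr_lift phi t).
Proof.
split.
- exact: gr_mapD.
- exact: gr_mapM.
- exact: gr_map1.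
- exact: gr_liftK.
move=> u u' v uu'; apply: val_inj.
have [r [c [_ vE]]] := span_moduleP v.
have {}vE : val v = piV (\sum_(s <- r) gr_poly sigma (c s) *: g s).
  by rewrite vE raddf_sum; apply: eq_bigr => s _; exact/esym/(pi_gr_poly q_gt1 sG).
rewrite [LHS]/(u *: val v) [RHS]/(u' *: val v) vE; apply: scale_fixed => //.
by apply: fixed_sum => s _; apply: fixedZ.
Qed.

Lemma span_free : free_of_rank (descent span_descent_data) E.
Proof.
pose b s : Y := exist _ (piV (g s) : J) (span_gen _ s).
exists (fun s => to_descent span_descent_data (b s)); split=> [v|r c uniq_r sum0].
  have [r [c [_ vE]]] := span_moduleP v; exists r, (fun s => gr_map phi (c s)).
  have -> : v = \sum_(s <- r) c s *: b s by apply: val_inj; rewrite vE raddf_sum.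
  apply: eq_bigr => s _.
  exact/(descent_eq span_descent_data)/esym/gr_liftK.
have : \sum_(s <- r) gr_lift phi t (c s) *: b s = 0 by exact: sum0.
move=> /(congr1 val); rewrite raddf_sum => sum1.
have : piV (\sum_(s <- r) gr_poly sigma (gr_lift phi t (c s)) *: g s) = 0 :> J.
  by rewrite -[RHS]sum1 raddf_sum; apply: eq_bigr => s _; exact: (pi_gr_poly q_gt1 sG).
move=> /(pi_eq0_dvd_pm q_gt1 (sigma := sigma))[w wE] s s_r.
rewrite -[c s](gr_liftK tK); apply: pideal_gr_poly.
exact: (indep uniq_r wE).
Qed.
End FreeDescent.

Section Restriction.
Variables (p n : nat) (p_pr : prime p) (F : fieldType) (K : splittingFieldType F)
    (galK : galois 1 {:K}) (dimK : \dim {:K} = (p ^ n)%N)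
    (sigma : gal_of {:K}) (gal_sigma : 'Gal({:K} / 1)%g = <[sigma]>%g)
    (Ki : nat -> {subfield K})
    (dimKi : forall i : nat, (i <= n)%N -> \dim (Ki i) = (p ^ i)%N).
Variables (j : nat) (le_jn : (j <= n)%N).
Local Notation cast := (@normalField_cast F K {:K}%AS (Ki j)).
Let le_0jn : (0 <= j <= n)%N := le_jn.

Lemma cast_sigma : cast sigma = sigma_ p sigma Ki 0 j.
Proof. by rewrite /sigma_ expn0 expg1. Qed.

Lemma castM : {morph cast : g h / (g * h)%g}.
Proof.
move=> g h.
have memG k : k \in 'Gal({:K} / Ki 0)%g.
  by rewrite (gal_Ki galK dimK gal_sigma dimKi) // expn0 expg1 -gal_sigma mem_gal1.
have subK0 : (Ki 0 <= Ki j <= {:K})%VS by rewrite (sub_Ki galK dimK gal_sigma dimKi) // subvf.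
have /and3P[_ _ normK0] := galois_Ki galK dimK gal_sigma dimKi le_0jn.
exact: (normalField_castM subK0 normK0).
Qed.

Lemma order_cast : #[cast sigma]%g = (p ^ j)%N.
Proof. by rewrite cast_sigma (order_sigma_ p_pr galK dimK gal_sigma dimKi le_0jn) subn0. Qed.

Lemma cast_section : exists t, cancel t cast.
Proof.
suff /choice[t tK] : forall h, exists g, cast g = h by exists t.
move=> h.
have : h \in 'Gal(Ki j / Ki 0)%g.
  rewrite (K0E dimKi) gal_kHom ?sub1v //; apply/kHomP; split=> [x y xK yK|_ /vlineP[k ->]].
    exact: rmorphM.
  by rewrite linearZ rmorph1.
rewrite (gal_sigma_ galK dimK gal_sigma dimKi le_0jn) -cast_sigma => /cycleP[k ->].
by exists (sigma ^+ k)%g; rewrite (map_expg castM).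
Qed.
End Restriction.

Lemma lmod_iso_refl (R : pzRingType) (V : lmodType R) : lmod_iso V V.
Proof. by exists (idfun : {linear V -> V}); exists idfun. Qed.

Theorem theorem1 (p n m : nat) (p_pr : prime p) (n_gt0 : (0 < n)%N)
    (m_gt0 : (0 < m)%N) (F : fieldType) (K : splittingFieldType F)
    (galK : galois 1 {:K}) (dimK : \dim {:K} = (p ^ n)%N)
    (sigma : gal_of {:K}) (gal_sigma : 'Gal({:K} / 1)%g = <[sigma]>%g)
    (Ki : nat -> {subfield K})
    (dimKi : forall i : nat, (i <= n)%N -> \dim (Ki i) = (p ^ i)%N)
    (xi : F) (xi_prim : p.-primitive_root xi)
    (norm_m1 : p = 2%N -> n = 1%N ->
       exists2 b : K, b != 0 & galNorm 1 {:K} b = -1) :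
  let R := group_ring 'Z_(p ^ m) (gal_of {:K}) in
  let J : lmodType R := mod_multiples (prime_expn_gt1 p_pr m_gt0) (units K) in
  exists (a : 'I_m -> option 'I_n.+1) (d : int) (X : lmodType R)
         (Y : 'I_n.+1 -> lmodType R) (e : 'I_n.+1 -> choiceType),
    let XX : lmodType R := mod_multiples (prime_expn_gt1 p_pr m_gt0)
                             (X_module p sigma a d) in
    [/\ (d = 1 %[mod p])%Z,
        lmod_iso J (X * famprod Y)%type,
        indecomposable X /\ lmod_iso X XX,
        forall i : 'I_n.+1,
          exists2 M : lmodType (group_ring 'Z_(p ^ m) (gal_of (Ki i))),
            lmod_iso_via (gr_map (@normalField_cast F K {:K}%AS (Ki i))) (Y i) M
            & free_of_rank M (e i)
      & (forall i : 'I_n.+1, (i < n)%N ->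
           Fp_dim p
             (subquotient (norm_group p (Ki i)) (norm_group p (Ki i.+1)))
             (e i + {j : 'I_m | a j == Some i})%type) /\
        Fp_dim p
          (subquotient (norm_group p {:K}%AS) (multiples p (units F)))
          (e ord_max + unit + {j : 'I_m | a j == Some ord_max})%type ].
Proof.
case: m m_gt0 => [|m'] // {}m_gt0.
set q_gt1 := prime_expn_gt1 p_pr m_gt0.
have sG (g : gal_of {:K}) : g \in <[sigma]>%g by rewrite -gal_sigma mem_gal1.
have sigma_n : (sigma ^+ (p ^ n) = 1)%g.
  by rewrite -(order_sigma galK dimK gal_sigma) expg_order.
have kmA := units_kummer_module p_pr n_gt0 m_gt0 galK dimK gal_sigma dimKi xi_prim norm_m1.
have [a min_a] := ex_minimal_sys kmA.
have [e [y [x sys]]] := min_solv min_a.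
have lvE (j : 'I_m'.+1) : a j = if level_of n a j is Some i then i.+1 else 0%N.
  case lv_j: (level_of n a j) => [i|]; first by apply/eqP; rewrite -(level_ofE min_a) lv_j.
  by move: lv_j; rewrite /level_of; case: (a j).
(* The index types and generators are needed as functions of i, to define Y and the ranks. *)
have ld (i : 'I_n.+1) : {E : choiceType &
    {g : E -> polymod (@gmod_act _ (units K) sigma : {additive units K -> units K}) |
    level_data p m'.+1 Ki a y x i g}}.
  have [E Eld] := cid (ex_level_data n_gt0 m_gt0 galK dimK gal_sigma dimKi norm_m1 min_a sys i).
  by exists E; apply: cid.
pose E i := projT1 (ld i); pose g i : E i -> _ := projT1 (projT2 (ld i)).
have gP i : level_data p m'.+1 Ki a y x i (g i) by exact: (projT2 (projT2 (ld i))).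
have gK (i : 'I_n.+1) (t : E i) : fixed p i (g i t) by case: (gP i).
have g_span i v := let: And4 _ _ span _ := gP i in span v.
have g_indep i r c u0 u := let: And4 _ _ _ indep := gP i in indep r c u0 u.
have [f [f_ker f_im f_surj]] := ex_system_map p_pr q_gt1 sG kmA sigma_n min_a sys lvE.
exists (level_of n a), (1 + p%:Z * e),
  (mod_multiples q_gt1 (X_module p sigma (level_of n (m := m'.+1) a) (1 + p%:Z * e))).
exists (level_module q_gt1 g), E; split.
- by rewrite -modzDmr modzMr addr0.
- exact: (level_decomposition sG kmA min_a sys gK g_span g_indep f_ker f_im f_surj).
- split; last exact: lmod_iso_refl.
  exact: (system_module_indecomposable p_pr kmA min_a sys f_ker f_im f_surj).
- move=> i; have le_in : (i <= n)%N by rewrite -ltnS.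
  have [t tK] := cast_section galK dimK gal_sigma dimKi le_in.
  pose castM_i := castM galK dimK gal_sigma dimKi le_in.
  exists (descent (span_descent_data q_gt1 sG castM_i tK
    (order_cast p_pr galK dimK gal_sigma dimKi le_in) (gK i))).
    exact: lmod_iso_via_descent.
  apply: span_free => r ga w uniq_r relE.
  exact: (level_kernel kmA min_a sys gK g_indep uniq_r relE).
split=> [i lt_in|].
  by case: (gP i) => _ [/(_ lt_in) dimE _] _ _.
by case: (gP ord_max) => _ [_ /(_ erefl)]; rewrite (KnE dimK dimKi).
Qed.
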